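(* Suppose $T$ is NIP and $G$ is the definable semidirect product $H\rtimes K$, where $K$ is fsg and $H$ is dfg. Let $E_K$ be any Ellis subgroup of $S_K^{\mathrm{fs}}(\mathcal{U},M)$, let $\widehat{E_H}\subseteq S_H^{\mathrm{inv}}(\mathcal{U},M)$ be an Ellis subgroup consisting of types which are right dfg over $M$, and set $E_H:=K_M(\widehat{E_H})=F_M(\widehat{E_H})^{-1}$. Let $u_H\in E_H$ and $u_K\in E_K$ be the idempotents, let $\iota\colon E_H\to E_H$ be group inversion, and let $\alpha\colon K\times H\to H$ be $\alpha(k,h)=khk^{-1}$. Then: (1) $E_H$ is an Ellis subgroup of $S_H^{\mathrm{fs}}(\mathcal{U},M)$; (2) $\widehat{E_H}*E_K$ is an Ellis subgroup of $S_G^{\mathrm{inv}}(\mathcal{U},M)$ and every element is uniquely of the form $p*q$ with $p\in\widehat{E_H}$, $q\in E_K$; (3) $E_K*E_H$ is an Ellis subgroup of $S_G^{\mathrm{fs}}(\mathcal{U},M)$ and every element is uniquely of the form $q*p$ with $q\in E_K$, $p\in E_H$; (4) $p*q\mapsto q*K_M(p)$ defines a bijection $\widehat{E_H}*E_K\to E_K*E_H$; (5) $\nu_M\colon p*q\mapsto q*\iota\big(\alpha(q^{-1}\otimes K_M(p))*u_H\big)$ defines a group isomorphism $\widehat{E_H}*E_K\to E_K*E_H$; (6) $\nu'_M\colon p*q\mapsto u_K*q^{-1}*K_M(p)$ defines an anti-isomorphism $\widehat{E_H}*E_K\to E_K*E_H$.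
   Context: $\mathcal{U}$ monster model of $T$, $M\prec\mathcal{U}$ small. $G$ is a group definable over $\emptyset$ with $\emptyset$-definable subgroups $H,K$, $H$ normal, $H\cap K=\{1\}$, $H\cdot K=G$ (definable semidirect product); types on $H$ or $K$ are regarded as types on $G$. For a definable group $L$, $S_L^{\mathrm{inv}}(\mathcal{U},M)$ (resp. $S_L^{\mathrm{fs}}(\mathcal{U},M)$) is the set of global types on $L$ which are $M$-invariant (resp. finitely satisfiable in $M$). Newelski product: $\varphi(x,d)\in p*q$ iff $\varphi(x\cdot b,d)\in p$ where $b\models q|_{Md}$. Translates: $\varphi(x)\in c\cdot p\iff\varphi(c\cdot x)\in p$, $\varphi(x)\in p\cdot c\iff\varphi(x\cdot c)\in p$. $p^{-1}=\mathrm{tp}(a^{-1}/\mathcal{U})$ for $a\models p$. For $M$-invariant global types $r_x,s_y$, the Morley product $r_x\otimes s_y$ is $\mathrm{tp}(a,b/\mathcal{U})$ where $b\models s$ and $a\models r|_{\mathcal{U}b}$ (the $M$-invariant extension); $\alpha(r\otimes s)$ denotes the type of $\alpha(a,b)$. $L$ is fsg if some global type on $L$ is left fsg over $M$ (it and all its left translates finitely satisfiable in $M$); a type is right dfg over $M$ if it and all its right translates are $M$-definable, and $L$ is dfg if such a type exists. Ellis subgroup: $u*I$ for $I$ a minimal left ideal and $u\in I$ idempotent. Retraction $F_M$ (NIP): add predicate $\mathbf{P}$ for $M$, take a $|\mathcal{U}|^+$-saturated $(N',N)\succ(\mathcal{U},M)$; for $M$-invariant $p$ let $p|_N$ be the restriction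 to $N$ of its $M$-invariant extension to $N'$; $\theta(x,b)\in F_M(p)$ iff $\{\theta(x,b),\mathbf{P}(x)\}\cup p|_N$ is consistent. $K_M(p):=F_M(p^{-1})$, applied to sets elementwise. *)

(* Defs.v *)
From mathcomp Require Import all_boot.
From mathcomp Require Import boolp classical_sets functions cardinality.

Set Implicit Arguments.
Unset Strict Implicit.
Unset Printing Implicit Defensive.

Local Open Scope classical_set_scope.
Local Open Scope card_scope.

Record language := Language {
  fsym : Type;
  rsym : Type;
  far : fsym -> nat;
  rar : rsym -> nat }.

Inductive term (L : language) (V : Type) : Type :=
| Var of V
| App (f : fsym L) of ('I_(far f) -> term L V).

(* [form L V] is the type of L-formulas with free variables in [V]; a
   quantifier binds the variable [None] of a formula over [option V].  An
   L(A)-formula in the variables X is a formula over [X + A], the parameters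
   being variables that are only ever evaluated at themselves. *)
Inductive form (L : language) (V : Type) : Type :=
| Eq of term L V & term L V
| Atom (r : rsym L) of ('I_(rar r) -> term L V)
| Bot
| Imp of form L V & form L V
| All of form L (option V).

Arguments Bot {L V}.

Definition Neg L V (phi : form L V) : form L V := Imp phi Bot.

Record structure (L : language) := Structure {
  carrier :> Type;
  finterp : forall f : fsym L, ('I_(far f) -> carrier) -> carrier;
  rinterp : forall r : rsym L, ('I_(rar r) -> carrier) -> Prop;
  carrier_inh : inhabited carrier }.

Fixpoint term_map L V W (f : V -> W) (t : term L V) : term L W :=
  match t with
  | Var v => Var L (f v)
  | App g ts => App (fun i => term_map f (ts i))
  end.

Fixpoint form_map L V W (f : V -> W) (phi : form L V) {struct phi} : form L W :=
  match phi with
  | Eq s t => Eq (term_map f s) (term_map f t)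
  | Atom r ts => Atom (fun i => term_map f (ts i))
  | Bot => Bot
  | Imp phi1 phi2 => Imp (form_map f phi1) (form_map f phi2)
  | All phi1 => All (form_map (omap f) phi1)
  end.

Fixpoint eval L (N : structure L) V (v : V -> N) (t : term L V) : N :=
  match t with
  | Var x => v x
  | App g ts => @finterp L N g (fun i => eval v (ts i))
  end.

Fixpoint sat L (N : structure L) V (v : V -> N) (phi : form L V) {struct phi} :
    Prop :=
  match phi with
  | Eq s t => eval v s = eval v t
  | Atom r ts => @rinterp L N r (fun i => eval v (ts i))
  | Bot => False
  | Imp phi1 phi2 => sat v phi1 -> sat v phi2
  | All phi1 => forall x : N, sat (fun o => if o is Some y then v y else x) phi1
  end.

Definition join X Y A (a : X -> A) (b : Y -> A) (z : X + Y) : A :=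
  match z with inl x => a x | inr y => b y end.

Notation tup n A := ('I_n -> A).

(* phi(x, y) |-> phi(x, e) *)
Definition inst L X Y A (phi : form L (X + Y)) (e : Y -> A) : form L (X + A) :=
  form_map (join inl (fun y => inr (e y))) phi.

(* [holds a Phi]: the L(N)-formula Phi is true of the tuple [a] of N. *)
Definition holds L (N : structure L) X (a : X -> N) (Phi : form L (X + N)) :
  Prop := sat (join a id) Phi.

Definition models L (N : structure L) (T : set (form L void)) : Prop :=
  forall sigma, T sigma -> sat (of_void N) sigma.

Definition NIP L (T : set (form L void)) : Prop :=
  ~ exists (N : structure L) (n m : nat) (phi : form L ('I_n + 'I_m))
           (a : nat -> tup n N) (b : set nat -> tup m N),
      models N T /\ forall i S, sat (join (a i) (b S)) phi <-> S i.

Definition elementary L (N W : structure L) (j : N -> W) : Prop :=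
  forall (m : nat) (phi : form L 'I_m) (e : tup m N), sat (j \o e) phi <-> sat e phi.

Definition elem_substructure L (U : structure L) (M : set U) : Prop :=
  exists (N : structure L) (j : N -> U), elementary j /\ range j = M.

Definition automorphism L (U : structure L) (sigma : U -> U) : Prop :=
  bijective sigma /\ elementary sigma.

(* Phi is an L(A)-formula, for A a subset of the structure N. *)
Definition over L (N : structure L) X (A : set N) (Phi : form L (X + N)) : Prop :=
  exists (m : nat) (phi : form L (X + 'I_m)) (e : tup m N),
    (forall i, A (e i)) /\ Phi = inst phi e.

Definition definable L (N : structure L) X (A : set N) (D : set (X -> N)) : Prop :=
  exists Phi : form L (X + N), over A Phi /\ D = [set a | holds a Phi].

Definition fin_satisfiable L (N : structure L) X (pi : set (form L (X + N))) : Prop :=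
  forall F, finite_set F -> F `<=` pi ->
    exists a : X -> N, forall Phi, F Phi -> holds a Phi.

Definition saturated L (N : structure L) (small : set (set N)) : Prop :=
  forall (A : set N) (n : nat) (pi : set (form L ('I_n + N))),
    small A -> pi `<=` over A -> fin_satisfiable pi ->
    exists a : tup n N, forall Phi, pi Phi -> holds a Phi.

Definition strongly_homogeneous L (N : structure L) (small : set (set N)) : Prop :=
  forall (A : set N) (f : N -> N), small A ->
    (forall (m : nat) (phi : form L 'I_m) (e : tup m N), (forall i, A (e i)) ->
       (sat (f \o e) phi <-> sat e phi)) ->
    exists sigma, automorphism sigma /\ forall x, A x -> sigma x = f x.

Definition card_lt (kappa : Type) B (A : set B) : Prop := ~~ ([set: kappa] #<= A).

(* The cardinal |L| + aleph_0 is that of [form L nat]; [card_lt kappa] is the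
   smallness notion of the monster model. *)
Definition monster L (U : structure L) (kappa : Type) : Prop :=
  [/\ card_lt kappa [set: form L nat],
      saturated (@card_lt kappa U) &
      strongly_homogeneous (@card_lt kappa U)].

Section Types.
Variables (L : language) (U : structure L).

Definition gform X := form L (X + U).

Definition global_type X (p : set (gform X)) : Prop :=
  fin_satisfiable p /\ forall Phi, p Phi \/ p (Neg Phi).

(* The L(U)-formula defining the set D belongs to p.  As global types are closed
   under equivalence in U, this is independent of the choice of the formula; a
   formula such as "phi(f(x))", for f a definable map, is handled through the
   set it defines. *)
Definition concentrates X (p : set (gform X)) (D : set (X -> U)) : Prop :=
  exists Phi, p Phi /\ D = [set a | holds a Phi].

(* tp(f(a)/U) for a |= p, where f is a definable map with domain D:
   Phi(y) is in it iff Phi(f(x)) is in p. *)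
Definition push X Y (D : set (X -> U)) (f : (X -> U) -> (Y -> U))
    (p : set (gform X)) : set (gform Y) :=
  [set Phi | concentrates p [set a | D a /\ holds (f a) Phi]].

(* b |= q|_A *)
Definition realizes X (A : set U) (q : set (gform X)) (b : X -> U) : Prop :=
  forall Phi, q Phi -> over A Phi -> holds b Phi.

Definition invariant X (M : set U) (p : set (gform X)) : Prop :=
  forall sigma, automorphism sigma -> (forall x, M x -> sigma x = x) ->
  forall (m : nat) (phi : form L (X + 'I_m)) (d : tup m U),
    p (inst phi d) <-> p (inst phi (sigma \o d)).

Definition fs_in X (M : set U) (p : set (gform X)) : Prop :=
  forall Phi, p Phi -> exists a : X -> U, (forall x, M (a x)) /\ holds a Phi.

Definition definable_type X (M : set U) (p : set (gform X)) : Prop :=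
  forall (m : nat) (phi : form L (X + 'I_m)),
    definable M [set d : tup m U | p (inst phi d)].

(* tp(e/M) = tp(e'/M), for e in the elementary extension j : U -> W. *)
Definition same_type (M : set U) (W : structure L) (j : U -> W) (m : nat)
    (e : tup m W) (e' : tup m U) : Prop :=
  forall (k : nat) (psi : form L ('I_m + 'I_k)) (c : tup k U), (forall i, M (c i)) ->
    (sat (join e (j \o c)) psi <-> sat (join e' c) psi).

(* The M-invariant extension of the M-invariant type p to the elementary
   extension j : U -> W. *)
Definition inv_ext X (M : set U) (W : structure L) (j : U -> W)
    (p : set (gform X)) : set (form L (X + W)) :=
  [set Phi | exists (m : nat) (phi : form L (X + 'I_m)) (e : tup m W) (e' : tup m U),
     [/\ Phi = inst phi e, same_type M j e e' & p (inst phi e')]].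

(* tp(a, b/U), where b |= s and a |= r|_{Ub} in an elementary extension W. *)
Definition morley X Y (M : set U) (r : set (gform X)) (s : set (gform Y)) :
    set (gform (X + Y)) :=
  [set Phi | exists (W : structure L) (j : U -> W) (a : X -> W) (b : Y -> W),
     [/\ elementary j,
         forall Psi, s Psi -> sat (join b j) Psi,
         forall Psi, inv_ext M j r Psi -> over (range j `|` range b) Psi ->
           holds a Psi &
         sat (join (join a b) j) Phi]].

End Types.

Definition pair_language (L : language) : language :=
  @Language (fsym L) (option (rsym L)) (@far L)
    (fun r => if r is Some r' then rar r' else 1).

Definition pair_structure L (U : structure L) (M : set U) :
    structure (pair_language L) :=
  @Structure (pair_language L) U (@finterp L U)
    (fun r => match r return ('I_(@rar (pair_language L) r) -> U) -> Prop with
              | Some r' => @rinterp L U r'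
              | None => fun a => M (a ord0)
              end)
    (carrier_inh U).

Definition reduct L (N : structure (pair_language L)) : structure L :=
  @Structure L N (@finterp _ N) (fun r => @rinterp _ N (Some r)) (carrier_inh N).

Definition pred_of L (N : structure (pair_language L)) : set (reduct N) :=
  [set x | @rinterp _ N None (fun=> x)].

(* [N'] with its predicate is a |U|^+-saturated elementary extension, via j, of
   the pair (U, M). *)
Definition saturated_pair L (U : structure L) (M : set U)
    (N' : structure (pair_language L)) (j : U -> N') : Prop :=
  @elementary _ (pair_structure M) N' j /\
  @saturated _ N' [set A | A #<= [set: U]].

(* The consistency, with the theory of (N', N) with parameters, of
   {theta(x, b), P(x)} together with p|_N is finite satisfiability in N'. *)
Definition retraction L (U : structure L) (M : set U)
    (N' : structure (pair_language L)) (j : U -> N') X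
    (p : set (gform U X)) : set (gform U X) :=
  let pN := [set Psi | @inv_ext L U X M (reduct N') j p Psi /\
                       over (@pred_of L N') Psi] in
  [set Theta | forall F, finite_set F -> F `<=` pN ->
     exists a : X -> reduct N',
       [/\ sat (join a (j : U -> reduct N')) Theta,
           forall x, pred_of (a x) &
           forall Psi, F Psi -> holds a Psi]].

(* The operations are total on n-tuples and unspecified outside of [gset].
   Definability of the inverse and of the unit follows from that of the product. *)
Record def_group L (U : structure L) (n : nat) := DefGroup {
  gset :> set (tup n U);
  gmul : tup n U -> tup n U -> tup n U;
  ginv : tup n U -> tup n U;
  gone : tup n U;
  gmul_in : forall a b, gset a -> gset b -> gset (gmul a b);
  ginv_in : forall a, gset a -> gset (ginv a);
  gone_in : gset gone;
  gmulA : forall a b c, gset a -> gset b -> gset c ->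
            gmul a (gmul b c) = gmul (gmul a b) c;
  gmul1 : forall a, gset a -> gmul gone a = a /\ gmul a gone = a;
  gmulV : forall a, gset a -> gmul (ginv a) a = gone /\ gmul a (ginv a) = gone;
  gset_def : definable set0 gset;
  gmul_def : definable set0
    [set c : 'I_n + ('I_n + 'I_n) -> U |
       let a := c \o inl in let b := c \o inr \o inl in
       [/\ gset a, gset b & c \o inr \o inr = gmul a b]] }.

Section Groups.
Variables (L : language) (U : structure L) (n : nat) (G : def_group U n) (M : set U).

Definition def_subgroup (H : set (tup n U)) : Prop :=
  [/\ definable set0 H, H `<=` G, H (gone G),
      forall a b, H a -> H b -> H (gmul G a b) &
      forall a, H a -> H (ginv G a)].

Definition conj_by (k h : tup n U) : tup n U := gmul G (gmul G k h) (ginv G k).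

Definition semidirect (H K : set (tup n U)) : Prop :=
  [/\ def_subgroup H, def_subgroup K,
      forall g h, gset G g -> H h -> H (conj_by g h),
      H `&` K = [set gone G] &
      [set gmul G h k | h in H & k in K] = G].

(* Types on G; a type on a subgroup H of G is a type on G concentrated on H. *)
Notation gtp := (set (@gform L U 'I_n)).

Definition S_ (H : set (tup n U)) : set gtp :=
  [set p | global_type p /\ concentrates p H].

Definition S_inv (H : set (tup n U)) : set gtp := [set p | S_ H p /\ invariant M p].

Definition S_fs (H : set (tup n U)) : set gtp := [set p | S_ H p /\ fs_in M p].

Definition nprod (p q : gtp) : gtp :=
  [set Phi | exists (m : nat) (phi : form L ('I_n + 'I_m)) (d : tup m U) (b : tup n U),
     [/\ Phi = inst phi d, gset G b, realizes (M `|` range d) q b &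
         concentrates p [set a | gset G a /\ sat (join (gmul G a b) d) phi]]].

Definition translate_l (c : tup n U) (p : gtp) : gtp := push (gset G) (gmul G c) p.

Definition translate_r (p : gtp) (c : tup n U) : gtp := push (gset G) (gmul G ^~ c) p.

Definition type_inv (p : gtp) : gtp := push (gset G) (ginv G) p.

(* alpha(t) for a type t on K x H and alpha(k, h) = k h k^-1 *)
Definition type_conj (H K : set (tup n U)) (t : set (gform U ('I_n + 'I_n))) : gtp :=
  push [set c : 'I_n + 'I_n -> U | K (c \o inl) /\ H (c \o inr)]
       (fun c => conj_by (c \o inl) (c \o inr)) t.

Definition left_fsg (H : set (tup n U)) (p : gtp) : Prop :=
  [/\ S_ H p, fs_in M p & forall c, H c -> fs_in M (translate_l c p)].

Definition right_dfg (H : set (tup n U)) (p : gtp) : Prop :=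
  [/\ S_ H p, definable_type M p & forall c, H c -> definable_type M (translate_r p c)].

Definition fsg (H : set (tup n U)) : Prop := exists p, left_fsg H p.

Definition dfg (H : set (tup n U)) : Prop := exists p, right_dfg H p.

Definition K_map (N' : structure (pair_language L)) (j : U -> N') (p : gtp) : gtp :=
  retraction M j (type_inv p).

End Groups.

Section Ellis.
Variables (S : Type) (op : S -> S -> S).

Definition left_ideal (X I : set S) : Prop :=
  [/\ I !=set0, I `<=` X & forall x y, X x -> I y -> I (op x y)].

Definition minimal_left_ideal (X I : set S) : Prop :=
  left_ideal X I /\ forall J, left_ideal X J -> J `<=` I -> J = I.

Definition ellis_subgroup (X E : set S) : Prop :=
  exists (I : set S) (u : S),
    [/\ minimal_left_ideal X I, I u, op u u = u & E = [set op u x | x in I]].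

Definition is_idempotent_of (E : set S) (u : S) : Prop := E u /\ op u u = u.

Definition group_inversion (E : set S) (u : S) (iota : S -> S) : Prop :=
  forall x, E x -> [/\ E (iota x), op x (iota x) = u & op (iota x) x = u].

Definition set_op (A B : set S) : set S := [set op x y | x in A & y in B].

Definition unique_factorization (A B : set S) : Prop :=
  forall z, set_op A B z ->
    exists! xy : S * S, [/\ A xy.1, B xy.2 & z = op xy.1 xy.2].

End Ellis.

(* Main.v *)
(** If all right translates u.c of a type u on a definable group are M-invariant,
    then u.c depends only on tp(c/M), and hence u * t = u.b for every b |= t|_M.
    So, when u is idempotent, its right stabilizer is a normal subgroup and the
    Ellis subgroup of u is the quotient by it, u.c representing the class of c.
    Right dfg types have this property because definable types are invariant,
    and the idempotents of minimal left ideals of S_K^fs have it because K is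
    fsg.  As u_K is idempotent it acts trivially, by conjugation, on the quotient
    of H by the stabilizer of u_H; hence u_H * u_K has the property in G and
    (u_H * u_K).(c k) = u_H.c * u_K.k.

    By NIP F_M is a well defined map into finitely satisfiable types.  It is
    continuous and commutes with M-definable maps, so that F_M(t * r) = t * F_M(r)
    for t finitely satisfiable in M.  Put f(c) = K_M(u_H.c^-1).  As F_M preserves
    the type over M, f(c) determines the class of c, and moving F_M outside of
    products gives t * f(c) = f(h c) for h |= t|_M in H, and
    (u_K.k * f(c)) * (u_K.k' * f(c')) = u_K.kk' * f(k'^-1 c k' c').
    All the claims become computations in the semidirect product. *)

Require Import Defs.
From HB Require Import structures.
From Stdlib Require List.
From mathcomp Require Import all_boot.
From mathcomp Require Import boolp classical_sets functions cardinality.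

Set Implicit Arguments.
Unset Strict Implicit.
Unset Printing Implicit Defensive.

Local Open Scope classical_set_scope.
Local Open Scope card_scope.

(* ssreflect and eqtype shadow these two names. *)
Notation over := Defs.over.
Notation invariant := Defs.invariant.

(** Identities between types are checked on realizations: two sets of formulas coincide once a
    single tuple realizes both over every small set. Products of types thus become products of
    elements of G, and choices of realizations are absorbed by automorphisms.

    NIP enters at one place. If phi(x, d) and its negation were both consistent with P and p|_N,
    phi(x, d) would alternate on a Morley sequence of p in P(N'), and all subsequences of it having
    the same type over M, phi would have the independence property. Hence membership in F_M(p) is
    witnessed by a single formula of p|_N, which gives completeness, continuity and commutation with
    definable maps.

    No invariance of translates is established for the types f(c). Products with them are therefore
    computed before F_M is applied, where the factor on the right is definable over M and can be
    realized before or after a finitely satisfiable one.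

    On representatives, nu_M takes c k to k (k^-1 c k), the same group element in the other order,
    and nu'_M takes c k to its inverse k^-1 c^-1. *)

Lemma dependent_choice I (T : I -> Type) (P : forall i, T i -> Prop) :
  (forall i, exists x, P i x) -> exists f : forall i, T i, forall i, P i (f i).
Proof. by move=> h; exists (fun i => sval (cid (h i))) => i; exact: svalP (cid (h i)). Qed.

(** * Formulas and definable sets *)

Section Syntax.
Variable L : language.

Lemma term_map_comp V W X (f : V -> W) (g : W -> X) (t : term L V) :
  term_map g (term_map f t) = term_map (g \o f) t.
Proof. by elim: t => [v|h ts IH] //=; congr App; apply: funext => i; exact: IH. Qed.

Lemma omap_comp_ext V W X (f : V -> W) (g : W -> X) :
  omap g \o omap f = omap (g \o f).
Proof. by apply: funext => -[]. Qed.

Lemma form_map_comp V (phi : form L V) : forall W X (f : V -> W) (g : W -> X),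
  form_map g (form_map f phi) = form_map (g \o f) phi.
Proof.
elim: phi => {V} [V s t|V r ts||V p IHp q IHq|V p IHp] W X f g //=.
- by rewrite !term_map_comp.
- by congr Atom; apply: funext => i; rewrite term_map_comp.
- by rewrite IHp IHq.
- by rewrite IHp omap_comp_ext.
Qed.

Lemma eval_map (N : structure L) V W (f : V -> W) (v : W -> N) t :
  eval v (term_map f t) = eval (v \o f) t.
Proof. by elim: t => [x|h ts IH] //=; congr finterp; apply: funext => i; exact: IH. Qed.

Lemma sat_map (N : structure L) V (phi : form L V) : forall W (f : V -> W) (v : W -> N),
  sat v (form_map f phi) <-> sat (v \o f) phi.
Proof.
elim: phi => {V} [V s t|V r ts|V|V p IHp q IHq|V p IHp] W f v //=.
- by rewrite !eval_map.
- by under eq_fun do rewrite eval_map.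
- by rewrite IHp IHq.
- split=> h x; have := h x; rewrite IHp.
  + by congr sat; apply: funext => -[].
  + by move=> H; rewrite (_ : _ \o _ = (fun o => if o is Some y then v (f y) else x)) //; apply: funext => -[].
Qed.

Definition And (V : Type) (p q : form L V) := Neg (Imp p (Neg q)).
Definition Ex (V : Type) (p : form L (option V)) : form L V := Neg (All (Neg p)).

Lemma sat_And (N : structure L) V (v : V -> N) p q :
  sat v (And p q) <-> sat v p /\ sat v q.
Proof.
rewrite /=; split=> [h|[? ?] h]; last exact: h.
split; apply: contrapT => n; apply: h => // *; exact: n.
Qed.

Lemma sat_Ex (N : structure L) V (v : V -> N) p :
  sat v (Ex p) <-> exists x, sat (fun o => if o is Some y then v y else x) p.
Proof.
rewrite /=; split=> [h|[x h] h']; last exact: (h' x).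
by apply: contrapT => n; apply: h => x h; apply: n; exists x.
Qed.

Lemma sat_Neg (N : structure L) V (v : V -> N) (p : form L V) :
  sat v (Neg p) <-> ~ sat v p.
Proof. by []. Qed.

Lemma fin_list T (F : set T) : finite_set F -> exists s : list T, forall x, F x <-> List.In x s.
Proof.
elim/Pchoice: T => T in F *; move=> /finite_seqP[s ->]; exists s => x /=.
elim: s => //= a s IH; rewrite inE -IH; split.
  by case/orP => [/eqP->|]; [left|right].
by case=> [->|->]; rewrite ?eqxx ?orbT.
Qed.

Lemma list_fin T (s : list T) : finite_set [set x | List.In x s].
Proof.
elim: s => [|a s IH] /=.
  by rewrite (_ : [set _ | _] = set0) //; apply/predeqP.
rewrite (_ : [set _ | _] = [set a] `|` [set x | List.In x s]).
  by rewrite finite_setU; split=> //; exact: finite_set1.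
by apply/predeqP => x /=; split=> -[->|?]; [left|right|left|right].
Qed.

(** The conjunction is built once and is right in every structure, so that it can be evaluated in
    [U] as well as in [N']; [Q] carries along a restriction such as being over a given set of
    parameters. *)
Lemma finite_conj_closed V (Q : form L V -> Prop) (F : set (form L V)) :
  Q (Neg Bot) -> (forall p q, Q p -> Q q -> Q (And p q)) -> finite_set F -> F `<=` Q ->
  exists psi : form L V, Q psi /\ forall (N : structure L) (v : V -> N),
    sat v psi <-> forall Phi, F Phi -> sat v Phi.
Proof.
move=> Q0 QA /fin_list[s Fs] FQ.
suff [psi [Qpsi H]] : exists psi : form L V, Q psi /\ forall (N : structure L) (v : V -> N),
    sat v psi <-> forall Phi, List.In Phi s -> sat v Phi.
  by exists psi; split=> // N v; rewrite H; split=> h Phi /Fs; exact: h.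
have {FQ} : forall Phi, List.In Phi s -> Q Phi by move=> Phi /Fs/FQ.
elim: s {Fs} => [|a s IH] h; first by exists (Neg Bot); split=> // N v; split=> // _ [].
have [|psi [Qpsi H]] := IH; first by move=> Phi i; apply: h; right.
exists (And a psi); split; first by apply: QA => //; apply: h; left.
move=> N v; rewrite sat_And H /=; split.
  by move=> [ha hs] Phi [<-|/hs].
by move=> k; split=> [|Phi i]; apply: k; [left|right].
Qed.

Lemma finite_conj V (F : set (form L V)) : finite_set F ->
  exists psi : form L V, forall (N : structure L) (v : V -> N),
    sat v psi <-> forall Phi, F Phi -> sat v Phi.
Proof. by move=> fF; have [] := @finite_conj_closed V (fun=> True) F => // psi []; exists psi. Qed.

Definition ex_split (V : Type) n (z : V + 'I_n.+1) : option V + 'I_n :=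
  match z with
  | inl v => inl (Some v)
  | inr i => if unlift ord0 i is Some k then inr k else inl None
  end.

Fixpoint exn (V : Type) n : form L (V + 'I_n) -> form L V :=
  match n return form L (V + 'I_n) -> form L V with
  | 0 => fun p => form_map (fun z : V + 'I_0 => match z with inl v => v | inr i => match notF (ltn_ord i) with end end) p
  | n'.+1 => fun p => Ex (@exn (option V) n' (form_map (@ex_split V n') p))
  end.

Lemma sat_exn (N : structure L) n : forall V (v : V -> N) (p : form L (V + 'I_n)),
  sat v (exn p) <-> exists a : tup n N, sat (join v a) p.
Proof.
elim: n => [|n IH] V v p.
  rewrite /= sat_map; split=> [h|[a]].
    have [x] := carrier_inh N.
    exists (fun=> x); move: h; congr sat; apply: funext => -[//|i]; by case: i.
  by congr sat; apply: funext => -[//|i]; case: i.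
rewrite [exn p]/= sat_Ex; split.
  move=> [x /IH[a]]; rewrite sat_map => h.
  exists (fun i => if unlift ord0 i is Some k then a k else x).
  move: h; congr sat; apply: funext => -[//|i] /=; by case: unliftP.
move=> [a h]; exists (a ord0); apply/IH; exists (a \o lift ord0); rewrite sat_map.
by move: h; congr sat; apply: funext => -[//|i] /=; case: unliftP => [k ->|->].
Qed.

Definition exl (V : Type) n (p : form L ('I_n + V)) : form L V := exn (form_map (join inr inl) p).

Lemma sat_exl (N : structure L) n V (v : V -> N) (p : form L ('I_n + V)) :
  sat v (exl p) <-> exists a : tup n N, sat (join a v) p.
Proof.
rewrite sat_exn; split=> -[a h]; exists a; move: h; rewrite sat_map;
  by rewrite (_ : _ \o _ = join a v) //; apply: funext => -[].
Qed.

(** Variables come from arbitrary types, while the definitions of the statement only speak of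
    ['I_m]. Arities being finite, an expression uses finitely many variables, and finite supports
    allow the passage between the two. *)
Lemma term_support V (t : term L V) :
  exists (T : finType) (e : T -> V) (s : term L T), t = term_map e s.
Proof.
elim: t => [v|h ts IH]; first by exists unit, (fun=> v), (Var L tt).
have [T hT] := choice IH; have [e he] := dependent_choice hT; have [s hs] := dependent_choice he.
exists {i : 'I_(far h) & T i}, (fun z => e (tag z) (tagged z)),
  (App (fun i => term_map (fun x => Tagged T x) (s i))).
by rewrite /=; congr App; apply: funext => i; rewrite hs term_map_comp.
Qed.

Lemma form_support V (phi : form L V) :
  exists (T : finType) (e : T -> V) (psi : form L T), phi = form_map e psi.
Proof.
elim: phi => {V} [V s t|V r ts|V|V p IHp q IHq|V p IHp].
- have [T1 [e1 [s1 ->]]] := term_support s; have [T2 [e2 [s2 ->]]] := term_support t.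
  exists (T1 + T2)%type, (join e1 e2), (Eq (term_map inl s1) (term_map inr s2)).
  by rewrite /= !term_map_comp.
- have [T hT] := choice (fun i => term_support (ts i)).
  have [e he] := dependent_choice hT; have [s hs] := dependent_choice he.
  exists {i : 'I_(rar r) & T i}, (fun z => e (tag z) (tagged z)),
    (Atom (fun i => term_map (fun x => Tagged T x) (s i))).
  by rewrite /=; congr Atom; apply: funext => i; rewrite hs term_map_comp.
- by exists void, (of_void V), Bot.
- have [T1 [e1 [s1 ->]]] := IHp; have [T2 [e2 [s2 ->]]] := IHq.
  exists (T1 + T2)%type, (join e1 e2), (Imp (form_map inl s1) (form_map inr s2)).
  by rewrite /= !form_map_comp.
- have [T [e [s ->]]] := IHp.
  (* Under a quantifier, only the support variables sent to some [Some v] stay free; those sent to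
     [None] become the bound one. *)
  have [e' he'] : exists e' : {t : T | e t} -> V, forall z, e (val z) = Some (e' z).
    apply: (dependent_choice (P := fun (z : {t : T | e t}) v => e (val z) = Some v)) => -[t /= ht].
    by case: (e t) ht => // v _; exists v.
  have [g hg] : exists g : T -> option {t : T | e t}, forall t, omap e' (g t) = e t.
    apply: (dependent_choice (P := fun t o => omap e' o = e t)) => t.
    case E : (e t) => [v|]; last by exists None.
    have ht : e t by rewrite E.
    by exists (Some (exist _ t ht)) => /=; rewrite -he' /= E.
  exists {t : T | e t}, e', (All (form_map g s)); rewrite /= form_map_comp.
  by congr (All (form_map _ _)); apply: funext => t; rewrite -hg.
Qed.

Lemma form_ord V (phi : form L V) :
  exists m (e : 'I_m -> V) (psi : form L 'I_m), phi = form_map e psi.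
Proof.
have [T [e [psi ->]]] := form_support phi.
exists #|T|, (e \o enum_val), (form_map enum_rank psi); rewrite form_map_comp.
by congr form_map; apply: funext => t /=; rewrite enum_rankK.
Qed.

(** Only the second summand is reduced to a finite support: the variables [X] of a type have to stay
    as they are. *)
Lemma inst_ord X Y (phi : form L (X + Y)) :
  exists m (e : 'I_m -> Y) (psi : form L (X + 'I_m)),
    phi = form_map (join inl (inr \o e)) psi.
Proof.
have [T [e [psi ->]]] := form_support phi.
pose inR (z : X + Y) := if z is inr _ then true else false.
have [e' he'] : exists e' : {t : T | inR (e t)} -> Y, forall z, e (val z) = inr (e' z).
  apply: (dependent_choice (P := fun (z : {t : T | inR (e t)}) v => e (val z) = inr v)) => -[t /= ht].
  by case: (e t) ht => // v _; exists v.
have [g hg] : exists g : T -> X + {t : T | inR (e t)}, forall t, join inl (inr \o e') (g t) = e t.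
  apply: (dependent_choice (P := fun t o => join inl (inr \o e') o = e t)) => t.
  case E : (e t) => [v|v]; first by exists (inl v).
  have ht : inR (e t) by rewrite E.
  by exists (inr (exist _ t ht)) => /=; rewrite -he' /= E.
exists #|{: {t : T | inR (e t)}}|, (e' \o enum_val), (form_map (join inl (inr \o enum_rank) \o g) psi).
rewrite form_map_comp; congr form_map; apply: funext => t; rewrite -hg /=.
by case: (g t) => //= z; rewrite enum_rankK.
Qed.

Lemma elementary_sat (N W : structure L) (j : N -> W) V (phi : form L V) (v : V -> N) :
  elementary j -> sat (j \o v) phi <-> sat v phi.
Proof.
move=> ej; have [m [e [psi ->]]] := form_ord phi.
by rewrite !sat_map; exact: (ej _ psi (v \o e)).
Qed.

Lemma inst_sat (N : structure L) X Y A (phi : form L (X + Y)) (e : Y -> A) (a : X -> N) (b : A -> N) :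
  sat (join a b) (inst phi e) <-> sat (join a (b \o e)) phi.
Proof. by rewrite sat_map; have -> : join a b \o join inl (fun y => inr (e y)) = join a (b \o e) by apply: funext => -[]. Qed.

Lemma holds_inst (N : structure L) X Y (phi : form L (X + Y)) (e : Y -> N) (a : X -> N) :
  holds a (inst phi e) <-> sat (join a e) phi.
Proof. exact: inst_sat. Qed.

Lemma inst_inst_ord X Y A (phi : form L (X + Y)) (e : Y -> A) :
  exists m (e' : 'I_m -> Y) (psi : form L (X + 'I_m)), phi = inst psi e' /\ inst phi e = inst psi (e \o e').
Proof.
have [m [e' [psi E]]] := inst_ord phi; exists m, e', psi; split=> //.
by rewrite E /inst form_map_comp; congr form_map; apply: funext => -[].
Qed.

Lemma over_inst (N : structure L) X Y (A : set N) (phi : form L (X + Y)) (e : Y -> N) :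
  (forall y, A (e y)) -> over A (inst phi e).
Proof.
move=> h; have [m [e' [psi [_ ->]]]] := inst_inst_ord phi e.
exists m, psi, (e \o e'); split=> // i; exact: h.
Qed.

Lemma form_map_id V (phi : form L V) : form_map id phi = phi.
Proof. by have [m [e [psi ->]]] := form_ord phi; rewrite form_map_comp. Qed.

Lemma inst_id (N : structure L) X (Phi : form L (X + N)) : inst Phi id = Phi.
Proof.
rewrite -[RHS]form_map_id /inst; congr form_map; apply: funext => -[] //.
Qed.

Lemma over_setT (N : structure L) X (Phi : form L (X + N)) : over setT Phi.
Proof. by rewrite -(inst_id Phi); apply: over_inst. Qed.

Lemma over_sub (N : structure L) X (A B : set N) (Phi : form L (X + N)) :
  A `<=` B -> over A Phi -> over B Phi.
Proof. by move=> AB [m [phi [e [h ->]]]]; exists m, phi, e; split=> // i; apply: AB. Qed.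

Lemma over_And (N : structure L) X (A : set N) (p q : form L (X + N)) :
  over A p -> over A q -> over A (And p q).
Proof.
move=> [m [phi [e [h ->]]]] [m' [phi' [e' [h' ->]]]].
pose f (z : X + 'I_m) : X + ('I_m + 'I_m') := match z with inl x => inl x | inr i => inr (inl i) end.
pose f' (z : X + 'I_m') : X + ('I_m + 'I_m') := match z with inl x => inl x | inr i => inr (inr i) end.
have -> : And (inst phi e) (inst phi' e') = inst (And (form_map f phi) (form_map f' phi')) (join e e').
  rewrite -[RHS]/(And (inst (form_map f phi) _) (inst (form_map f' phi') _)) /inst !form_map_comp.
  have -> : join inl (inr \o join e e') \o f = join inl (inr \o e) by apply: funext => -[].
  by have -> : join inl (inr \o join e e') \o f' = join inl (inr \o e') by apply: funext => -[].
by apply: over_inst => -[].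
Qed.

Lemma finite_conj_over (N : structure L) X (A : set N) (F : set (form L (X + N))) :
  finite_set F -> F `<=` over A -> exists psi, over A psi /\ forall (W : structure L) (v : X + N -> W),
    sat v psi <-> forall Phi, F Phi -> sat v Phi.
Proof.
apply: finite_conj_closed; last exact: over_And.
by apply: (@over_inst N X void A (Neg Bot) (of_void N)) => -[].
Qed.

End Syntax.

(** * Cardinal estimates for small sets *)

Section Cardinality.

Lemma card_le_fun T T' (A : set T) (B : set T') (f : T -> T') :
  (forall x, A x -> B (f x)) -> (forall x y, A x -> A y -> f x = f y -> x = y) -> A #<= B.
Proof.
move=> fB fi; have [g] : $|{injfun A >-> B}|; last exact: inj_card_le.
apply/injfunPex; exists f => // x y; rewrite !inE; exact: fi.
Qed.

Lemma infinite_nat_inj T (A : set T) : infinite_set A ->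
  exists g : nat -> T, injective g /\ forall k, A (g k).
Proof.
elim/Ppointed: T => T in A *.
  by rewrite emptyE => /infinite_setN0[].
move=> /infiniteP/pcard_leP[f]; exists f; split=> [x y|k]; last exact: funS.
by apply: inj; rewrite inE.
Qed.

Lemma finite_card_le T T' (A : set T) (B : set T') : finite_set A -> infinite_set B -> A #<= B.
Proof. by move=> /finite_set_countable cA /infiniteP; exact: card_le_trans. Qed.

(* Hilbert's hotel *)
Lemma infinite_setU_card T (A F : set T) : infinite_set A -> finite_set F -> A `|` F #<= A.
Proof.
move=> iA /fin_list[s Fs]; have -> : F = [set x | List.In x s] by apply/predeqP.
elim: s {F Fs} => [|x s IH].
  by rewrite (_ : [set _ | _] = set0) ?setU0 //; apply/predeqP.
apply: card_le_trans IH; set B := A `|` [set y | List.In y s].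
have iB : infinite_set B by apply: sub_infinite_set iA => y; left.
have -> : A `|` [set y | List.In y (x :: s)] = B `|` [set x].
  apply/predeqP => y; split=> [[h|[<-|h]]|[[h|h]|->]].
  - by left; left.
  - by right.
  - by left; right.
  - by left.
  - by right; right.
  - by right; left.
have [g [gi gB]] := infinite_nat_inj iB.
case: (EM (B x)) => [Bx|nBx].
  by rewrite (_ : B `|` _ = B) // setUidl // => y ->.
pose h y := if pselect (y = x) then g 0 else
  if pselect (exists k, g k = y) is left e then g (sval (cid e)).+1 else y.
apply: (@card_le_fun _ _ _ _ h).
  move=> y By; rewrite /h; case: (pselect (y = x)) => [E|yx]; first exact: gB.
  by case: pselect => [e|ne]; [exact: gB|case: By].
have hx y : y = x -> h y = g 0 by move=> ->; rewrite /h; case: (pselect (x = x)).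
have hg k : h (g k) = g k.+1.
  rewrite /h; case: (pselect (g k = x)) => [E|nE]; first by case: nBx; rewrite -E.
  case: pselect => [e|ne]; last by case: ne; exists k.
  by case: (cid e) => l /= /gi ->.
have hn y : y <> x -> (~ exists k, g k = y) -> h y = y.
  by move=> nx ng; rewrite /h; case: (pselect (y = x)) => // nE; case: pselect.
have cases y : [\/ y = x, exists k, y = g k | y <> x /\ ~ exists k, g k = y].
  case: (EM (y = x)) => [|nx]; first by constructor 1.
  case: (EM (exists k, g k = y)) => [[k <-]|ng]; first by constructor 2; exists k.
  by constructor 3.
move=> y z _ _; case: (cases y) => [->|[k ->]|[ny gy]]; case: (cases z) => [->|[l ->]|[nz gz]]; rewrite ?hg ?(hx x) // ?(hn y) ?(hn z) //.
- by move/gi.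
- by move=> E; case: gz; exists 0.
- by move/gi.
- by move=> /gi[->].
- by move=> E; case: gz; exists k.+1.
- by move=> E; case: gy; exists 0.
- by move=> E; case: gy; exists l.+1.
Qed.

Lemma card_le_setU T T' (A F : set T) (B : set T') : infinite_set B -> A #<= B -> finite_set F ->
  A `|` F #<= B.
Proof.
move=> iB AB fF; case: (EM (finite_set A)) => [fA|iA].
  by apply: finite_card_le => //; rewrite finite_setU.
exact: card_le_trans (infinite_setU_card iA fF) AB.
Qed.

Section Small.
Variables (L : language) (kappa : Type).
Hypothesis kL : card_lt kappa [set: form L nat].

Lemma nat_le_form : [set: nat] #<= [set: form L nat].
Proof.
apply: (@card_le_fun _ _ _ _ (fun k : nat => Eq (Var L k) (Var L k))) => // x y _ _; by case.
Qed.

Lemma infinite_kappa : infinite_set [set: kappa].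
Proof.
move=> fk; move/negP: kL; apply; apply: card_le_trans nat_le_form.
exact: finite_set_countable.
Qed.

Lemma card_lt_countable T (A : set T) : countable A -> card_lt kappa A.
Proof.
move=> cA; apply/negP => h; move/negP: kL; apply.
by apply: card_le_trans nat_le_form; exact: card_le_trans cA.
Qed.

Lemma card_lt_setU T (A F : set T) : card_lt kappa A -> finite_set F -> card_lt kappa (A `|` F).
Proof.
move=> sA fF; apply/negP => h; case: (EM (finite_set A)) => [fA|iA].
  by apply: infinite_kappa; apply: card_le_finite h _; rewrite finite_setU.
by move/negP: sA; apply; apply: card_le_trans h _; exact: infinite_setU_card.
Qed.

Lemma card_lt_image T T' (A : set T) (f : T -> T') : card_lt kappa A -> card_lt kappa (f @` A).
Proof.
by move=> sA; apply/negP => h; move/negP: sA; apply; exact: card_le_trans h (card_image_le _ _).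
Qed.

End Small.
End Cardinality.

(** * Definable relations, definable maps and the group operations *)

Section Definable.
Variables (L : language) (U : structure L).

(** Definability without parameters, with variables from any type: substitutions and additional
    variables are then composition with a map, and parameters are put in afterwards by
    [definableI]. *)
Definition Def (V : Type) (R : (V -> U) -> Prop) :=
  exists phi : form L V, forall v, R v <-> sat v phi.

Lemma Def_iff V (R R' : (V -> U) -> Prop) : (forall v, R' v <-> R v) -> Def R -> Def R'.
Proof. by move=> h [phi H]; exists phi => v; rewrite h. Qed.

Lemma Def_sub V W (f : V -> W) (R : (V -> U) -> Prop) : Def R -> Def (fun w => R (w \o f)).
Proof. by move=> [phi H]; exists (form_map f phi) => v; rewrite sat_map. Qed.

Lemma Def_and V (R R' : (V -> U) -> Prop) : Def R -> Def R' -> Def (fun v => R v /\ R' v).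
Proof.
by move=> [phi H] [phi' H']; exists (And phi phi') => v; rewrite sat_And H H'.
Qed.

Lemma Def_ex V n (R : (V + 'I_n -> U) -> Prop) :
  Def R -> Def (fun v => exists c : tup n U, R (join v c)).
Proof.
by move=> [phi H]; exists (exn phi) => v; rewrite sat_exn; split=> -[c /H]; exists c.
Qed.

Lemma definable_iff X (A : set U) (D D' : set (X -> U)) : (forall a, D' a <-> D a) ->
  definable A D -> definable A D'.
Proof. by move=> h; rewrite (_ : D = D') //; apply/predeqP => a; rewrite h. Qed.

Lemma definableI X Y (A : set U) (R : (X + Y -> U) -> Prop) (e : Y -> U) :
  Def R -> (forall y, A (e y)) -> definable A [set a | R (join a e)].
Proof.
move=> [phi H] h; exists (inst phi e); split; first exact: over_inst.
by apply/predeqP => a /=; rewrite H holds_inst.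
Qed.

Lemma definableE X (A : set U) (D : set (X -> U)) : definable A D ->
  exists m (e : tup m U) (R : (X + 'I_m -> U) -> Prop),
    [/\ forall i, A (e i), Def R & D = [set a | R (join a e)]].
Proof.
move=> [Phi [[m [phi [e [h ->]]]] ->]].
exists m, e, (fun v => sat v phi); split=> //; first by exists phi.
by apply/predeqP => a /=; rewrite holds_inst.
Qed.

Lemma definable_Def X (D : set (X -> U)) : definable set0 D -> Def D.
Proof.
move=> /definableE[m [e [R [h [phi H] ->]]]].
have f : 'I_m -> X by move=> i; case: (h i).
exists (form_map (join id f) phi) => v; rewrite sat_map /= H.
suff -> : join v e = v \o join id f by [].
by apply: funext => -[//|i]; case: (h i).
Qed.

Lemma definable_holds X (A : set U) (Phi : form L (X + U)) :
  over A Phi -> definable A [set a | holds a Phi].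
Proof. by exists Phi. Qed.

Lemma definable_mono X (A B : set U) (D : set (X -> U)) : A `<=` B ->
  definable A D -> definable B D.
Proof. by move=> AB [Phi [o ->]]; exists Phi; split=> //; exact: over_sub o. Qed.

Lemma definable_and X (A : set U) (D D' : set (X -> U)) :
  definable A D -> definable A D' -> definable A (D `&` D').
Proof.
move=> /definableE[m [e [R [h HR ->]]]] /definableE[m' [e' [R' [h' HR' ->]]]].
pose f1 (z : X + 'I_m) : X + ('I_m + 'I_m') := match z with inl x => inl x | inr i => inr (inl i) end.
pose f2 (z : X + 'I_m') : X + ('I_m + 'I_m') := match z with inl x => inl x | inr i => inr (inr i) end.
apply: definable_iff (definableI (e := join e e') (Def_and (Def_sub f1 HR) (Def_sub f2 HR')) _).
  move=> a /=; rewrite (_ : join a _ \o f1 = join a e); last by apply: funext => -[].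
  by rewrite (_ : join a _ \o f2 = join a e') //; apply: funext => -[].
by case.
Qed.

Section Fun.
Variable n : nat.

(** Only the graph over [dom] has to be definable, because the group operations are unspecified
    outside [G]. *)
Definition dfun (V : Type) (dom : set (V -> U)) (g : (V -> U) -> tup n U) :=
  Def (fun v : V + 'I_n -> U => dom (v \o inl) /\ v \o inr = g (v \o inl)).

Lemma dfun_pre V Z (dom : set (V -> U)) g (R : ('I_n + Z -> U) -> Prop) : dfun dom g -> Def R ->
  Def (fun v : V + Z -> U => dom (v \o inl) /\ R (join (g (v \o inl)) (v \o inr))).
Proof.
move=> Hg HR.
pose f1 (z : V + 'I_n) : (V + Z) + 'I_n := match z with inl v => inl (inl v) | inr i => inr i end.
pose f2 (z : 'I_n + Z) : (V + Z) + 'I_n := match z with inl i => inr i | inr z => inl (inr z) end.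
have := Def_ex (Def_and (Def_sub f1 Hg) (Def_sub f2 HR)); apply: Def_iff => v.
have E1 c : (join v c \o f1) \o inl = v \o inl by [].
have E2 c : (join v c \o f1) \o inr = c by [].
have E3 c : join v c \o f2 = join c (v \o inr) by apply: funext => -[].
split=> [[d r]|[c []]].
  by exists (g (v \o inl)); rewrite E1 E2 E3.
by rewrite E1 E2 E3 => -[d ->].
Qed.

Lemma dfun_param X Y (dom : set (X + Y -> U)) g (b : Y -> U) (A : set U) (E : set (tup n U)) :
  dfun dom g -> (forall y, A (b y)) -> definable A E ->
  definable A [set x | dom (join x b) /\ E (g (join x b))].
Proof.
move=> Hg hb /definableE[m [e [R [he HR ->]]]].
pose f (z : (X + Y) + 'I_m) : X + (Y + 'I_m) :=
  match z with inl (inl x) => inl x | inl (inr y) => inr (inl y) | inr i => inr (inr i) end.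
apply: definable_iff (definableI (e := join b e) (Def_sub f (dfun_pre Hg HR)) _); last by case.
move=> a /=.
have E1 : (join a (join b e) \o f) \o inl = join a b by apply: funext => -[].
have E2 : (join a (join b e) \o f) \o inr = e by apply: funext.
by rewrite E1 E2.
Qed.

Lemma dfun_proj V (dom : set (V -> U)) (f : 'I_n -> V) : Def dom -> dfun dom (fun v => v \o f).
Proof.
move=> Hd; have [phi Hphi] : Def (fun v : V + 'I_n -> U => v \o inr = v \o (inl \o f)).
  have fF : finite_set (range (fun i : 'I_n => Eq (Var L (inr i)) (Var L (inl (f i))) : form L (V + 'I_n))).
    by apply: finite_image; exact: finite_finset.
  have [psi H] := finite_conj fF; exists psi => v; rewrite H; split.
    by move=> E _ [i _ <-] /=; have := congr1 (@^~ i) E.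
  by move=> h; apply: funext => i; exact: (h _ (imageP _ (a := i) I)).
apply: Def_iff (Def_and (Def_sub inl Hd) (ex_intro _ phi Hphi)) => v.
by [].
Qed.

Lemma dfun_comp V (dom : set (V -> U)) (g : (V -> U) -> tup n U) (dom' : set (tup n U))
    (g' : tup n U -> tup n U) :
  dfun dom g -> dfun dom' g' -> (forall v, dom v -> dom' (g v)) -> dfun dom (fun v => g' (g v)).
Proof.
move=> Hg Hg' h; apply: Def_iff (dfun_pre Hg Hg') => v; split.
  by move=> [d e]; split=> //; split; first exact: h.
by move=> [d [_ e]].
Qed.
End Fun.

Section Group.
Variables (n : nat) (G : def_group U n).

Lemma Def_G : Def (gset G). Proof. exact: definable_Def (gset_def G). Qed.

Lemma Def_GG : Def (fun v : 'I_n + 'I_n -> U => gset G (v \o inl) /\ gset G (v \o inr)).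
Proof. exact: Def_and (Def_sub inl Def_G) (Def_sub inr Def_G). Qed.

Lemma dfun_gmul : dfun (fun v : 'I_n + 'I_n -> U => gset G (v \o inl) /\ gset G (v \o inr))
  (fun v => gmul G (v \o inl) (v \o inr)).
Proof.
pose f (z : 'I_n + ('I_n + 'I_n)) : ('I_n + 'I_n) + 'I_n :=
  match z with inl i => inl (inl i) | inr (inl i) => inl (inr i) | inr (inr i) => inr i end.
apply: Def_iff (Def_sub f (definable_Def (gmul_def G))) => v.
by split=> [[[a b c]]|[a b c]].
Qed.

Lemma dfun_mul V (dom : set (V -> U)) g1 g2 :
  dfun dom g1 -> dfun dom g2 -> (forall v, dom v -> gset G (g1 v)) -> (forall v, dom v -> gset G (g2 v)) ->
  dfun dom (fun v => gmul G (g1 v) (g2 v)).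
Proof.
move=> H1 H2 h1 h2.
pose f1 (z : ('I_n + 'I_n) + 'I_n) : 'I_n + ('I_n + 'I_n) :=
  match z with inl (inl i) => inl i | inl (inr i) => inr (inl i) | inr i => inr (inr i) end.
have K1 := dfun_pre H1 (Def_sub f1 dfun_gmul).
pose f2 (z : V + ('I_n + 'I_n)) : 'I_n + (V + 'I_n) :=
  match z with inl v => inr (inl v) | inr (inl i) => inl i | inr (inr i) => inr (inr i) end.
have K2 := dfun_pre H2 (Def_sub f2 K1).
pose f3 (z : V + (V + 'I_n)) : V + 'I_n :=
  match z with inl v => inl v | inr (inl v) => inl v | inr (inr i) => inr i end.
apply: Def_iff (Def_sub f3 K2) => v.
have E1 : (v \o f3) \o inl = v \o inl by [].
set w := (v \o f3) in E1 *; rewrite E1.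
set w2 := join _ _ \o f2.
have E2 : w2 \o inl = v \o inl by apply: funext.
have E3 : w2 \o inr = join (g2 (v \o inl)) (v \o inr) by apply: funext => -[].
rewrite E2 E3; set w3 := _ \o f1.
have E4 : w3 \o inl \o inl = g1 (v \o inl) by apply: funext.
have E5 : w3 \o inl \o inr = g2 (v \o inl) by apply: funext.
have E6 : w3 \o inr = v \o inr by apply: funext.
rewrite E4 E5 E6; split=> [[d e]|[d [_ [_ e]]]] //.
by do !split=> //; [exact: h1|exact: h2].
Qed.

(** In a group the unit is the only solution of c = c c. *)
Lemma Def_one : Def (fun c : tup n U => c = gone G).
Proof.
pose f (z : ('I_n + 'I_n) + 'I_n) : 'I_n := match z with inl (inl i) => i | inl (inr i) => i | inr i => i end.
apply: Def_iff (Def_sub f dfun_gmul) => v; split.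
  move=> ->; have [g1] := gmul1 (gone_in G).
  by split=> //; split; exact: gone_in.
move=> [[Gv _] E]; have {}E : v = gmul G v v := E.
have [l r] := gmulV Gv; have iv := ginv_in Gv.
by rewrite -l {3}E gmulA // l; have [-> _] := gmul1 Gv.
Qed.

Lemma dfun_ginv : dfun (gset G) (ginv G).
Proof.
pose f (z : ('I_n + 'I_n) + 'I_n) : ('I_n + 'I_n) + 'I_n := match z with inl (inl i) => inl (inr i) | inl (inr i) => inl (inl i) | inr i => inr i end.
apply: Def_iff (Def_ex (Def_and (Def_sub inr Def_one) (Def_sub f dfun_gmul))) => v.
have E1 c : ((join v c \o f) \o inl) \o inl = v \o inr by apply: funext.
have E2 c : ((join v c \o f) \o inl) \o inr = v \o inl by apply: funext.
have E3 c : (join v c \o f) \o inr = c by apply: funext.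
have E4 c : join v c \o inr = c by apply: funext.
split.
  move=> [Gv E]; exists (gone G); rewrite E1 E2 E3 E4 E.
  by have [-> _] := gmulV Gv; do !split=> //; exact: ginv_in.
move=> [c []]; rewrite E1 E2 E3 E4 => -> [[Gr Gl] E]; split=> //.
have iv := ginv_in Gl; have [l r] := gmulV Gl.
by have [_ <-] := gmul1 Gr; rewrite -r gmulA // -E; have [-> _] := gmul1 iv.
Qed.

End Group.
End Definable.

(** * Global types and the Newelski product *)

Section GlobalTypes.
Variables (L : language) (U : structure L).

(** An equivalence where [realizes] has an implication. For global types the two agree, but this one
    is also informative for a set of formulas whose completeness is still to be proved. *)
Definition Real X (A : set U) (p : set (@gform L U X)) (a : X -> U) :=
  forall Phi, over A Phi -> (p Phi <-> holds a Phi).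

Definition fixes (A : set U) (sigma : U -> U) := forall x, A x -> sigma x = x.

Section Basic.
Variables (X : Type) (p : set (@gform L U X)).
Hypothesis gp : global_type p.

Lemma gt_and (Phi Psi Chi : gform U X) : p Phi -> p Psi ->
  (forall a, holds a Phi -> holds a Psi -> holds a Chi) -> p Chi.
Proof.
move=> p1 p2 h; have [fs cp] := gp; case: (cp Chi) => // pn.
have [] := fs [set Phi; Psi; Neg Chi].
- exact: finite_set3.
- by move=> _ [[->|->]|->].
move=> a ha; have : holds a (Neg Chi) by apply: ha; right.
by case; apply: h; apply: ha; left; [left|right].
Qed.

Lemma gt_sub (Phi Psi : gform U X) : p Phi -> (forall a, holds a Phi -> holds a Psi) -> p Psi.
Proof. by move=> p1 h; apply: (gt_and p1 p1) => a + _; exact: h. Qed.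

Lemma gt_nonempty (Phi : gform U X) : p Phi -> exists a, holds a Phi.
Proof.
move=> p1; have [fs _] := gp; have [|_ ->|a ha] := fs [set Phi].
- exact: finite_set1.
- by [].
- by exists a; apply: ha.
Qed.

Lemma gt_neg (Phi : gform U X) : p (Neg Phi) <-> ~ p Phi.
Proof.
split=> [n y|]; last by case: gp => _ /(_ Phi)[].
have [a []] : exists a : X -> U, holds a Bot by apply/gt_nonempty/(gt_and n y).
Qed.

Lemma conc_holds (Phi : gform U X) : concentrates p [set a | holds a Phi] <-> p Phi.
Proof.
split=> [[Psi [pP E]]|pP]; last by exists Phi.
by apply: gt_sub pP _ => a ha; have : [set a | holds a Psi] a by []; rewrite -E.
Qed.

Lemma conc_real A a (D : set (X -> U)) : Real A p a -> definable A D ->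
  (concentrates p D <-> D a).
Proof. by move=> R [Phi [o ->]]; rewrite conc_holds; exact: R. Qed.

Lemma realizes_Real A a : realizes A p a <-> Real A p a.
Proof.
split=> [h Phi o|h Phi pP o]; last by apply/h.
split=> [pP|]; first exact: h.
apply: contraPP => /gt_neg n; apply: h n _.
by case: o => m [phi [e [he ->]]]; exact: (over_inst (Neg phi)).
Qed.

End Basic.

Lemma Real_sub X (A B : set U) (p : set (@gform L U X)) a : A `<=` B -> Real B p a -> Real A p a.
Proof. by move=> s R Phi o; apply: R; exact: over_sub o. Qed.

Lemma finite_over X (F : set (@gform L U X)) : finite_set F ->
  exists B : set U, finite_set B /\ forall Phi, F Phi -> over B Phi.
Proof.
move=> /fin_list[s Fs]; suff [B [fB h]] : exists B : set U, finite_set B /\ forall Phi, List.In Phi s -> over B Phi.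
  by exists B; split=> // Phi /Fs; exact: h.
elim: s {Fs} => [|Psi s [B [fB h]]]; first by exists set0; split=> //; exact: finite_set0.
have [m [phi [e [_ ->]]]] := over_setT Psi.
exists (range e `|` B); split.
  by rewrite finite_setU; split=> //; apply: finite_image; exact: finite_finset.
move=> Phi [<-|/h]; last by apply: over_sub => x; right.
by apply: over_inst => i; left; exists i.
Qed.

Section Automorphisms.
Variables (sigma : U -> U) (aut : automorphism sigma).

Lemma aut_sat V (v : V -> U) (phi : form L V) : sat (sigma \o v) phi <-> sat v phi.
Proof. by apply: elementary_sat; case: aut. Qed.

Lemma aut_holds X A (a : X -> U) (Phi : gform U X) : fixes A sigma -> over A Phi ->
  (holds (sigma \o a) Phi <-> holds a Phi).
Proof.
move=> fx [m [phi [e [he ->]]]]; rewrite !holds_inst -(aut_sat (join a e)).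
suff -> : sigma \o join a e = join (sigma \o a) e by [].
apply: funext => -[//|i] /=; exact: fx (he i).
Qed.

Lemma aut_definable X A (D : set (X -> U)) a : fixes A sigma -> definable A D ->
  (D (sigma \o a) <-> D a).
Proof. by move=> fx [Phi [o ->]]; exact: aut_holds fx o. Qed.

Lemma aut_surj X (a : X -> U) : exists b : X -> U, a = sigma \o b.
Proof.
have [[g K1 K2] _] := aut; exists (g \o a); apply: funext => x /=.
by rewrite K2.
Qed.

(** The hypothesis on [D] and [D'] says that [sigma] maps the first onto the second; on formulas
    this replaces the parameters d by sigma d. *)
Lemma conc_inv X (M : set U) (p : set (@gform L U X)) (D D' : set (X -> U)) :
  invariant M p -> fixes M sigma -> (forall a, D' (sigma \o a) <-> D a) ->
  concentrates p D -> concentrates p D'.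
Proof.
move=> ip fx h [Phi [pP E]]; have [m [phi [d [_ EP]]]] := over_setT Phi.
exists (inst phi (sigma \o d)); split; first by rewrite -(ip _ aut fx) -EP.
apply/predeqP => a'; have [a ->] := aut_surj a'; rewrite h E EP /=.
rewrite !holds_inst -(aut_sat (join a d)).
by suff -> : sigma \o join a d = join (sigma \o a) (sigma \o d) by []; apply: funext => -[].
Qed.

Lemma inv_Real X (M A : set U) (p : set (@gform L U X)) a :
  invariant M p -> fixes M sigma -> Real A p a -> Real (sigma @` A) p (sigma \o a).
Proof.
move=> ip fx R Phi [m [phi [e [he ->]]]].
have [e' E] := aut_surj e.
have he' i : A (e' i).
  have [x Ax Ex] := he i; have [[g K1 _] _] := aut.
  by rewrite -(K1 (e' i)) (_ : sigma (e' i) = sigma x) ?K1 // Ex E.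
rewrite E -(ip _ aut fx) R; last exact: over_inst.
rewrite !holds_inst -(aut_sat (join a e')).
by suff -> : sigma \o join a e' = join (sigma \o a) (sigma \o e') by []; apply: funext => -[].
Qed.

End Automorphisms.

(** If p contained phi(x, d) but not phi(x, sigma d), a point of [M] would satisfy the first and not
    the second, although [sigma] fixes that point. The other direction uses the inverse
    automorphism. *)
Lemma fs_invariant X (M : set U) (p : set (@gform L U X)) : global_type p -> fs_in M p -> invariant M p.
Proof.
move=> gp fs sigma aut fx m phi d.
suff H (s : U -> U) (e : tup m U) : automorphism s -> fixes M s -> p (inst phi e) -> p (inst phi (s \o e)).
  split; first exact: H.
  have [[g K1 K2] _] := aut.
  have ag : automorphism g.
    split; first by exists sigma.
    move=> k psi e; rewrite -(aut_sat aut (g \o e)).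
    by rewrite (_ : sigma \o _ = e) //; apply: funext => x /=; rewrite K2.
  have fg : fixes M g by move=> x /fx {1}<-; rewrite K1.
  by move=> /(H g _ ag fg); rewrite (_ : g \o _ = d) //; apply: funext => i /=; rewrite K1.
move=> {aut fx} aut fx p1; apply: contrapT => /(gt_neg gp) p2.
have [a [Ma ha]] : exists a : X -> U, (forall x, M (a x)) /\ holds a (And (inst phi e) (Neg (inst phi (s \o e)))).
  by apply: fs; apply: (gt_and gp p1 p2) => a h1 h2; apply/sat_And; split.
move: ha; rewrite /holds sat_And => -[/holds_inst h1 h2]; apply: h2; apply/holds_inst.
move: h1; rewrite -(aut_sat aut).
by suff -> : s \o join a e = join a (s \o e) by []; apply: funext => -[x|i] //=; rewrite fx.
Qed.

Lemma definable_invariant X (M : set U) (p : set (@gform L U X)) : definable_type M p -> invariant M p.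
Proof.
move=> dp sigma aut fx m phi d.
by have := aut_definable aut d fx (dp m phi); rewrite /= => ->.
Qed.

Section Push.
Variables (X Y : Type) (p : set (@gform L U X)) (D : set (X -> U)) (f : (X -> U) -> (Y -> U)).
Hypothesis gp : global_type p.

Lemma push_Real A a : Real A p a -> D a ->
  (forall E, definable A E -> definable A [set x | D x /\ E (f x)]) ->
  Real A (push D f p) (f a).
Proof.
move=> R Da h Phi o; rewrite /push /= (conc_real gp R (h _ (definable_holds o))) /=.
by split=> [[]|].
Qed.
End Push.

End GlobalTypes.

(** * Types tested on realizations in the monster model *)

Section Monster.
Variables (L : language) (U : structure L) (small : set (set U)).
Hypothesis Usat : saturated small.
Hypothesis Uhom : strongly_homogeneous small.
Hypothesis smallU : forall A B : set U, small A -> finite_set B -> small (A `|` B).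

Lemma finite_range m (e : tup m U) : finite_set (range e).
Proof. by apply: finite_image; exact: finite_finset. Qed.

Lemma exists_Real n (p : set (@gform L U 'I_n)) A : global_type p -> small A -> exists a, Real A p a.
Proof.
move=> gp sA; have [|F fF Fp|a ha] := @Usat A n [set Phi | p Phi /\ over A Phi] sA.
- by move=> Phi [].
- by case: gp => fs _; apply: fs => // Phi /Fp[].
- by exists a; apply/realizes_Real => // Phi pP o; exact: ha.
Qed.

(** A formula involves finitely many parameters, so a realization over a large enough small set
    decides it, and also witnesses finite satisfiability. *)
Lemma global_type_Real X (t : set (@gform L U X)) (B : set U) : small B ->
  (forall A, small A -> B `<=` A -> exists a, Real A t a) -> global_type t.
Proof.
move=> sB h; split.
  move=> F fF Ft; have [C [fC hC]] := finite_over fF.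
  have [|x|a ha] := h (B `|` C); [exact: smallU|by left|].
  exists a => Phi FP; apply/ha; last exact: Ft.
  by apply: over_sub (hC _ FP) => x; right.
move=> Phi; have [m [phi [e [_ ->]]]] := over_setT Phi.
have [||a ha] := h (B `|` range e); [by apply: smallU => //; exact: finite_range|by move=> x; left|].
have o psi : over (B `|` range e) (inst psi e : form L (X + U)) by apply: over_inst => i; right; exists i.
case: (EM (holds a (inst phi e))) => H; [left|right].
  exact/(ha _ (o phi)).
exact/(ha _ (o (Neg phi))).
Qed.

Lemma Real_eq X (p q : set (@gform L U X)) (B : set U) : small B ->
  (forall A, small A -> B `<=` A -> exists a, Real A p a /\ Real A q a) -> p = q.
Proof.
move=> sB h; apply/predeqP => Phi; have [m [phi [e [_ ->]]]] := over_setT Phi.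
have [||a [Rp Rq]] := h (B `|` range e); [by apply: smallU => //; exact: finite_range|by move=> x; left|].
have o : over (B `|` range e) (inst phi e : form L (X + U)) by apply: over_inst => i; right; exists i.
by rewrite (Rp _ o) (Rq _ o).
Qed.

Lemma homogeneity m (b b' : tup m U) (A : set U) : small A ->
  (forall Phi, over A Phi -> (holds b Phi <-> holds b' Phi)) ->
  exists sigma, [/\ automorphism sigma, fixes A sigma & sigma \o b = b'].
Proof.
move=> sA H.
pose f x := if pselect (A x) then x else
  if pselect (exists i, b i = x) is left h then b' (sval (cid h)) else x.
have [||sigma [aut hs]] := @Uhom (A `|` range b) f.
- by apply: smallU => //; exact: finite_range.
- move=> k phi e he.
  have [g hg] : exists g : 'I_k -> 'I_m + {x | A x},
      forall i, join b sval (g i) = e i /\ join b' sval (g i) = f (e i).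
    apply: (dependent_choice (P := fun i z => join b sval z = e i /\ join b' sval z = f (e i))) => i.
    rewrite /f; case: pselect => [h|nA]; first by exists (inr (exist _ _ h)).
    case: pselect => [h|]; last by case; have [//|[z _ <-]] := he i; exists z.
    by exists (inl (sval (cid h))) => /=; split=> //; case: cid.
  have := H (inst (form_map g phi) sval) (over_inst _ (fun y => svalP y)).
  rewrite !holds_inst !sat_map.
  have -> : join b sval \o g = e by apply: funext => i; have [] := hg i.
  have -> : join b' sval \o g = f \o e by apply: funext => i; have [] := hg i.
  by move=> ->.
exists sigma; split=> // [x Ax|].
  by rewrite hs; [rewrite /f; case: pselect|left].
apply: funext => i /=; rewrite hs; last by right; exists i.
(* Equality formulas settle the overlaps: a coordinate of [b] that lies in [A] is the same in [b'],
   and equal coordinates of [b] give equal coordinates of [b']. *)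
rewrite /f; case: pselect => [h|nA].
  have o : over A (inst (Eq (Var L (inl i)) (Var L (inr tt))) (fun=> b i) : form L ('I_m + U)).
    exact: over_inst.
  have := H _ o; rewrite !holds_inst /= => -[/(_ erefl) E _]; exact: esym E.
case: pselect => [h|[]]; last by exists i.
case: (cid h) => k /= E.
have o : over A (inst (Eq (Var L (inl i)) (Var L (inl k))) (of_void U) : form L ('I_m + U)).
  by apply: over_inst => -[].
by have := H _ o; rewrite !holds_inst /= => -[/(_ (esym E)) -> _].
Qed.

Lemma Real_conj m (p : set (@gform L U 'I_m)) (b b' : tup m U) (A : set U) : small A ->
  Real A p b -> Real A p b' ->
  exists sigma, [/\ automorphism sigma, fixes A sigma & sigma \o b = b'].
Proof. by move=> sA R R'; apply: homogeneity => // Phi o; rewrite -(R _ o) (R' _ o). Qed.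

Lemma invariant_Real X (t : set (@gform L U X)) (M B : set U) : small B ->
  (forall A, small A -> B `<=` A -> exists a, Real A t a /\
     forall sigma, automorphism sigma -> fixes M sigma -> Real (sigma @` A) t (sigma \o a)) ->
  invariant M t.
Proof.
move=> sB h sigma aut fx m phi d.
have [||a [R Rs]] := h (B `|` range d); [by apply: smallU => //; exact: finite_range|by move=> x; left|].
rewrite (R (inst phi d)); last by apply: over_inst => i; right; exists i.
rewrite (Rs _ aut fx); last by apply: over_inst => i; exists (d i) => //; right; exists i.
rewrite !holds_inst -(aut_sat aut (join a d)).
by suff -> : sigma \o join a d = join (sigma \o a) (sigma \o d) by []; apply: funext => -[].
Qed.

End Monster.

Section Elementary.
Variables (L : language) (U : structure L) (M : set U).
Hypothesis eM : elem_substructure M.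

(** This is the Tarski-Vaught property: [M] is the range of an elementary embedding, so an
    existential formula over [M] is pulled back and solved there. *)
Lemma definable_solution k (D : set (tup k U)) a : definable M D -> D a ->
  exists a' : tup k U, (forall i, M (a' i)) /\ D a'.
Proof.
have [N [j [ej rj]]] := eM => -[Phi [[m [phi [e [he ->]]]] ->]] /= /holds_inst h.
have [e0 E0] : exists e0 : 'I_m -> N, forall i, j (e0 i) = e i.
  apply: (dependent_choice (P := fun i x => j x = e i)) => i.
  by have := he i; rewrite -rj => -[x _ <-]; exists x.
have Ee : e = j \o e0 by apply: funext => i; rewrite -E0.
have : sat e (exl phi) by apply/sat_exl; exists a.
rewrite Ee (elementary_sat _ _ ej) => /sat_exl[b hb].
exists (j \o b); split=> [i|]; first by rewrite -rj; exists (b i).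
rewrite holds_inst; have -> : join (j \o b) (j \o e0) = j \o join b e0 by apply: funext => -[].
by rewrite (elementary_sat _ _ ej).
Qed.

End Elementary.

(** * The Newelski product *)

Section Product.
Variables (L : language) (U : structure L) (small : set (set U)).
Hypothesis Usat : saturated small.
Hypothesis Uhom : strongly_homogeneous small.
Hypothesis smallU : forall A B : set U, small A -> finite_set B -> small (A `|` B).
Hypothesis small_image : forall (A : set U) (f : U -> U), small A -> small (f @` A).
Variables (n : nat) (G : def_group U n) (M : set U).
Hypothesis eM : elem_substructure M.
Hypothesis sM : small M.

Notation gtp := (set (@gform L U 'I_n)).
Notation op := (nprod G M).
Notation mul := (gmul G).

Lemma small_range A k (e : tup k U) : small A -> small (A `|` range e).
Proof. by move=> sA; apply: smallU => //; exact: finite_range. Qed.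

Lemma def_subgroup_G : def_subgroup G (gset G).
Proof.
split=> //; [exact: gset_def|exact: gone_in|exact: gmul_in|exact: ginv_in].
Qed.

Lemma fs_conc X (p : set (@gform L U X)) (D : set (X -> U)) : fs_in M p ->
  concentrates p D -> exists a, (forall i, M (a i)) /\ D a.
Proof. by move=> fs [Phi [/fs[a [Ma h]] ->]]; exists a. Qed.

Lemma definable_rmul A (b : tup n U) (E : set (tup n U)) : gset G b -> range b `<=` A ->
  definable A E -> definable A [set x | gset G x /\ E (mul x b)].
Proof.
move=> Gb sb dE; have := dfun_param (dfun_gmul G) (b := b) (fun y => sb _ (imageP _ I)) dE.
by apply: definable_iff => a /=; split=> [[]|[[]]].
Qed.

Lemma definable_lmul A (b : tup n U) (E : set (tup n U)) : gset G b -> range b `<=` A ->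
  definable A E -> definable A [set x | gset G x /\ E (mul b x)].
Proof.
move=> Gb sb dE.
have H : dfun (fun v : 'I_n + 'I_n -> U => gset G (v \o inl) /\ gset G (v \o inr)) (fun v => mul (v \o inr) (v \o inl)).
  apply: dfun_mul; [exact: dfun_proj (Def_GG G)|exact: dfun_proj (Def_GG G)|by move=> v []..].
have := dfun_param H (b := b) (fun y => sb _ (imageP _ I)) dE.
by apply: definable_iff => a /=; split=> [[]|[[]]].
Qed.

Lemma definable_ginv A (E : set (tup n U)) :
  definable A E -> definable A [set x | gset G x /\ E (ginv G x)].
Proof.
move=> dE; have H : dfun (fun v : 'I_n + void -> U => gset G (v \o inl)) (fun v => ginv G (v \o inl)).
  apply: dfun_comp (dfun_ginv G) _; last by [].
  by apply: dfun_proj; exact: Def_sub (Def_G G).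
have := dfun_param H (b := of_void U) (A := A) _ dE.
by apply=> -[].
Qed.

Lemma S_in (H : set (tup n U)) p A a : definable set0 H -> S_ H p -> Real A p a -> H a.
Proof.
move=> dH [gp cp] R; apply/(conc_real gp R); last exact: cp.
exact: definable_mono dH.
Qed.

Lemma S_Real (H : set (tup n U)) (p : gtp) B : small B -> definable set0 H ->
  (forall A, small A -> B `<=` A -> exists a, Real A p a /\ H a) -> S_ H p.
Proof.
move=> sB dH h; have gp : global_type p.
  by apply: (global_type_Real smallU sB) => A sA BA; have [a [R _]] := h _ sA BA; exists a.
split=> //; have [a [R Ha]] := h B sB (fun _ => id).
by apply/(conc_real gp R) => //; exact: definable_mono dH.
Qed.

Lemma S_sub (H H' : set (tup n U)) p : definable set0 H -> definable set0 H' -> H `<=` H' -> S_ H p -> S_ H' p.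
Proof.
move=> dH dH' s Sp; apply: (S_Real sM dH') => A sA MA; have [gp _] := Sp.
have [a R] := exists_Real Usat gp sA.
by exists a; split=> //; apply: s; exact: S_in Sp R.
Qed.

Lemma subgroup_S H p : def_subgroup G H -> S_ H p -> S_ (gset G) p.
Proof. by move=> [dH s _ _ _]; apply: S_sub => //; exact: gset_def. Qed.

Lemma subgroup_Sinv H p : def_subgroup G H -> S_inv M H p -> S_inv M (gset G) p.
Proof. by move=> sH [/(subgroup_S sH)]. Qed.

Lemma fs_inv (H : set (tup n U)) : S_fs M H `<=` S_inv M H.
Proof. by move=> p [[gp ?] fs]; split=> //; apply: fs_invariant. Qed.

Lemma aut_G sigma a : automorphism sigma -> gset G (sigma \o a) <-> gset G a.
Proof. by move=> aut; apply: (aut_definable aut (A := set0)) => //; exact: gset_def. Qed.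

Lemma aut_mul sigma a b : automorphism sigma -> gset G a -> gset G b ->
  sigma \o mul a b = mul (sigma \o a) (sigma \o b).
Proof.
move=> aut Ga Gb; pose c := join a (join b (mul a b)).
have := aut_definable aut c (A := set0) _ (gmul_def G).
case=> // _ [|_ _ E]; first by [].
exact: E.
Qed.

(** The definition of the product picks a realization of q anew for every formula. As p is
    [M]-invariant and realizations of q over the same parameters are conjugate, one pair serves for
    all formulas over [A]. *)
Lemma nprod_Real p q A a b : S_inv M (gset G) p -> S_ (gset G) q -> small A -> M `<=` A ->
  Real A q b -> Real (A `|` range b) p a -> Real A (op p q) (mul a b).
Proof.
move=> [Sp ip] Sq sA MA Rb Ra Phi oPhi.
have [gp _] := Sp; have [gq _] := Sq; have dG := gset_def G.
have Ga := S_in dG Sp Ra; have Gb := S_in dG Sq Rb.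
have dE : definable (A `|` range b) [set x | gset G x /\ holds (mul x b) Phi].
  apply: (definable_rmul (E := [set y | holds y Phi])) => //.
  by apply: definable_mono (definable_holds oPhi) => x; left.
split; last first.
  move=> h; have [m [phi [d [hd E]]]] := oPhi; exists m, phi, d, b; split=> //.
    apply: (realizes_Real gq _ _).2; apply: Real_sub Rb => x [/MA //|[i _ <-]]; exact: hd.
  apply/(conc_real gp Ra) => /=.
    by apply: definable_iff dE => x /=; rewrite E holds_inst.
  by split=> //; move: h; rewrite E holds_inst.
move=> [m [phi [d [b1 [E Gb1 Rb1 c1]]]]].
(* The presentation [inst phi d] may carry parameters outside [A], in variables that do not occur in
   [phi]. Hence the detour through [b2], conjugate to [b1] over [M] and [d], and to [b] over [A]. *)
have sA1 : small (M `|` range d) by exact: small_range.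
have sA2 : small (A `|` range d) by exact: small_range.
have [b2 Rb2] := exists_Real Usat gq sA2.
have Rb1' : Real (M `|` range d) q b1 by apply/realizes_Real.
have Rb2' : Real (M `|` range d) q b2 by apply: Real_sub Rb2 => x [/MA|]; [left|right].
have Rb2A : Real A q b2 by apply: Real_sub Rb2 => x; left.
have [s1 [aut1 fx1 e1]] := Real_conj Uhom smallU sA1 Rb1' Rb2'.
have [s2 [aut2 fx2 e2]] := Real_conj Uhom smallU sA Rb2A Rb.
have Gb2 := S_in dG Sq Rb2.
have oPhi1 : over (M `|` range d) Phi by rewrite E; apply: over_inst => i; right; exists i.
have c2 : concentrates p [set x | gset G x /\ holds (mul x b2) Phi].
  apply: (conc_inv aut1 ip) c1 => [x Mx|x /=]; first by apply: fx1; left.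
  rewrite aut_G // -e1; split=> -[Gx h]; split=> //; move: h; rewrite -aut_mul // (aut_holds aut1 _ fx1 oPhi1) E holds_inst //.
have c3 : concentrates p [set x | gset G x /\ holds (mul x b) Phi].
  apply: (conc_inv aut2 ip) c2 => [x Mx|x /=]; first by apply: fx2; apply: MA.
  rewrite aut_G // -e2; split=> -[Gx h]; split=> //; move: h; rewrite -aut_mul // (aut_holds aut2 _ fx2 oPhi) //.
by have [] := (conc_real gp Ra dE).1 c3.
Qed.

Lemma nprod_exists p q A : S_inv M (gset G) p -> S_ (gset G) q -> small A -> M `<=` A ->
  exists a b, [/\ Real A q b, Real (A `|` range b) p a & Real A (op p q) (mul a b)].
Proof.
move=> Sp Sq sA MA; have [gq _] := Sq; have [[gp _] _] := Sp.
have [b Rb] := exists_Real Usat gq sA.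
have [a Ra] := exists_Real Usat gp (small_range b sA).
by exists a, b; split=> //; exact: nprod_Real.
Qed.

Lemma nprod_S H p q : def_subgroup G H -> S_inv M H p -> S_ H q -> S_ H (op p q).
Proof.
move=> sH Sp Sq; have [dH _ _ mH _] := sH; apply: (S_Real sM dH) => A sA MA.
have [a [b [Rb Ra R]]] := nprod_exists (subgroup_Sinv sH Sp) (subgroup_S sH Sq) sA MA.
exists (mul a b); split=> //; apply: mH; [apply: S_in Ra => //; exact: (Sp.1)|exact: S_in Rb].
Qed.

Lemma nprod_inv H p q : def_subgroup G H -> S_inv M H p -> S_inv M H q -> S_inv M H (op p q).
Proof.
move=> sH Sp Sq; split; first exact: nprod_S (Sq.1).
have SpG := subgroup_Sinv sH Sp; have SqG := subgroup_Sinv sH Sq.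
apply: (invariant_Real smallU sM) => A sA MA.
have [a [b [Rb Ra R]]] := nprod_exists SpG SqG.1 sA MA.
exists (mul a b); split=> // sigma aut fx.
have dG := gset_def G.
rewrite aut_mul //; [|exact: S_in SpG.1 Ra|exact: S_in SqG.1 Rb].
have fA : M `<=` sigma @` A by move=> x Mx; exists x; [exact: MA|exact: fx].
have E : sigma @` (A `|` range b) = (sigma @` A) `|` range (sigma \o b).
  rewrite image_setU; congr (_ `|` _); apply/predeqP => x; split.
    by move=> [_ [i _ <-] <-]; exists i.
  by move=> [i _ <-]; exists (b i) => //; exists i.
apply: nprod_Real => //; [exact: SqG.1|exact: small_image|exact: inv_Real SqG.2 fx Rb|].
by rewrite -E; exact: inv_Real SpG.2 fx Ra.
Qed.

Lemma nprod_assoc p q r : S_inv M (gset G) p -> S_inv M (gset G) q -> S_inv M (gset G) r ->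
  op p (op q r) = op (op p q) r.
Proof.
move=> Sp Sq Sr; apply: (Real_eq smallU sM) => A sA MA; have dG := gset_def G.
have sG := def_subgroup_G.
have [b [c [Rc Rb Rbc]]] := nprod_exists Sq Sr.1 sA MA.
have [gp _] := Sp.1.
have sA' := small_range b (small_range c sA).
have [a Ra] := exists_Real Usat gp (small_range (mul b c) sA').
have Ra1 : Real (A `|` range (mul b c)) p a by apply: Real_sub Ra => x [|]; [left; left; left|right].
have Ra2 : Real ((A `|` range c) `|` range b) p a by apply: Real_sub Ra => x [|]; left; [left|right].
exists (mul a (mul b c)); split.
  by apply: nprod_Real => //; exact: (nprod_S sG Sq Sr.1).
rewrite gmulA; [|exact: S_in Sp.1 Ra|exact: S_in Sq.1 Rb|exact: S_in Sr.1 Rc].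
apply: nprod_Real => //; [exact: nprod_inv|exact: Sr.1|].
apply: nprod_Real => //; [exact: Sq.1|exact: small_range|by move=> x /MA; left].
Qed.

(** The product is the only point of a set definable over [M], and such a set has a point in [M]. *)
Lemma closed_mul (a b : tup n U) : (forall i, M (a i)) -> (forall i, M (b i)) -> gset G a -> gset G b ->
  forall i, M (mul a b i).
Proof.
move=> Ma Mb Ga Gb; pose f (z : ('I_n + 'I_n) + 'I_n) : 'I_n + ('I_n + 'I_n) :=
  match z with inl z => inr z | inr z => inl z end.
have dD := definableI (e := join a b) (Def_sub f (dfun_gmul G)) (A := M).
have h : forall y, M (join a b y) by case.
have [|c [Mc]] := definable_solution eM (dD h) (a := mul a b).
  by [].
move=> [_ E]; have {}E : c = mul a b := E.
by rewrite -E.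
Qed.

Lemma closed_inv (a : tup n U) : (forall i, M (a i)) -> gset G a -> forall i, M (ginv G a i).
Proof.
move=> Ma Ga; pose f (z : 'I_n + 'I_n) : 'I_n + 'I_n :=
  match z with inl z => inr z | inr z => inl z end.
have dD := definableI (e := a) (Def_sub f (dfun_ginv G)) Ma.
have [|c [Mc]] := definable_solution eM dD (a := ginv G a).
  by [].
move=> [_ E]; have {}E : c = ginv G a := E.
by rewrite -E.
Qed.

(** The realization of p is replaced by a point x of [M] while b is a parameter, and then b by a
    point y of [M] while x is a parameter. *)
Lemma nprod_fs H p q : def_subgroup G H -> S_fs M H p -> S_fs M H q -> S_fs M H (op p q).
Proof.
move=> sH fp fq; have Sp := fs_inv fp; have Sq := fs_inv fq; have dG := gset_def G.
split; first exact: nprod_S Sq.1.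
have SpG := subgroup_Sinv sH Sp; have SqG := subgroup_Sinv sH Sq.
move=> Phi; have [m [phi [d [_ E]]]] := over_setT Phi => pPhi.
set A := M `|` range d; have sA : small A by exact: small_range.
have MA : M `<=` A by left.
have [a [b [Rb Ra R]]] := nprod_exists SpG SqG.1 sA MA.
have oA : over A Phi by rewrite E; apply: over_inst => i; right; exists i.
have h : holds (mul a b) Phi by apply/(R _ oA).
have Ga := S_in dG SpG.1 Ra; have Gb := S_in dG SqG.1 Rb.
have dE : definable (A `|` range b) [set x | gset G x /\ holds (mul x b) Phi].
  apply: (definable_rmul (E := [set y | holds y Phi])) => //.
  by apply: definable_mono (definable_holds oA) => x; left.
have [x [Mx [Gx hx]]] := fs_conc fp.2 ((conc_real Sp.1.1 Ra dE).2 (conj Ga h)).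
have dE' : definable A [set y | gset G y /\ holds (mul x y) Phi].
  apply: (definable_lmul (E := [set y | holds y Phi])) => //; [by move=> _ [i _ <-]; exact: MA|].
  exact: definable_holds.
have [y [My [Gy hy]]] := fs_conc fq.2 ((conc_real Sq.1.1 Rb dE').2 (conj Gb hx)).
by exists (mul x y); split=> //; exact: closed_mul.
Qed.

Lemma translate_r_Real p c A a : S_ (gset G) p -> gset G c -> range c `<=` A -> Real A p a ->
  Real A (translate_r G p c) (mul a c).
Proof.
move=> Sp Gc cA R; apply: (push_Real Sp.1 (f := fun x => mul x c)) => //; first exact: S_in (gset_def G) Sp R.
by move=> E dE; exact: definable_rmul.
Qed.

Lemma translate_l_Real p c A a : S_ (gset G) p -> gset G c -> range c `<=` A -> Real A p a ->
  Real A (translate_l G c p) (mul c a).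
Proof.
move=> Sp Gc cA R; apply: (push_Real Sp.1 (f := fun x => mul c x)) => //; first exact: S_in (gset_def G) Sp R.
by move=> E dE; exact: definable_lmul.
Qed.

Lemma type_inv_Real p A a : S_ (gset G) p -> Real A p a -> Real A (type_inv G p) (ginv G a).
Proof.
move=> Sp R; apply: (push_Real Sp.1) => //; first exact: S_in (gset_def G) Sp R.
by move=> E dE; exact: definable_ginv.
Qed.

Lemma translate_r_S H p c : def_subgroup G H -> S_ H p -> H c -> S_ H (translate_r G p c).
Proof.
move=> sH Sp Hc; have [dH sHG _ mH _] := sH.
apply: (S_Real (small_range c sM) dH) => A sA MA; have [gp _] := Sp.
have [a R] := exists_Real Usat gp sA; exists (mul a c); split; last by apply: mH => //; exact: S_in R.
by apply: translate_r_Real => //; [exact: subgroup_S sH Sp|exact: sHG|move=> x rx; apply: MA; right].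
Qed.

Lemma translate_l_S H p c : def_subgroup G H -> S_ H p -> H c -> S_ H (translate_l G c p).
Proof.
move=> sH Sp Hc; have [dH sHG _ mH _] := sH.
apply: (S_Real (small_range c sM) dH) => A sA MA; have [gp _] := Sp.
have [a R] := exists_Real Usat gp sA; exists (mul c a); split; last by apply: mH => //; exact: S_in R.
by apply: translate_l_Real => //; [exact: subgroup_S sH Sp|exact: sHG|move=> x rx; apply: MA; right].
Qed.

Lemma type_inv_S H p : def_subgroup G H -> S_ H p -> S_ H (type_inv G p).
Proof.
move=> sH Sp; have [dH sHG _ mH iH] := sH.
apply: (S_Real sM dH) => A sA MA; have [gp _] := Sp.
have [a R] := exists_Real Usat gp sA; exists (ginv G a); split; last by apply: iH => //; exact: S_in R.
by apply: type_inv_Real => //; exact: subgroup_S sH Sp.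
Qed.

Lemma aut_inv sigma a : automorphism sigma -> gset G a -> sigma \o ginv G a = ginv G (sigma \o a).
Proof.
move=> aut Ga; have [phi H] := dfun_ginv G; have := H (join a (ginv G a)).
have := H (join (sigma \o a) (sigma \o ginv G a)).
have -> : join (sigma \o a) (sigma \o ginv G a) = sigma \o join a (ginv G a) by apply: funext => -[].
by rewrite (aut_sat aut) => h1 h2; have /h1[_ E] := h2.1 (conj Ga erefl).
Qed.

Lemma type_inv_inv H p : def_subgroup G H -> S_inv M H p -> S_inv M H (type_inv G p).
Proof.
move=> sH Sp; split; first exact: (type_inv_S sH Sp.1).
have SpG := subgroup_Sinv sH Sp.
apply: (invariant_Real smallU sM) => A sA MA; have [[gp _] _] := Sp.
have [a R] := exists_Real Usat gp sA; exists (ginv G a); split; first exact: type_inv_Real SpG.1 R.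
move=> sigma aut fx; rewrite aut_inv //; last exact: S_in (gset_def G) SpG.1 R.
by apply: type_inv_Real; [exact: SpG.1|exact: inv_Real SpG.2 fx R].
Qed.

Lemma fs_push_closed (p : gtp) (D : set (tup n U)) (f : tup n U -> tup n U) : global_type p -> fs_in M p ->
  (forall x, D x -> (forall i, M (x i)) -> forall i, M (f x i)) -> fs_in M (push D f p).
Proof.
move=> gp fs cl Phi /= /(fs_conc fs)[a [Ma [Da h]]].
by exists (f a); split=> //; exact: cl.
Qed.

Lemma type_inv_fs H p : def_subgroup G H -> S_fs M H p -> S_fs M H (type_inv G p).
Proof.
move=> sH fp; split; first exact: (type_inv_S sH fp.1).
by apply: fs_push_closed; [exact: fp.1.1|exact: fp.2|move=> x Gx Mx; exact: closed_inv].
Qed.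

(** In [definable_type] all parameter variables of the formula vary; here some of them are fixed at
    values in [A], and the index types are arbitrary. *)
Lemma definable_type_param X Y Z (p : set (@gform L U X)) (A : set U)
    (chi : form L (X + (Y + Z))) (c : Z -> U) :
  definable_type M p -> M `<=` A -> (forall z, A (c z)) ->
  definable A [set y : Y -> U | p (inst chi (join y c))].
Proof.
move=> dp MA hc; have [m [d [chi' E]]] := inst_ord chi.
have Ech (u : Y + Z -> U) : inst chi u = inst chi' (u \o d).
  by rewrite E /inst form_map_comp; congr form_map; apply: funext => -[].
have [Psi [[r [xi [c' [hc' E']]]] EPsi]] := dp m chi'.
pose d' (z : 'I_m + 'I_r) : Y + (Z + 'I_r) :=
  match z with inl i => match d i with inl y => inl y | inr z => inr (inl z) end | inr i => inr (inr i) end.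
have H1 : Def (fun v : Y + (Z + 'I_r) -> U => sat (v \o d') xi).
  by exists (form_map d' xi) => v; rewrite sat_map.
have H2 (z : Z + 'I_r) : A (join c c' z) by case: z => [z|i] /=; [exact: hc|exact: MA].
apply: definable_iff (definableI H1 H2) => y /=; rewrite Ech.
have -> : p (inst chi' (join y c \o d)) = [set d0 | p (inst chi' d0)] (join y c \o d) by [].
rewrite EPsi /= E' holds_inst.
suff -> : join (join y c \o d) c' = join y (join c c') \o d' by [].
by apply: funext => -[i|i] //=; case: (d i).
Qed.

(* A formula theta(y, a) of q failing at b yields, by definability of p, a point
   x of M with theta(x, a) such that ~ theta(x, .) belongs to p. *)
Lemma fs_definable_commute (p q : gtp) A a b : fs_in M q -> global_type q ->
  definable_type M p -> global_type p -> M `<=` A ->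
  Real A q b -> Real (A `|` range b) p a -> Real (A `|` range a) q b.
Proof.
move=> fq gq dp gp MA Rb Ra.
suff H Phi : over (A `|` range a) Phi -> q Phi -> holds b Phi.
  by apply/realizes_Real => // Phi; move=> /[swap]; exact: H.
move=> oPhi qPhi; apply: contrapT => nh.
have [k [theta [e [he E]]]] := oPhi.
(* split the parameters into those from A and those from a *)
have [g hg] : exists g : 'I_k -> {x | A x} + 'I_n, forall i, join sval a (g i) = e i.
  apply: (dependent_choice (P := fun i z => join sval a z = e i)) => i.
  by have [h|[x _ <-]] := he i; [exists (inl (exist _ _ h))|exists (inr x)].
pose f (z : 'I_n + 'I_k) : 'I_n + ({x | A x} + 'I_n) := match z with inl x => inl x | inr i => inr (g i) end.
pose psi : form L ('I_n + ({x | A x} + 'I_n)) := form_map f theta.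
have Ee : e = join sval a \o g by apply: funext => i; rewrite -hg.
have Epsi : Phi = inst psi (join sval a).
  rewrite E /inst /psi form_map_comp Ee; congr form_map; by apply: funext => -[].
(* chi(x ; y, c) := ~ theta(y, x, c) as a formula in the variable of p *)
pose sw (z : 'I_n + ({x | A x} + 'I_n)) : 'I_n + ('I_n + {x | A x}) :=
  match z with inl y => inr (inl y) | inr (inl c) => inr (inr c) | inr (inr x) => inl x end.
have Esw (u v : tup n U) : join v (join u sval) \o sw = join u (join sval v) by apply: funext => -[|[]].
have dDp : definable A [set y : tup n U | p (inst (Neg (form_map sw psi)) (join y sval))].
  by apply: definable_type_param => // z; exact: proj2_sig z.
have h1 : p (inst (Neg (form_map sw psi)) (join b sval)).
  apply/Ra; last first.
    by rewrite holds_inst /= sat_map Esw -(holds_inst psi) -Epsi.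
  apply: over_inst => -[i|z] /=; [by right; exists i|by left; exact: proj2_sig z].
have c1 : concentrates q [set y | p (inst (Neg (form_map sw psi)) (join y sval))] by apply/(conc_real gq Rb dDp).
have [Psi [qPsi EPsi]] := c1.
have [x [Mx hx]] := fq _ (gt_and gq qPhi qPsi (Chi := And Phi Psi) (fun a h h' => (sat_And _ _ _).2 (conj h h'))).
move: hx; rewrite /holds sat_And => -[hx1 hx2].
have hx3 : p (inst (Neg (form_map sw psi)) (join x sval)).
  have -> : p (inst (Neg (form_map sw psi)) (join x sval)) = [set y | p (inst (Neg (form_map sw psi)) (join y sval))] x by [].
  by rewrite EPsi.
have {hx3} : holds a (inst (Neg (form_map sw psi)) (join x sval)).
  have o : forall y : 'I_n + {x | A x}, (A `|` range b) (join x sval y).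
    by case=> [i|z]; left; [exact: MA _ (Mx i)|exact: proj2_sig z].
  by have := (Ra _ (over_inst (Neg (form_map sw psi)) o)).1 hx3.
rewrite holds_inst /= sat_map Esw; apply.
by rewrite -(holds_inst psi) -Epsi.
Qed.

End Product.

(** * The pair and the retraction *)

Section PairFormulas.
Variable L : language.

Fixpoint pair_term V (t : term L V) : term (pair_language L) V :=
  match t with
  | Var v => Var _ v
  | App g ts => @App (pair_language L) V g (fun i => pair_term (ts i))
  end.

Fixpoint pair_form (V : Type) (phi : form L V) : form (pair_language L) V :=
  match phi with
  | Eq s t => Eq (pair_term s) (pair_term t)
  | Atom r ts => @Atom (pair_language L) _ (Some r) (fun i => pair_term (ts i))
  | Bot => Bot
  | Imp p q => Imp (pair_form p) (pair_form q)
  | All p => All (pair_form p)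
  end.

Lemma pair_term_map V V' (f : V -> V') (t : term L V) : pair_term (term_map f t) = term_map f (pair_term t).
Proof. by elim: t => [x|g ts IH] //=; congr App; apply: funext => i; exact: IH. Qed.

Lemma pair_form_map V (phi : form L V) : forall V' (f : V -> V'),
  pair_form (form_map f phi) = form_map f (pair_form phi).
Proof.
elim: phi => {V} [V s t|V r ts|V|V p IHp q IHq|V p IHp] V' f //=.
- by rewrite !pair_term_map.
- by congr Atom; apply: funext => i; rewrite pair_term_map.
- by rewrite IHp IHq.
- by rewrite IHp.
Qed.

(** Serves to reduce the finite satisfiability of a set of translated formulas, possibly with side
    conditions such as P(x), to that of the original set. *)
Lemma finite_preimage T T' (f : T -> T') (pi : set T) (Q F' : set T') : finite_set F' ->
  F' `<=` f @` pi `|` Q -> exists F, [/\ finite_set F, F `<=` pi & F' `<=` f @` F `|` Q].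
Proof.
move=> /fin_list[s Fs] h.
suff [F [fF Fpi hF]] : exists F, [/\ finite_set F, F `<=` pi & forall x, List.In x s -> (f @` F `|` Q) x].
  by exists F; split=> // x /Fs; exact: hF.
have {h} : forall x, List.In x s -> (f @` pi `|` Q) x by move=> x /Fs; exact: h.
elim: s {Fs} => [|x s IH] h; first by exists set0; split=> //; exact: finite_set0.
have [|F [fF Fpi hF]] := IH; first by move=> y ys; apply: h; right.
have [[t pit E]|Qx] := h x (or_introl erefl).
  exists (t |` F); split.
  - by rewrite finite_setU; split=> //; exact: finite_set1.
  - by move=> y [->|/Fpi].
  - move=> y [<-|/hF[[z Fz <-]|]]; [by left; exists t => //; left|by left; exists z => //; right|by right].
by exists F; split=> // y [<-|/hF]; [right|].
Qed.

Lemma eval_pair (N : structure (pair_language L)) V (v : V -> N) (t : term L V) :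
  eval v (pair_term t) = @eval L (reduct N) V v t.
Proof.
elim: t => [x|g ts IH] //=; congr (@finterp _ N g); apply: funext => i; exact: IH.
Qed.

Lemma sat_pair (N : structure (pair_language L)) V (phi : form L V) : forall v : V -> N,
  sat v (pair_form phi) <-> @sat L (reduct N) V v phi.
Proof.
elim: phi => {V} [V s t|V r ts|V|V p IHp q IHq|V p IHp] v //=.
- by rewrite !eval_pair.
- by under eq_fun do rewrite eval_pair.
- by rewrite IHp IHq.
- by split=> h x; apply/IHp.
Qed.

Lemma sat_pair_structure (U : structure L) (M : set U) V (phi : form L V) (v : V -> U) :
  @sat _ (pair_structure M) V v (pair_form phi) <-> sat v phi.
Proof. by rewrite sat_pair; case: U M v. Qed.

Definition in_P (V : Type) (x : V) : form (pair_language L) V :=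
  @Atom (pair_language L) V None (fun=> Var _ x).

Lemma all_in_P V k (f : 'I_k -> V) : exists psi : form (pair_language L) V,
  forall (N : structure (pair_language L)) (v : V -> N),
    sat v psi <-> forall i, @pred_of L N (v (f i)).
Proof.
have fF : finite_set (range (fun i => in_P (f i))) by apply: finite_image; exact: finite_finset.
have [psi H] := finite_conj fF; exists psi => N v; rewrite H; split=> [h i|h _ [i _ <-]].
  by have := h _ (imageP _ (a := i) I).
exact: h.
Qed.

Lemma elementary_exists (L' : language) (N W : structure L') (j : N -> W) V (X : finType)
    (psi : form L' (X + V)) (d : V -> N) : elementary j ->
  (exists a : X -> W, sat (join a (j \o d)) psi) -> exists a : X -> N, sat (join a d) psi.
Proof.
move=> ej [a ha].
pose f (z : X + V) : V + 'I_#|X| := match z with inl x => inr (enum_rank x) | inr v => inl v end.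
have h (S : structure L') (b : 'I_#|X| -> S) (c : V -> S) : join c b \o f = join (b \o enum_rank) c by apply: funext => -[].
have : sat (j \o d) (exn (form_map f psi)).
  apply/sat_exn; exists (a \o enum_val); rewrite sat_map h.
  have -> // : (a \o enum_val) \o enum_rank = a.
  by apply: funext => x /=; rewrite enum_rankK.
rewrite elementary_sat // => /sat_exn[b]; rewrite sat_map h => hb.
by exists (b \o enum_rank).
Qed.

End PairFormulas.

Section Pair.
Variables (L : language) (U : structure L) (small : set (set U)).
Hypothesis Usat : saturated small.
Hypothesis Uhom : strongly_homogeneous small.
Hypothesis smallU : forall A B : set U, small A -> finite_set B -> small (A `|` B).
Variable M : set U.
Hypothesis eM : elem_substructure M.
Hypothesis sM : small M.
Variables (N' : structure (pair_language L)) (j : U -> N').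
Hypothesis sP : saturated_pair M j.

Notation W := (reduct N').
Notation P := (@pred_of L N').
Notation jW := (j : U -> W).

Lemma pair_elementary : @elementary _ (pair_structure M) N' j.
Proof. by case: sP. Qed.

Lemma pair_exists V (X : finType) (psi : form (pair_language L) (X + V)) (d : V -> U) :
  (exists a : X -> N', sat (join a (j \o d)) psi) ->
  exists a : X -> U, @sat _ (pair_structure M) _ (join a d) psi.
Proof. exact: (elementary_exists pair_elementary). Qed.

Lemma reduct_elementary : elementary jW.
Proof.
move=> m phi e; rewrite -(sat_pair (N := N') phi (j \o e)).
rewrite (elementary_sat _ (e : 'I_m -> pair_structure M) pair_elementary).
exact: sat_pair_structure.
Qed.

Lemma pred_j x : P (j x) <-> M x.
Proof.
have := elementary_sat (in_P L tt) (fun=> x : pair_structure M) pair_elementary.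
by [].
Qed.

(** The existence of a solution in P is expressible in the pair with parameters from [U], and in (U,
    M) the predicate is [M]. This is why retracted types are finitely satisfiable in [M]. *)
Lemma pred_solution n (Theta : form L ('I_n + U)) (a : 'I_n -> W) : (forall i, P (a i)) ->
  sat (join a jW) Theta -> exists b : tup n U, (forall i, M (b i)) /\ holds b Theta.
Proof.
move=> Pa ha; have [psi H] := all_in_P L (@inl 'I_n U).
have [|b] := @pair_exists U 'I_n (And (pair_form Theta) psi) id.
  by exists a; rewrite sat_And H sat_pair.
rewrite sat_And H => -[/sat_pair_structure hb Mb].
by exists b; split=> // i; exact: (Mb i).
Qed.

(* M is an elementary substructure of U, hence P(N') of N'. *)
Lemma pred_witness n m (phi : form L ('I_n + 'I_m)) (e : 'I_m -> W) : (forall i, P (e i)) ->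
  (exists a : 'I_n -> W, sat (join a e) phi) ->
  exists a : 'I_n -> W, (forall i, P (a i)) /\ sat (join a e) phi.
Proof.
move=> Pe [a ha]; apply: contrapT => nh.
have [p1 H1] := all_in_P L (@id 'I_m).
have [p2 H2] := all_in_P L (@inl 'I_n 'I_m).
pose psi := And (And p1 (exl (pair_form phi))) (Neg (exl (And p2 (pair_form phi)))).
have [|b] := @pair_exists void 'I_m (form_map inl psi) (of_void U).
  exists e; rewrite sat_map !sat_And H1 !sat_exl; split; first by split=> //; exists a; rewrite sat_pair.
  by move=> /sat_exl[c]; rewrite sat_And H2 sat_pair => -[Pc hc]; apply: nh; exists c.
rewrite sat_map !sat_And H1 sat_exl => -[[Mb [c]]] /sat_pair_structure hc; apply.
have dD : definable M [set x : tup n U | holds x (inst phi b)].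
  by apply: definable_holds; apply: over_inst => i; exact: (Mb i).
have [|x [Mx hx]] := definable_solution eM dD (a := c); first by rewrite /= holds_inst.
apply/sat_exl; exists x; rewrite sat_And H2; split; first by move=> i; exact: Mx.
by apply/sat_pair_structure; move: hx; rewrite /= holds_inst.
Qed.

(* tp(e/M) = tp(e'/M) for tuples indexed by an arbitrary type *)
Definition stype V (e : V -> W) (e' : V -> U) :=
  forall psi : form L (V + U), over M psi -> (sat (join e jW) psi <-> holds e' psi).

Lemma stype_same m (e : 'I_m -> W) (e' : tup m U) : stype e e' <-> @same_type L U M W j m e e'.
Proof.
split=> [h k psi c Mc|h psi [k [phi [c [Mc ->]]]]].
  by have := h _ (over_inst psi Mc); rewrite inst_sat holds_inst.
by rewrite inst_sat holds_inst; exact: h.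
Qed.

Lemma stype_sub V V' (f : V' -> V) e e' : stype e e' -> stype (e \o f) (e' \o f).
Proof.
move=> h psi [k [phi [c [Mc ->]]]].
pose f' (z : V' + 'I_k) : V + 'I_k := match z with inl x => inl (f x) | inr i => inr i end.
have := h _ (over_inst (form_map f' phi) Mc).
rewrite inst_sat !holds_inst !inst_sat !sat_map.
have E (S : Type) (b : V -> S) (c' : 'I_k -> S) : join b c' \o f' = join (b \o f) c' by apply: funext => -[].
by rewrite !E.
Qed.

Lemma stype_sat V (e : V -> W) e' (psi : form L V) : stype e e' -> (sat e psi <-> sat e' psi).
Proof.
move=> h; pose f (v : V) : V + void := inl v.
have := h (inst (form_map f psi) (of_void U)) (over_inst _ _).
rewrite inst_sat holds_inst !sat_map; apply; by case.
Qed.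

(** The type over [M] of a finite tuple of [N'] is finitely satisfiable in [U] by elementarity, and
    [U] is saturated over the small set [M]. *)
Lemma stype_exists (X : finType) (e : X -> W) : exists e', stype e e'.
Proof.
suff [e' h] : exists e' : 'I_#|X| -> U, stype (e \o enum_val) e'.
  exists (e' \o enum_rank).
  rewrite (_ : e = (e \o enum_val) \o enum_rank); first exact: stype_sub.
  by apply: funext => x /=; rewrite enum_rankK.
have [||a ha] := @Usat M #|X| [set Phi | over M Phi /\ sat (join (e \o enum_val) jW) Phi] sM.
- by move=> Phi [].
- move=> F fF Fpi; have [psi H] := finite_conj fF.
  have [|a] := elementary_exists (d := id) (psi := psi) reduct_elementary.
    by exists (e \o enum_val); apply/H => Phi /Fpi[].
  by move=> /H h; exists a.
exists a => Phi o; split=> [h|]; first by apply: ha.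
apply: contraPP => h h'; have /ha : [set Phi | over M Phi /\ sat (join (e \o enum_val) jW) Phi] (Neg Phi).
  by split=> //; case: o => m [phi [c [Mc ->]]]; exact: (over_inst (Neg phi)).
by apply.
Qed.

Section Ext.
Variables (n : nat) (p : set (@gform L U 'I_n)).
Hypothesis gp : global_type p.
Hypothesis ip : invariant M p.

Lemma stype_invariant (V : finType) (phi : form L ('I_n + V)) (e : V -> W) e' e'' :
  stype e e' -> stype e e'' -> p (inst phi e') -> p (inst phi e'').
Proof.
move=> h h'; pose en (z : 'I_#|V|) : V := enum_val z.
have [sigma [aut fx E]] : exists s, [/\ automorphism s, fixes M s & s \o (e' \o en) = e'' \o en].
  apply: (homogeneity Uhom smallU sM) => Phi o.
  by rewrite -(stype_sub en h o) (stype_sub en h' o).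
pose phi' := form_map (join inl (inr \o enum_rank) : 'I_n + V -> 'I_n + 'I_#|V|) phi.
have Ei (d : V -> U) : inst phi d = inst phi' (d \o en).
  rewrite /inst /phi' form_map_comp; congr form_map; apply: funext => -[] //= x.
  by rewrite /en enum_rankK.
by rewrite !Ei -E (ip aut fx).
Qed.

(* phi(x, e) belongs to the invariant extension of p to N' *)
Definition ext (V : Type) (phi : form L ('I_n + V)) (e : V -> W) :=
  exists e', stype e e' /\ p (inst phi e').

Lemma ext_inv_ext V (phi : form L ('I_n + V)) e : ext phi e ->
  @inv_ext L U 'I_n M W j p (inst phi e).
Proof.
move=> [e' [h pe]]; have [m [f [psi [E _]]]] := inst_inst_ord phi e.
have Ec A (u : V -> A) : inst phi u = inst psi (u \o f).
  by rewrite E /inst form_map_comp; congr form_map; apply: funext => -[].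
exists m, psi, (e \o f), (e' \o f); split; [exact: Ec|by apply/stype_same; exact: stype_sub|by rewrite -Ec].
Qed.

Lemma ext_and (V V' : finType) (phi : form L ('I_n + V)) (phi' : form L ('I_n + V')) e e' :
  ext phi e -> ext phi' e' ->
  ext (And (form_map (join inl (inr \o inl)) phi) (form_map (join inl (inr \o inr)) phi')) (join e e').
Proof.
move=> [e1 [h1 p1]] [e2 [h2 p2]]; have [u hu] := stype_exists (join e e').
exists u; split=> //.
have p1' := stype_invariant h1 (stype_sub inl hu : stype e (u \o inl)) p1.
have p2' := stype_invariant h2 (stype_sub inr hu : stype e' (u \o inr)) p2.
apply: (gt_and gp p1' p2') => a /holds_inst k1 /holds_inst k2.
rewrite holds_inst sat_And !sat_map; split.
  by rewrite (_ : _ \o _ = join a (u \o inl)) //; apply: funext => -[].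
by rewrite (_ : _ \o _ = join a (u \o inr)) //; apply: funext => -[].
Qed.

Lemma ext_top : ext (Neg Bot : form L ('I_n + void)) (of_void W).
Proof.
have [u hu] := stype_exists (of_void W); exists u; split=> //.
by apply/(gt_neg gp) => /(gt_nonempty gp)[].
Qed.

(** Membership in the invariant extension does not depend on how a formula is written with
    parameters: [e] and [e'] have a joint copy in [U], and a failure of the implication is expressed
    by one formula on the joint tuple. *)
Lemma ext_iff (V V' : finType) (phi : form L ('I_n + V)) (phi' : form L ('I_n + V')) e e' :
  ext phi e -> (forall a : 'I_n -> W, sat (join a e) phi -> sat (join a e') phi') -> ext phi' e'.
Proof.
move=> [e1 [h1 p1]] H; have [u hu] := stype_exists (join e e').
have p1' := stype_invariant h1 (stype_sub inl hu : stype e (u \o inl)) p1.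
exists (u \o inr); split; first exact: (stype_sub inr hu).
apply: (gt_sub gp p1') => a; rewrite !holds_inst => k; apply: contrapT => nk.
pose f (z : 'I_n + V) : 'I_n + (V + V') := match z with inl x => inl x | inr x => inr (inl x) end.
pose f' (z : 'I_n + V') : 'I_n + (V + V') := match z with inl x => inl x | inr x => inr (inr x) end.
pose psi := exl (And (form_map f phi) (Neg (form_map f' phi'))).
have E1 (S : Type) (b : 'I_n -> S) c : join b c \o f = join b (c \o inl) by apply: funext => -[].
have E2 (S : Type) (b : 'I_n -> S) c : join b c \o f' = join b (c \o inr) by apply: funext => -[].
have /sat_exl[c] : sat (join e e') psi.
  by apply/(stype_sat psi hu)/sat_exl; exists a; rewrite sat_And /= !sat_map E1 E2.
rewrite sat_And /= !sat_map E1 E2 => -[k1 k2].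
by apply: k2; exact: H.
Qed.
End Ext.

(** The flag [inP] adds P(x) to the conditions, so that one statement serves for realizations in
    P(N') and in all of N'. *)
Lemma reduct_saturation (inP : Prop) n (A : set N') (pi : set (form L ('I_n + W))) :
  A #<= [set: U] -> pi `<=` @over L W 'I_n A ->
  (forall F, finite_set F -> F `<=` pi ->
     exists a : 'I_n -> W, (inP -> forall i, P (a i)) /\ forall Phi, F Phi -> @holds L W _ a Phi) ->
  exists a : 'I_n -> W, (inP -> forall i, P (a i)) /\ forall Phi, pi Phi -> @holds L W _ a Phi.
Proof.
move=> cA oA fs.
have sat_h (a : 'I_n -> W) (Phi : form L ('I_n + W)) : @holds _ N' _ a (pair_form Phi) <-> @holds L W _ a Phi.
  exact: sat_pair.
have [|F' fF' hF'|a ha] := sP.2 A n ((@pair_form L ('I_n + N')) @` pi `|` [set Phi | inP /\ exists i, Phi = in_P L (inl i)]) cA.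
- move=> Phi [[Psi /oA[m [phi [d [Ad ->]]]] <-]|[_ [i ->]]].
    by rewrite /inst pair_form_map; exact: (over_inst (pair_form phi) Ad).
  have -> : in_P L (inl i) = inst (in_P L (inl i : 'I_n + void)) (of_void N') by [].
  by apply: over_inst => -[].
- have [F [fF Fpi hF]] := finite_preimage fF' hF'.
  have [a [Pa ha]] := fs F fF Fpi; exists a => Phi /hF[[Psi /ha h <-]|[hP [i ->]]].
    exact/sat_h.
  exact: Pa.
exists a; split=> [hP i|Phi piPhi].
  have := ha (in_P L (inl i)); apply; right; split=> //; by exists i.
by apply/sat_h/ha; left; exists Phi.
Qed.

Definition lift n (Phi : form L ('I_n + U)) : form L ('I_n + W) := form_map (join inl (inr \o j)) Phi.

Lemma sat_lift n (a : 'I_n -> W) Phi : @holds L W _ a (lift Phi) <-> sat (join a jW) Phi.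
Proof. by rewrite /holds sat_map (_ : join a id \o _ = join a j) //; apply: funext => -[]. Qed.

Lemma over_lift n (A : set U) (Phi : form L ('I_n + U)) : over A Phi -> @over L W _ (j @` A) (lift Phi).
Proof.
move=> [m [phi [d [Ad ->]]]]; rewrite (_ : lift _ = inst phi (j \o d)).
  by apply: (over_inst (N := W) phi) => i; exists (d i).
by rewrite /lift /inst form_map_comp; congr form_map; apply: funext => -[].
Qed.

(** The type of [c] over [M] is finitely satisfiable in [M], whose image lies in P, and its
    parameters are at most as many as the elements of [U]. *)
Lemma pred_realization n (c : tup n U) : exists e : 'I_n -> W, (forall i, P (e i)) /\ stype e c.
Proof.
have [||F fF Fpi|e [Pe he]] := @reduct_saturation True n (j @` M) (@lift n @` [set Phi | over M Phi /\ holds c Phi]).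
- by apply: card_le_trans (card_image_le _ _) (card_leT _).
- by move=> _ [Phi [o _] <-]; exact: over_lift.
- have [F0 [fF0 F0pi hF]] := @finite_preimage _ _ (@lift n) _ set0 F fF (fun Phi h => or_introl (Fpi Phi h)).
  have [psi [o H]] := finite_conj_over fF0 (fun Phi h => (F0pi Phi h).1).
  have [a [Ma ha]] := definable_solution eM (definable_holds o) (a := c) ((H _ _).2 (fun Phi h => (F0pi _ h).2)).
  exists (j \o a); split=> [_ i|Phi /hF[[Psi F0Psi <-]|//]]; first exact/pred_j.
  apply/sat_lift; rewrite (_ : join (j \o a) jW = jW \o join a id); last by apply: funext => -[].
  apply/(elementary_sat _ _ reduct_elementary).
  exact: (H U (join a id)).1.
exists e; split; first exact: Pe.
move=> Phi o; split.
  apply: contraPP => h h'; have : @holds L W _ e (lift (Neg Phi)).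
    apply: he; exists (Neg Phi) => //; split=> //.
    by case: o => m [phi [d [Md ->]]]; exact: (over_inst (Neg phi)).
  by move/sat_lift; apply.
by move=> h; apply/sat_lift/he; exists Phi.
Qed.

End Pair.

Section Sequences.
Variable T : Type.

Lemma in_mkseq (f : nat -> T) k x : List.In x (mkseq f k) <-> exists l, l < k /\ f l = x.
Proof.
suff H m : List.In x (map f (iota m k)) <-> exists l, (m <= l < m + k) /\ f l = x.
  by rewrite /mkseq H; split=> -[l [h E]]; exists l; split.
elim: k m => [|k IH] m /=; first by split=> // -[l []]; rewrite addn0 => /andP[/leq_ltn_trans h /h]; rewrite ltnn.
rewrite IH; split.
  case=> [<-|[l [/andP[h1 h2] <-]]]; first by exists m; rewrite leqnn addnS ltnS leq_addr.
  by exists l; rewrite (ltnW h1) addnS -addSn h2.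
move=> [l [/andP[h1 h2] <-]]; move: h1; rewrite leq_eqVlt => /orP[/eqP ->|h1]; first by left.
by right; exists l; rewrite h1 addSn -addnS h2.
Qed.

Lemma build_sequence (Q : seq T -> T -> Prop) : (forall s, exists a, Q s a) ->
  exists f : nat -> T, forall k, Q (mkseq f k) (f k).
Proof.
move=> /choice[next H].
pose fix pre k := if k is k'.+1 then rcons (pre k') (next (pre k')) else [::].
exists (fun k => next (pre k)) => k.
suff -> : mkseq (fun k => next (pre k)) k = pre k by exact: H.
by elim: k => // k IH; rewrite mkseqS IH.
Qed.

Definition coords (X : finType) (s : seq (X -> T)) : set T := [set x | exists t, List.In t s /\ exists i, t i = x].

Lemma finite_coords (X : finType) (s : seq (X -> T)) : finite_set (coords s).
Proof.
rewrite (_ : coords s = \bigcup_(t in [set t | List.In t s]) range t).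
  by apply: bigcup_finite => [|t _]; [exact: list_fin|apply: finite_image; exact: finite_finset].
apply/predeqP => x; split=> [[t [h [i <-]]]|[t h [i _ <-]]]; first by exists t => //; exists i.
by exists t; split=> //; exists i.
Qed.

End Sequences.

(** * Completeness and continuity of the retraction under NIP *)

Section Retraction.
Variables (L : language) (U : structure L) (small : set (set U)).
Hypothesis Usat : saturated small.
Hypothesis Uhom : strongly_homogeneous small.
Hypothesis smallU : forall A B : set U, small A -> finite_set B -> small (A `|` B).
Hypothesis small_countable : forall A : set U, countable A -> small A.
Variable M : set U.
Hypothesis eM : elem_substructure M.
Hypothesis sM : small M.
Variables (N' : structure (pair_language L)) (j : U -> N').
Hypothesis sP : saturated_pair M j.
Variable T : set (form L void).
Hypothesis TU : models U T.
Hypothesis nip : NIP T.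

Notation W := (reduct N').
Notation P := (@pred_of L N').
Notation jW := (j : U -> W).
Notation ext := (ext M j).
Notation stype := (@stype L U M N' j _).

(* If U is finite, j is onto. *)
Lemma card_le_pair (A : set N') F : A `<=` range j -> finite_set F -> A `|` F #<= [set: U].
Proof.
move=> Aj fF; case: (EM (finite_set [set: U])) => [fU|iU].
  apply: (card_le_trans _ (card_image_le j _)); apply: subset_card_le => y _.
  apply: contrapT => ny.
  pose psi (u : U) : form L ('I_1 + U) := Neg (Eq (Var L (inl ord0)) (Var L (inr u))).
  have [theta H] := finite_conj (finite_image psi fU).
  have [|a] := elementary_exists (X := 'I_1) (d := id) (psi := theta) (reduct_elementary sP).
    by exists (fun=> y); apply/H => _ [u _ <-] /= E; apply: ny; exists u.
  by move=> /H /(_ (psi (a ord0))); case; [exists (a ord0)|].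
apply: card_le_setU => //; apply: card_le_trans (subset_card_le Aj) (card_image_le _ _).
Qed.

Section Type_.
Variables (n : nat) (p : set (@gform L U 'I_n)).
Hypothesis gp : global_type p.
Hypothesis ip : invariant M p.

(** A formula of the extension restricted to [Q] comes with two presentations: one whose parameters
    have a copy in [U], and one whose parameters lie in [Q]. [ext_iff] passes from the first to the
    second, and finitely many formulas are then joined by conjunction. *)
Lemma ext_collapse (Q : set N') (F : set (form L ('I_n + W))) : finite_set F ->
  (forall Psi, F Psi -> @inv_ext L U 'I_n M W j p Psi /\ @over L W 'I_n Q Psi) ->
  exists (V : finType) (phi : form L ('I_n + V)) (e : V -> W),
    [/\ forall v, Q (e v), ext p phi e &
        forall a : 'I_n -> W, sat (join a e) phi -> forall Psi, F Psi -> @holds L W _ a Psi].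
Proof.
move=> /fin_list[s Fs] h.
suff [V [phi [e [Pe xe H]]]] : exists (V : finType) (phi : form L ('I_n + V)) (e : V -> W),
    [/\ forall v, Q (e v), ext p phi e &
        forall a : 'I_n -> W, sat (join a e) phi -> forall Psi, List.In Psi s -> @holds L W _ a Psi].
  by exists V, phi, e; split=> // a ha Psi /Fs; exact: H.
have {h} : forall Psi, List.In Psi s -> @inv_ext L U 'I_n M W j p Psi /\ @over L W 'I_n Q Psi.
  by move=> Psi /Fs/h.
elim: s {Fs} => [|Psi s IH] h.
  exists void, (Neg Bot), (of_void W); by split=> //; exact: (ext_top Usat sM sP gp).
have [|V [phi [e [Pe xe H]]]] := IH; first by move=> Psi' hs; apply: h; right.
have [[m1 [phi1 [e1 [e1' [E1 st1 pe1]]]]] [m2 [phi2 [e2 [Pe2 E2]]]]] := h Psi (or_introl erefl).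
have x1 : ext p phi1 e1 by exists e1'; split=> //; apply/stype_same.
have x2 : ext p phi2 e2.
  apply: (ext_iff Usat Uhom smallU sM sP gp ip x1) => a.
  have h1 : @holds L W _ a Psi <-> sat (join a e1) phi1 by rewrite E1 holds_inst.
  have h2 : @holds L W _ a Psi <-> sat (join a e2) phi2 by rewrite E2 holds_inst.
  by move=> /h1/h2.
have x := ext_and Usat Uhom smallU sM sP gp ip x2 xe.
have PV v : Q (join e2 e v) by case: v.
exists ('I_m2 + V)%type, (And (form_map (join inl (inr \o inl)) phi2) (form_map (join inl (inr \o inr)) phi)).
exists (join e2 e); split=> // a.
rewrite sat_And !sat_map => -[k1 k2] Psi' [<-|hs].
  rewrite E2 holds_inst; move: k1; congr sat; by apply: funext => -[].
apply: H hs; move: k2; congr sat; by apply: funext => -[].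
Qed.

Lemma ext_exists (V : finType) (phi : form L ('I_n + V)) (e : V -> W) :
  ext p phi e -> exists a : 'I_n -> W, sat (join a e) phi.
Proof.
move=> [e' [st pe]].
have /(stype_sat (exl phi) st).2 : sat e' (exl phi).
  by have [a] := gt_nonempty gp pe; rewrite holds_inst => ha; apply/sat_exl; exists a.
by move=> /sat_exl.
Qed.

Lemma ext_witness (V : finType) (phi : form L ('I_n + V)) (e : V -> W) : (forall v, P (e v)) ->
  ext p phi e -> exists a : 'I_n -> W, (forall i, P (a i)) /\ sat (join a e) phi.
Proof.
move=> Pe /ext_exists[a ha].
pose f (z : 'I_n + V) : 'I_n + 'I_#|V| := match z with inl x => inl x | inr x => inr (enum_rank x) end.
have Ef (b : 'I_n -> W) : join b (e \o enum_val) \o f = join b e.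
  by apply: funext => -[//|v] /=; rewrite enum_rankK.
have [||b [Pb]] := @pred_witness L U M eM N' j sP n #|V| (form_map f phi) (e \o enum_val).
- by move=> i; exact: Pe.
- by exists a; rewrite sat_map Ef.
by rewrite sat_map Ef => hb; exists b.
Qed.

Lemma retractionP Theta : retraction M j p Theta <->
  forall (V : finType) (phi : form L ('I_n + V)) (e : V -> W), (forall v, P (e v)) -> ext p phi e ->
    exists a : 'I_n -> W, [/\ forall i, P (a i), sat (join a jW) Theta & sat (join a e) phi].
Proof.
split=> [h V phi e Pe xe|h F fF Fp].
  have [|Psi ->|a [hT Pa ha]] := h [set inst phi e]; first exact: finite_set1.
    by split; [exact: ext_inv_ext|exact: over_inst].
  by exists a; split=> //; have := ha _ erefl; rewrite holds_inst.
have [V [phi [e [Pe xe H]]]] := ext_collapse fF Fp.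
by have [a [Pa hT ha]] := h V phi e Pe xe; exists a; split=> //; exact: H.
Qed.

(** Saturation turns consistency into an actual point of P(N'), generic over [M] and the list [s],
    which will be the history of a sequence under construction. *)
Lemma retraction_saturated Theta s :
  retraction M j p Theta -> (forall t, List.In t s -> forall i : 'I_n, P (t i)) ->
  let A := j @` M `|` coords s in
  exists a : 'I_n -> W, [/\ forall i, P (a i), sat (join a jW) Theta &
    forall Psi, @inv_ext L U 'I_n M W j p Psi -> @over L W 'I_n A Psi -> @holds L W _ a Psi].
Proof.
move=> hT Ps A; have [k [theta [d [_ ET]]]] := over_setT Theta.
have AP : A `<=` P.
  by move=> x [[u Mu <-]|[t [/Ps Pt [i <-]]]]; [apply/(pred_j sP)|exact: Pt].
pose pi := [set Psi | @inv_ext L U 'I_n M W j p Psi /\ @over L W 'I_n A Psi] `|` [set inst theta (jW \o d)].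
(* The parameters of [Theta] have to be counted for the saturation, although p is restricted to [A]
   only. *)
have cB : (j @` M `|` range (j \o d)) `|` coords s #<= [set: U].
  by apply: card_le_pair (@finite_coords _ _ s) => x [[u _ <-]|[i _ <-]]; [exists u|exists (d i)].
have [||a [Pa ha]] := reduct_saturation sP (inP := True) (pi := pi) cB.
- move=> Psi [[_]|->]; first by apply: over_sub => x [?|?]; [left; left|right].
  by apply: over_inst => i; left; right; exists i.
- move=> F fF Fpi; pose F0 := F `&` [set Psi | @inv_ext L U 'I_n M W j p Psi /\ @over L W 'I_n A Psi].
  have [||a [hTa Pa ha]] := hT F0; first exact: finite_setIl.
    by move=> Psi [_ [h1 h2]]; split=> //; exact: over_sub h2.
  exists a; split=> // Psi FPsi; have [h|->] := Fpi _ FPsi; first by apply: ha.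
  rewrite holds_inst; move: hTa; rewrite ET inst_sat; by [].
exists a; split; first exact: Pa.
  by rewrite ET inst_sat -(holds_inst (N := W)); apply: ha; right.
by move=> Psi h1 h2; apply: ha; left.
Qed.

Lemma stype_join m (V : Type) (e : V -> W) e' (c : tup m U) : stype e e' -> (forall i, M (c i)) ->
  stype (join e (jW \o c)) (join e' c).
Proof.
move=> st Mc psi [k [phi [d [Md ->]]]].
pose f (z : (V + 'I_m) + 'I_k) : V + ('I_m + 'I_k) :=
  match z with inl (inl v) => inl v | inl (inr i) => inr (inl i) | inr i => inr (inr i) end.
have Mcd y : M (join c d y) by case: y.
have := st _ (over_inst (form_map f phi) Mcd); rewrite inst_sat !holds_inst inst_sat !sat_map.
have -> : join e ((j : U -> W) \o join c d) \o f = join (join e (jW \o c)) (jW \o d) by apply: funext => -[[]|].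
by have -> : join e' (join c d) \o f = join (join e' c) d by apply: funext => -[[]|].
Qed.

(* Both are Morley sequences of p: each term realizes p, or its invariant
   extension, over M and the previous terms. *)
Lemma morley_sequence_stype (a : nat -> 'I_n -> W) (a' : nat -> tup n U) (idx : nat -> nat) :
  (forall k i, P (a k i)) ->
  (forall k Psi, @inv_ext L U 'I_n M W j p Psi ->
     @over L W 'I_n (j @` M `|` coords (mkseq a k)) Psi ->
     @holds L W _ (a k) Psi) ->
  (forall k, Real (M `|` coords (mkseq a' k)) p (a' k)) ->
  (forall l k, l < k -> idx l < idx k) ->
  forall k, stype (fun z : 'I_k * 'I_n => a (idx z.1) z.2) (fun z => a' z.1 z.2).
Proof.
move=> Pa Ra Ra' lt_idx; elim=> [|k IH].
  have [u hu] := stype_exists Usat sM sP (fun z : 'I_0 * 'I_n => a (idx z.1) z.2).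
  by rewrite (_ : (fun z => _) = u) //; apply: funext => -[[]].
move=> psi [r [phi [c [Mc ->]]]]; rewrite inst_sat holds_inst.
pose V := ('I_k * 'I_n + 'I_r)%type.
have [g hg] : exists g : 'I_k.+1 * 'I_n -> 'I_n + V, forall z,
    g z = match unlift ord_max z.1 with Some l => inr (inl (l, z.2)) | None => inl z.2 end.
  by eexists.
pose f (z : 'I_k.+1 * 'I_n + 'I_r) : 'I_n + V := match z with inl z => g z | inr i => inr (inr i) end.
set e := fun z : 'I_k * 'I_n => a (idx z.1) z.2 in IH.
set e' := fun z : 'I_k * 'I_n => a' z.1 z.2 in IH.
have E1 : join (fun z : 'I_k.+1 * 'I_n => a (idx z.1) z.2) (jW \o c) = join (a (idx k)) (join e (jW \o c)) \o f.
  apply: funext => -[[l i]|i] //=; rewrite hg /=; case: unliftP => [l' ->|->] //=.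
  by rewrite /e /= /bump leqNgt ltn_ord.
have E2 : join (fun z : 'I_k.+1 * 'I_n => a' z.1 z.2) c = join (a' k) (join e' c) \o f.
  apply: funext => -[[l i]|i] //=; rewrite hg /=; case: unliftP => [l' ->|->] //=.
  by rewrite /e' /= /bump leqNgt ltn_ord.
rewrite E1 E2 -!sat_map; set theta := form_map f phi.
have st := stype_join IH Mc.
have o' th : over (M `|` coords (mkseq a' k))
    (inst th (join e' c) : form L ('I_n + U)).
  apply: over_inst => -[[l i]|i] /=; last by left.
  by right; exists (a' l); split; [apply/in_mkseq; exists l|exists i].
have o th : @over L W 'I_n (j @` M `|` coords (mkseq a (idx k)))
    (inst th (join e (jW \o c))).
  apply: over_inst => -[[l i]|i] /=; last by left; exists (c i).
  by right; exists (a (idx l)); split; [apply/in_mkseq; exists (idx l); split=> //; exact: lt_idx|exists i].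
have main th : sat (join (a' k) (join e' c)) th -> sat (join (a (idx k)) (join e (jW \o c))) th.
  rewrite -holds_inst => /(Ra' k _ (o' th)) pth.
  have := Ra (idx k) _ (ext_inv_ext (ex_intro _ _ (conj st pth))) (o th).
  by rewrite holds_inst.
split; last exact: main.
by apply: contraPP => /(main (Neg theta)).
Qed.

(** Otherwise a Morley sequence of p can be chosen in P(N') so that [Theta] holds exactly at the odd
    places. Every subsequence has the type over [M] of a fixed Morley sequence in [U], on which all
    patterns of truth values are therefore realized. *)
Lemma retraction_consistent Theta : retraction M j p Theta -> ~ retraction M j p (Neg Theta).
Proof.
move=> hT hF; apply: nip; have [m [theta [d [_ ET]]]] := over_setT Theta.
have sat_theta (x : 'I_n -> W) : sat (join x jW) Theta <-> sat (join x (jW \o d)) theta.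
  by rewrite ET inst_sat.
(* an alternating sequence in P(N') *)
have [a Ha] : exists a : nat -> 'I_n -> W, forall k,
    (forall t, List.In t (mkseq a k) -> forall i, P (t i)) ->
    [/\ forall i, P (a k i), sat (join (a k) jW) Theta <-> odd k &
    forall Psi, @inv_ext L U 'I_n M W j p Psi ->
     @over L W 'I_n (j @` M `|` coords (mkseq a k)) Psi ->
     @holds L W _ (a k) Psi].
  have [s|a Ha] := @build_sequence ('I_n -> W) (fun s b =>
    (forall t, List.In t s -> forall i, P (t i)) ->
    [/\ forall i, P (b i), sat (join b jW) Theta <-> odd (size s) &
    forall Psi, @inv_ext L U 'I_n M W j p Psi ->
     @over L W 'I_n (j @` M `|` coords s) Psi ->
     @holds L W _ b Psi]).
    case: (EM (forall t, List.In t s -> forall i, P (t i))) => [Ps|nP]; last first.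
      by have [x] := carrier_inh W; exists (fun=> x).
    case: (boolP (odd (size s))) => hs.
      by have [b [Pb Tb Hb]] := retraction_saturated hT Ps; exists b.
    have [b [Pb Tb Hb]] := retraction_saturated hF Ps; exists b => _; split=> //.
    by split=> // /Tb.
  by exists a => k Pk; have := Ha k Pk; rewrite size_mkseq.
have Pa k : forall i, P (a k i).
  elim: {k}k.+1 {-2}k (ltnSn k) => // N IH k; rewrite ltnS => kN.
  have [|//] := Ha k; move=> t /in_mkseq[l [lk <-]]; apply: IH.
  exact: leq_trans lk kN.
have {}Ha k := Ha k (fun t h => let: ex_intro l (conj _ E) := (in_mkseq a k t).1 h in
  eq_ind _ (fun t => forall i, P (t i)) (Pa l) _ E).
(* a Morley sequence in U *)
have [a' Ra'] : exists a' : nat -> tup n U, forall k,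
    Real (M `|` coords (mkseq a' k)) p (a' k).
  apply: (@build_sequence _ (fun s b => Real (M `|` coords s) p b)) => s.
  apply: (exists_Real Usat gp); apply: smallU => //.
  exact: finite_coords.
pose th (b : bool) := if b then theta else Neg theta.
have finite_pattern (S : set nat) k : exists y : tup m U,
    forall l : 'I_k, sat (join (a' l) y) (th `[<S l>]).
  (* Of the places 2l and 2l+1 the odd one is taken exactly when l belongs to [S]; on this
     subsequence [d] itself realizes the pattern [S]. *)
  pose idx l := (l.*2 + `[<S l>])%N.
  have lt_idx l l' : l < l' -> idx l < idx l'.
    rewrite /idx => h; apply: (@leq_trans l.+1.*2).
      by rewrite doubleS; case: asboolP => _; rewrite ?addn1 ?addn0 // ltnW.
    by apply: leq_trans (leq_addr _ _); rewrite leq_double.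
  have Ha3 l := let: And3 _ _ h := Ha l in h.
  have st : stype (fun z : 'I_k * 'I_n => a (idx z.1) z.2) (fun z => a' z.1 z.2).
    exact: morley_sequence_stype Pa Ha3 Ra' lt_idx k.
  pose f (l : 'I_k) (z : 'I_n + 'I_m) : 'I_k * 'I_n + 'I_m :=
    match z with inl i => inl (l, i) | inr i => inr i end.
  have fF : finite_set (range (fun l : 'I_k => form_map (f l) (th `[<S l>]))).
    by apply: finite_image; exact: finite_finset.
  have [psi H] := finite_conj fF.
  (* That some tuple realizes the pattern belongs to the type of the subsequence, hence is true of
     [a'] in [U] as well. *)
  have /(stype_sat (exn psi) st) : sat (fun z : 'I_k * 'I_n => a (idx z.1) z.2) (exn psi).
    apply/sat_exn; exists (jW \o d); apply/H => _ [l _ <-]; rewrite sat_map.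
    rewrite (_ : _ \o _ = join (a (idx l)) (jW \o d)); last by apply: funext => -[].
    have [_ hodd _] := Ha (idx l).
    have Eo : odd (idx l) = `[<S l>] by rewrite /idx oddD odd_double; case: `[<S l>].
    by move: hodd; rewrite sat_theta Eo /th; case: `[<S l>] => -[h1 h2]; [exact: h2|move/h1].
  move=> /sat_exn[y]; rewrite H => hy; exists y => l.
  have := hy _ (imageP _ (a := l) I); rewrite sat_map.
  by rewrite (_ : _ \o _ = join (a' l) y) //; apply: funext => -[].
have pattern (S : set nat) : exists y : tup m U, forall l, sat (join (a' l) y) theta <-> S l.
  pose psi l : form L ('I_m + U) := inst (form_map (join inr inl) (th `[<S l>])) (a' l).
  have hpsi y l : holds y (psi l) <-> sat (join (a' l) y) (th `[<S l>]).
    by rewrite holds_inst sat_map (_ : _ \o _ = join (a' l) y) //; apply: funext => -[].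
  (* Finite patterns add up to an infinite one by saturation over the countable set of coordinates
     of [a']. *)
  have [||F fF Fpsi|y hy] := @Usat [set x | exists l i, x = a' l i] m (range psi).
  - apply: small_countable; rewrite (_ : [set _ | _] = \bigcup_l (range (a' l))).
      by apply: bigcup_countable => // l _; apply: finite_set_countable; exact: finite_range.
    by apply/predeqP => x; split=> [[l [i ->]]|[l _ [i _ <-]]]; [exists l => //; exists i|exists l, i].
  - by move=> _ [l _ <-]; apply: over_inst => i; exists l, i.
  - have [F0 [fF0 _ hF0]] := @finite_preimage _ _ psi setT set0 F fF (fun Phi h => or_introl (Fpsi Phi h)).
    have [s Fs] := fin_list fF0.
    have [k hk] : exists k, forall l, List.In l s -> l < k.
      elim: s {Fs} => [|x s [k hk]]; first by exists 0.
      exists (maxn x.+1 k) => l [<-|/hk h]; first by rewrite leq_maxl.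
      by apply: leq_trans h _; rewrite leq_maxr.
    have [y hy] := finite_pattern S k; exists y => Phi /hF0[[l /Fs/hk lk <-]|//].
    by apply/hpsi; exact: (hy (Ordinal lk)).
  exists y => l; have /hpsi := hy _ (imageP _ (a := l) I).
  by rewrite /th; case: asboolP => h k; [split|split=> [/k|/h]].
have [b Hb] := choice pattern.
by exists U, n, m, theta, a', b; split=> // i S; exact: Hb.
Qed.

(** If [Theta] is consistent with p|_N on P then its negation is not, so a single formula phi(x, e)
    of p|_N forces [Theta] on P. Such a certificate, unlike mere consistency, is compatible with
    conjunctions and can be carried over to other types. *)
Lemma retraction_cert Theta : retraction M j p Theta <->
  exists (V : finType) (phi : form L ('I_n + V)) (e : V -> W),
    [/\ forall v, P (e v), ext p phi e &
      forall a : 'I_n -> W, (forall i, P (a i)) -> sat (join a e) phi -> sat (join a jW) Theta].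
Proof.
split=> [/retraction_consistent h|[V [phi [e [Pe xe H]]]]].
  apply: contrapT => nc; apply: h; apply/retractionP => V phi e Pe xe.
  apply: contrapT => na; apply: nc; exists V, phi, e; split=> // a Pa ha.
  by apply: contrapT => nT; apply: na; exists a; split.
apply/retractionP => V' phi' e' Pe' xe'.
have [|a [Pa]] := ext_witness _ (ext_and Usat Uhom smallU sM sP gp ip xe xe').
  by case.
rewrite sat_And !sat_map => -[k1 k2]; exists a; split=> //.
  apply: H => //; move: k1; congr sat; by apply: funext => -[].
move: k2; congr sat; by apply: funext => -[].
Qed.

Lemma retraction_cert_list (s : list (gform U 'I_n)) : (forall Theta, List.In Theta s -> retraction M j p Theta) ->
  exists a : 'I_n -> W, (forall i, P (a i)) /\ forall Theta, List.In Theta s -> sat (join a jW) Theta.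
Proof.
move=> h; suff [V [phi [e [Pe xe H]]]] : exists (V : finType) (phi : form L ('I_n + V)) (e : V -> W),
    [/\ forall v, P (e v), ext p phi e &
      forall a : 'I_n -> W, (forall i, P (a i)) -> sat (join a e) phi ->
        forall Theta, List.In Theta s -> sat (join a jW) Theta].
  by have [a [Pa ha]] := ext_witness Pe xe; exists a; split=> // Theta; exact: H.
elim: s h => [|Theta s IH] h.
  by exists void, (Neg Bot), (of_void W); split=> //; exact: (ext_top Usat sM sP gp).
have [|V [phi [e [Pe xe H]]]] := IH; first by move=> Theta' hs; apply: h; right.
have [V' [phi' [e' [Pe' xe' H']]]] := (retraction_cert Theta).1 (h Theta (or_introl erefl)).
exists (V + V')%type, (And (form_map (join inl (inr \o inl)) phi) (form_map (join inl (inr \o inr)) phi')).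
exists (join e e'); split; [by case|exact: (ext_and Usat Uhom smallU sM sP gp ip xe xe')|].
move=> a Pa; rewrite sat_And !sat_map => -[k1 k2] Theta' [<-|hs].
  apply: H' => //; move: k2; congr sat; by apply: funext => -[].
apply: (H a Pa) hs; move: k1; congr sat; by apply: funext => -[].
Qed.

Lemma retraction_global : global_type (retraction M j p).
Proof.
split=> [F /fin_list[s Fs] FR|Theta].
  have [|a [Pa ha]] := @retraction_cert_list s; first by move=> Theta /Fs/FR.
  have [psi H] := finite_conj (list_fin s).
  have [|b [_ hb]] := @pred_solution L U M N' j sP n psi a Pa; first by apply/H => Theta; exact: ha.
  by exists b => Phi /Fs hs; apply: (H U (join b id)).1.
case: (EM (retraction M j p Theta)) => [|h]; [by left|right].
apply/retraction_cert; apply: contrapT => nc; apply: h; apply/retractionP => V phi e Pe xe.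
apply: contrapT => na; apply: nc; exists V, phi, e; split=> // a Pa ha hT.
by apply: na; exists a; split.
Qed.

Lemma retraction_fs : fs_in M (retraction M j p).
Proof.
move=> Theta hT; have [|a [Pa ha]] := @retraction_cert_list [:: Theta].
  by move=> Theta' [<-|].
have [|b [Mb hb]] := @pred_solution L U M N' j sP n Theta a Pa; first by apply: ha; left.
by exists b.
Qed.

Lemma retraction_over Theta : over M Theta -> p Theta -> retraction M j p Theta.
Proof.
move=> [m [phi [e [Me ->]]]] pT; apply/retraction_cert.
exists 'I_m, phi, (jW \o e); split=> [v||a _]; first by apply/(pred_j sP).
  exists e; split=> // psi o; rewrite (_ : join (jW \o e) jW = jW \o join e id); last by apply: funext => -[].
  exact: elementary_sat (reduct_elementary sP).
by rewrite inst_sat.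
Qed.

End Type_.

(** Let phi(x, e) be a certificate and let e' in [U] have the type of e over [M]: every invariant
    type containing phi(x, e') has the same certificate. *)
Lemma retraction_continuous n (p : set (@gform L U 'I_n)) Theta : global_type p -> invariant M p ->
  retraction M j p Theta -> exists Psi, p Psi /\
    forall r : set (@gform L U 'I_n), global_type r -> invariant M r -> r Psi -> retraction M j r Theta.
Proof.
move=> gp ip /(retraction_cert gp ip)[V [phi [e [Pe [e' [st pe]] H]]]].
exists (inst phi e'); split=> // r gr ir re; apply/(retraction_cert gr ir).
by exists V, phi, e; split=> //; exists e'.
Qed.

End Retraction.

(** * The retraction, definable maps and products *)

Section RetractionGroup.
Variables (L : language) (U : structure L) (small : set (set U)).
Hypothesis Usat : saturated small.
Hypothesis Uhom : strongly_homogeneous small.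
Hypothesis smallU : forall A B : set U, small A -> finite_set B -> small (A `|` B).
Hypothesis small_image : forall (A : set U) (f : U -> U), small A -> small (f @` A).
Hypothesis small_countable : forall A : set U, countable A -> small A.
Variable M : set U.
Hypothesis eM : elem_substructure M.
Hypothesis sM : small M.
Variables (N' : structure (pair_language L)) (j : U -> N').
Hypothesis sP : saturated_pair M j.
Variable T : set (form L void).
Hypothesis TU : models U T.
Hypothesis nip : NIP T.
Variables (n : nat) (G : def_group U n).

Notation gtp := (set (@gform L U 'I_n)).
Notation W := (reduct N').
Notation P := (@pred_of L N').
Notation jW := (j : U -> W).
Notation F := (@retraction L U M N' j 'I_n).
Notation op := (nprod G M).
Notation mul := (gmul G).

Let F_cert := retraction_cert Usat Uhom smallU small_countable eM sM sP TU nip.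
Let F_global := retraction_global Usat Uhom smallU small_countable eM sM sP TU nip.
Let F_fs := retraction_fs Usat Uhom smallU small_countable eM sM sP TU nip.
Let F_over := retraction_over Usat Uhom smallU small_countable eM sM sP TU nip.
Let F_consistent := retraction_consistent Usat smallU small_countable sM sP TU nip.
Let F_continuous := retraction_continuous Usat Uhom smallU small_countable eM sM sP TU nip.
Let FP := retractionP Usat Uhom smallU sM sP.
Let nprodR := nprod_Real Usat Uhom smallU sM (G := G).
Let smallR := small_range smallU.

Lemma eq_tuple V (X : finType) (f g : X -> V) : exists psi : form L V,
  forall (N : structure L) (v : V -> N), sat v psi <-> v \o f = v \o g.
Proof.
have fF : finite_set (range (fun i : X => Eq (Var L (f i)) (Var L (g i)))).
  by apply: finite_image; exact: finite_finset.
have [psi H] := finite_conj fF; exists psi => N v; rewrite H; split=> [h|E _ [i _ <-] /=].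
  by apply: funext => i; exact: (h _ (imageP _ (a := i) I)).
by have := congr1 (@^~ i) E.
Qed.

Lemma Real_F p A a : global_type p -> invariant M p -> A `<=` M -> Real A (F p) a -> Real A p a.
Proof.
move=> gp ip AM R Phi o; rewrite -(R _ o); split; first by apply: F_over => //; exact: over_sub o.
move=> FPhi; apply: contrapT => /(gt_neg gp) np; apply: (F_consistent gp FPhi).
apply: (F_over gp ip) => //.
by case: o => m [phi [e [he ->]]]; apply: (over_inst (Neg phi)) => i; exact: AM.
Qed.

Lemma F_conc p (D : set (tup n U)) : global_type p -> invariant M p -> definable M D ->
  concentrates p D -> concentrates (F p) D.
Proof.
move=> gp ip [Phi [o ->]] /(conc_holds gp) pPhi.
by apply/(conc_holds (F_global gp ip)); exact: F_over.
Qed.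

Lemma F_S (H : set (tup n U)) p : definable set0 H -> S_inv M H p -> S_fs M H (F p).
Proof.
move=> dH [[gp cp] ip]; split; last exact: F_fs.
split; first exact: F_global.
by apply: F_conc => //; exact: definable_mono dH.
Qed.

(** [gam] defines the graph of [f] and makes sense in [N'] too. If the two sides differed, a
    certificate phi(y, e) against [Theta] would put phi(f(x), e) into the extension of p; some a in
    P(N') would satisfy both this and Theta(f(x)), and f(a), being in P(N'), would contradict the
    certificate. *)
Lemma F_push k p (D : set (tup n U)) (f : tup n U -> tup n U) (gam : form L ('I_n + ('I_n + 'I_k))) (m : tup k U) :
  S_inv M D p -> (forall i, M (m i)) ->
  (forall x y, sat (join x (join y m)) gam <-> D x /\ y = f x) ->
  definable M D ->
  (forall x, D x -> (forall i, M (x i)) -> forall i, M (f x i)) ->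
  global_type (push D f p) -> invariant M (push D f p) -> global_type (push D f (F p)) ->
  F (push D f p) = push D f (F p).
Proof.
move=> [[gp cp] ip] Mm hgam dD cl gq iq gF.
have gFp := F_global gp ip.
(* Two complete types are equal when no formula of one is negated in the other. *)
suff main Theta : push D f (F p) Theta -> ~ F (push D f p) (Neg Theta).
  apply/predeqP => Theta; split.
    move=> FT; apply: contrapT => /(gt_neg gF)/main; apply.
    by apply: (gt_sub (F_global gq iq) FT) => a ha; apply.
  by move=> /main h; apply: contrapT => /(gt_neg (F_global gq iq)).
move=> hT /(F_cert gq iq)[V [phi [e [Pe [e' [st pe]] H]]]].
pose f1 (Y : Type) (z : 'I_n + ('I_n + 'I_k)) : ('I_n + (Y + 'I_k)) + 'I_n :=
  match z with inl x => inl (inl x) | inr (inl y) => inr y | inr (inr i) => inl (inr (inr i)) end.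
pose f2 (Y : Type) (z : 'I_n + Y) : ('I_n + (Y + 'I_k)) + 'I_n :=
  match z with inl y => inr y | inr z => inl (inr (inl z)) end.
pose ins (Y : Type) (theta : form L ('I_n + Y)) : form L ('I_n + (Y + 'I_k)) :=
  exn (And (form_map (f1 Y) gam) (form_map (f2 Y) theta)).
have sat_ins (N : structure L) Y (theta : form L ('I_n + Y)) (x : 'I_n -> N) v c :
    sat (join x (join v c)) (ins Y theta) <-> exists y : tup n N, sat (join x (join y c)) gam /\ sat (join y v) theta.
  have E1 y : join (join x (join v c)) y \o f1 Y = join x (join y c) by apply: funext => -[|[]].
  have E2 y : join (join x (join v c)) y \o f2 Y = join y v by apply: funext => -[].
  by rewrite sat_exn; split=> -[y h]; exists y; move: h; rewrite sat_And !sat_map E1 E2.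
have ins_U Y (theta : form L ('I_n + Y)) (v : Y -> U) x : sat (join x (join v m)) (ins Y theta) <-> D x /\ sat (join (f x) v) theta.
  rewrite sat_ins; split=> [[y [/hgam[Dx ->]]]|[Dx h]] //; exists (f x); split=> //; exact/hgam.
have xe : ext M j p (ins V phi) (join e (jW \o m)).
  exists (join e' m); split; first exact: stype_join.
  have [Psi [pPsi E]] := pe.
  apply: (gt_sub gp pPsi) => a ha; rewrite holds_inst ins_U.
  have : [set a | holds a Psi] a by []; rewrite -E /= => -[Da]; rewrite holds_inst.
  by split.
have Pem v : P (join e (jW \o m) v) by case: v => [v|i] /=; [exact: Pe|apply/(pred_j sP)].
have FT : F p (inst (ins U Theta) (join id m)).
  have [Psi [pPsi E]] := hT.
  apply: (gt_sub gFp pPsi) => a ha; rewrite holds_inst ins_U.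
  by have : [set a | holds a Psi] a by []; rewrite -E.
have [a [Pa]] := (FP gp ip _).1 FT _ _ _ Pem xe.
rewrite inst_sat (_ : jW \o join id m = join jW (jW \o m)); last by apply: funext => -[].
move=> /sat_ins[y [g1 t1]] /sat_ins[y2 [g2 t2]].
(* Uniqueness of the value, and closure of P under [f], hold in (U, M); a failure in [N'] would be a
   failure there by elementarity of the pair. *)
have [Py E] : (forall i, P (y i)) /\ y = y2.
  apply: contrapT => nE.
  pose X := ('I_n + ('I_n + 'I_n))%type.
  pose g1' (z : 'I_n + ('I_n + 'I_k)) : X + 'I_k := match z with inl x => inl (inl x) | inr (inl y) => inl (inr (inl y)) | inr (inr i) => inr i end.
  pose g2' (z : 'I_n + ('I_n + 'I_k)) : X + 'I_k := match z with inl x => inl (inl x) | inr (inl y) => inl (inr (inr y)) | inr (inr i) => inr i end.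
  have [p1 H1] := all_in_P L (fun i : 'I_n => inl (inl i) : X + 'I_k).
  have [p2 H2] := all_in_P L (fun i : 'I_n => inl (inr (inl i)) : X + 'I_k).
  have [eq Heq] := eq_tuple (fun i : 'I_n => inl (inr (inl i)) : X + 'I_k) (fun i : 'I_n => inl (inr (inr i)) : X + 'I_k).
  pose psi := And (And p1 (pair_form (And (form_map g1' gam) (form_map g2' gam)))) (Neg (And p2 (pair_form eq))).
  have [|b] := @pair_exists L U M N' j sP 'I_k X psi m.
    exists (join a (join y y2)); rewrite !sat_And H1 !sat_pair !sat_map; split.
      have -> : join (join a (join y y2)) (j \o m) \o g1' = join a (join y (jW \o m)) by apply: funext => -[|[]].
      by have -> : join (join a (join y y2)) (j \o m) \o g2' = join a (join y2 (jW \o m)) by apply: funext => -[|[]].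
    rewrite sat_Neg sat_And H2 sat_pair Heq => -[h1 h2]; apply: nE; split=> //.
  rewrite !sat_And H1 !sat_pair_structure !sat_map => -[[Mb]].
  pose x := fun i : 'I_n => b (inl i).
  pose y' := fun i : 'I_n => b (inr (inl i)).
  pose y2' := fun i : 'I_n => b (inr (inr i)).
  rewrite (_ : _ \o g1' = join x (join y' m)); last by apply: funext => -[|[]].
  rewrite (_ : _ \o g2' = join x (join y2' m)); last by apply: funext => -[|[]].
  move=> [/hgam[Dx E1] /hgam[_ E2]]; rewrite sat_Neg sat_And H2 sat_pair_structure Heq; apply.
  split; last by rewrite -[LHS]/y' -[RHS]/y2' E1 E2.
  by move=> i; change (M (y' i)); rewrite E1; apply: cl => // i'; exact: (Mb i').
apply: (H y Py); last exact: t1.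
by rewrite E.
Qed.

Let dG := gset_def G.
Let sG := def_subgroup_G G.
Let Gfs p (Sp : S_inv M (gset G) p) : S_fs M (gset G) (F p) := F_S dG Sp.

Lemma translate_l_inv p (m : tup n U) : S_inv M (gset G) p -> gset G m -> (forall i, M (m i)) ->
  S_inv M (gset G) (translate_l G m p).
Proof.
move=> Sp Gm Mm; have lS := translate_l_S Usat smallU sM sG; split; first exact: lS Sp.1 Gm.
apply: (invariant_Real smallU sM) => A sA MA; have [[gp _] ip] := Sp.
have [a R] := exists_Real Usat gp sA; have Ga := S_in dG Sp.1 R.
exists (mul m a); split; first by apply: translate_l_Real => //; [exact: Sp.1|move=> _ [i _ <-]; exact: MA].
move=> s aut fx; rewrite (aut_mul aut) //.
have E : s \o m = m by apply: funext => i /=; exact: fx.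
rewrite E; apply: translate_l_Real => //; [exact: Sp.1| |exact: (inv_Real aut ip fx R)].
by move=> _ [i _ <-]; exists (m i); [exact: MA|exact: fx].
Qed.

Lemma F_lmul p (m : tup n U) : S_inv M (gset G) p -> gset G m -> (forall i, M (m i)) ->
  F (translate_l G m p) = translate_l G m (F p).
Proof.
move=> Sp Gm Mm; have [phi H] := dfun_gmul G.
pose f (z : ('I_n + 'I_n) + 'I_n) : 'I_n + ('I_n + 'I_n) :=
  match z with inl (inl i) => inr (inr i) | inl (inr x) => inl x | inr y => inr (inl y) end.
have [[gq _] iq] := translate_l_inv Sp Gm Mm.
apply: (F_push (gam := form_map f phi) (m := m)) => //.
- move=> x y; rewrite sat_map -H.
  have -> : join x (join y m) \o f = join (join m x) y by apply: funext => -[[]|].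
  split=> [[[_ Gx] E]|[Gx ->]] //; split=> //; exact: E.
- exact: definable_mono dG.
- by move=> x Gx Mx; exact: closed_mul.
- by have [] := translate_l_S Usat smallU sM sG (Gfs Sp).1 Gm.
Qed.

Lemma F_inv p : S_inv M (gset G) p -> F (type_inv G p) = type_inv G (F p).
Proof.
move=> Sp; have [phi H] := dfun_ginv G.
pose f (z : 'I_n + 'I_n) : 'I_n + ('I_n + 'I_0) :=
  match z with inl i => inl i | inr x => inr (inl x) end.
have [[gq _] iq] := type_inv_inv Usat smallU sM sG Sp.
apply: (F_push (k := 0) (gam := form_map f phi) (m := fun i => match notF (ltn_ord i) with end)) => //.
- by case.
- move=> x y; rewrite sat_map -H.
  by set m := (fun _ : 'I_0 => _); have -> : join x (join y m) \o f = join x y by apply: funext => -[].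
- exact: definable_mono dG.
- by move=> x Gx Mx; exact: closed_inv.
- by have [] := type_inv_S Usat smallU sM sG (Gfs Sp).1.
Qed.

(* Both sides are limits of F_M(m r) = m F_M(r) as m in M tends to t. *)
Lemma F_nprod t r : S_fs M (gset G) t -> S_inv M (gset G) r -> F (op t r) = op t (F r).
Proof.
move=> ft Sr; have St := fs_inv ft; have fr := Gfs Sr; have SFr := fs_inv fr.
have Str : S_inv M (gset G) (op t r) := nprod_inv Usat Uhom smallU small_image sM sG St Sr.
have StF : S_inv M (gset G) (op t (F r)) := nprod_inv Usat Uhom smallU small_image sM sG St SFr.
have gF := F_global Str.1.1 Str.2.
suff main Theta : op t (F r) Theta -> ~ F (op t r) (Neg Theta).
  apply/predeqP => Theta; split.
    move=> FT; apply: contrapT => /(gt_neg StF.1.1)/main; apply.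
    by apply: (gt_sub gF FT) => a ha; apply.
  by move=> /main h; apply: contrapT => /(gt_neg gF).
move=> hT /(F_continuous Str.1.1 Str.2)[Psi [hPsi cont]].
have [m1 [phi1 [d1 [_ ET]]]] := over_setT Theta.
have [m2 [phi2 [d2 [_ EP]]]] := over_setT Psi.
pose A := (M `|` range d1) `|` range d2.
have sA : small A by apply: smallR; exact: smallR.
have MA : M `<=` A by left; left.
have oT : over A Theta by rewrite ET; apply: over_inst => i; left; right; exists i.
have oP : over A Psi by rewrite EP; apply: over_inst => i; right; exists i.
have [e Re] := exists_Real Usat fr.1.1 sA.
have [e1 Re1] := exists_Real Usat Sr.1.1 sA.
have sA' : small ((A `|` range e) `|` range e1) by apply: smallR; exact: smallR.
have [b Rb] := exists_Real Usat ft.1.1 sA'.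
have Rb1 : Real (A `|` range e) t b by apply: Real_sub Rb => x; left.
have Rb2 : Real (A `|` range e1) t b by apply: Real_sub Rb => x [|]; [left; left|right].
have Gb := S_in dG ft.1 Rb; have Ge := S_in dG fr.1 Re; have Ge1 := S_in dG Sr.1 Re1.
have h1 : holds (mul b e) Theta by apply/(nprodR St fr.1 sA MA Re Rb1).
have h2 : holds (mul b e1) Psi by apply/(nprodR St Sr.1 sA MA Re1 Rb2).
have dE1 : definable ((A `|` range e) `|` range e1) [set x | gset G x /\ holds (mul x e) Theta].
  apply: (definable_rmul (E := [set y | holds y Theta])) => //; first by move=> x; left; right.
  by apply: definable_mono (definable_holds oT) => x; left; left.
have dE2 : definable ((A `|` range e) `|` range e1) [set x | gset G x /\ holds (mul x e1) Psi].
  apply: (definable_rmul (E := [set y | holds y Psi])) => //.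
  by apply: definable_mono (definable_holds oP) => x; left; left.
(* As [b] realizes t over [e] and [e1] together, a single m in [M] puts [Theta] into m F_M(r) and
   [Psi] into m r. By the choice of [Psi], the latter puts the negation of [Theta] into F_M(m r),
   which is m F_M(r). *)
have := (conc_real ft.1.1 Rb (definable_and dE1 dE2)).2 (conj (conj Gb h1) (conj Gb h2)).
move=> /(fs_conc ft.2)[m [Mm [[Gm k1] [_ k2]]]].
have mA : range m `<=` A by move=> _ [i _ <-]; exact: MA.
have mF : translate_l G m (F r) Theta by apply/(translate_l_Real fr.1 Gm mA Re).
have mr : translate_l G m r Psi by apply/(translate_l_Real Sr.1 Gm mA Re1).
have [[gmr _] imr] := translate_l_inv Sr Gm Mm.
by apply: (F_consistent gmr _ (cont _ gmr imr mr)); rewrite F_lmul.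
Qed.

(* t is the type over U of a realization of tp(c/M) in P(N'). *)
Lemma fs_extension (H : set (tup n U)) c : definable set0 H -> H c -> exists t, S_fs M H t /\ Real M t c.
Proof.
move=> dH Hc; have [e [Pe st]] := pred_realization eM sP c.
pose t : gtp := [set Phi | sat (join e jW) Phi].
have gt : global_type t.
  split=> [Fs fF Ft|Phi]; last exact: EM.
  have [psi K] := finite_conj fF.
  have [|b [_ hb]] := @pred_solution L U M N' j sP n psi e Pe; first by apply/K.
  by exists b; exact: (K U (join b id)).1.
have Rc : Real M t c by move=> Phi o; exact: st.
exists t; split=> //; split; last by move=> Phi h; exact: pred_solution h.
split=> //; apply/(conc_real gt Rc) => //; exact: definable_mono dH.
Qed.

Lemma same_type_realization (s : gtp) (W' : structure L) (j' : U -> W') (b' : 'I_n -> W') (b : tup n U)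
    (A : set U) k (d : tup k U) m (f : 'I_m -> 'I_n + 'I_k) : global_type s ->
  (forall Psi, s Psi -> sat (join b' j') Psi) -> Real A s b -> M `<=` A -> (forall i, A (d i)) ->
  @same_type L U M W' j' m (join b' (j' \o d) \o f) (join b d \o f).
Proof.
move=> gs Rb' Rb MA Ad l psi c Mc.
pose f' (z : 'I_m + 'I_l) : 'I_n + ('I_k + 'I_l) :=
  match z with inl i => match f i with inl x => inl x | inr y => inr (inl y) end | inr i => inr (inr i) end.
have E (S : Type) (x : 'I_n -> S) (y : 'I_k -> S) (z : 'I_l -> S) :
    join (join x y \o f) z = join x (join y z) \o f'.
  by apply: funext => -[i|i] //=; case: (f i).
rewrite !E -!sat_map; set theta := form_map f' psi.
have o th : over A (inst th (join d c) : form L ('I_n + U)) by apply: over_inst => -[i|i] //=; exact: MA.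
have main th : sat (join b (join d c)) th -> sat (join b' (join (j' \o d) (j' \o c))) th.
  rewrite -holds_inst => /(Rb _ (o th))/Rb'; rewrite inst_sat.
  by have -> : j' \o join d c = join (j' \o d) (j' \o c) by apply: funext => -[].
split; last exact: main.
by apply: contraPP => /(main (Neg theta)).
Qed.

Lemma realization_pair (s : gtp) : global_type s ->
  exists b' : 'I_n -> W, forall Psi, s Psi -> sat (join b' (j : U -> W)) Psi.
Proof.
move=> gs.
have [||F fF Fpi|e [_ he]] := @reduct_saturation L U M N' j sP False n (range j) (@lift L U N' j n @` s).
- exact: card_image_le.
- by move=> _ [Phi _ <-]; exact: over_lift (over_setT Phi).
- have [F0 [fF0 F0s hF]] := @finite_preimage _ _ (@lift L U N' j n) _ set0 F fF (fun Phi h => or_introl (Fpi Phi h)).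
  have [psi H] := finite_conj fF0; have [fs _] := gs; have [a ha] := fs F0 fF0 F0s.
  exists (j \o a); split=> // Phi /hF[[Psi F0Psi <-]|//].
  apply/sat_lift; rewrite (_ : join _ _ = (j : U -> W) \o join a id); last by apply: funext => -[].
  by apply/(elementary_sat _ _ (reduct_elementary sP)); exact: ha.
by exists e => Psi sPsi; apply/sat_lift/he; exists Psi.
Qed.

(** The definition of [morley] allows any elementary extension and any realizations in it; by
    invariance of r they all agree with a pair found in [U]. Conversely [N'], being saturated over
    [U], is an extension where such realizations exist. *)
Lemma morley_Real (r s : gtp) A (a b : tup n U) : global_type r -> invariant M r -> global_type s ->
  M `<=` A -> Real A s b -> Real (A `|` range b) r a -> Real A (morley M r s) (join a b).
Proof.
move=> gr ir gs MA Rb Ra Phi [k [phi [d [Ad ->]]]].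
pose f (z : ('I_n + 'I_n) + 'I_k) : 'I_n + ('I_n + 'I_k) :=
  match z with inl (inl x) => inl x | inl (inr y) => inr (inl y) | inr i => inr (inr i) end.
pose chi := form_map f phi.
have sat_chi (S : structure L) (x y : 'I_n -> S) z : sat (join x (join y z)) chi <-> sat (join (join x y) z) phi.
  by rewrite sat_map; have -> : join x (join y z) \o f = join (join x y) z by apply: funext => -[[]|].
rewrite holds_inst -sat_chi -(holds_inst chi).
have Abd y : (A `|` range b) (join b d y) by case: y => [i|i] /=; [right; exists i|left].
have ext_r (W' : structure L) (j' : U -> W') (b' : 'I_n -> W') theta :
    (forall Psi, s Psi -> sat (join b' j') Psi) -> r (inst theta (join b d)) ->
    inv_ext M j' r (inst theta (join b' (j' \o d))).
  move=> Rb' rt; have [m [g [psi Eth]]] := inst_ord theta.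
  have Ei (S : Type) (u : 'I_n + 'I_k -> S) : inst theta u = inst psi (u \o g).
    by rewrite Eth /inst form_map_comp; congr form_map; apply: funext => -[].
  exists m, psi, (join b' (j' \o d) \o g), (join b d \o g); split; [exact: Ei| |by rewrite -Ei].
  exact: same_type_realization Rb' Rb MA Ad.
have over_r (W' : structure L) (j' : U -> W') (b' : 'I_n -> W') theta :
    over (range j' `|` range b') (inst theta (join b' (j' \o d)) : form L ('I_n + W')).
  by apply: over_inst => -[i|i] /=; [right; exists i|left; exists (d i)].
rewrite -(Ra _ (over_inst chi Abd)); split.
  move=> [W' [j' [a' [b' [ej' Rb' Ra' h]]]]].
  apply: contrapT => /(gt_neg gr) nr.
  have := Ra' _ (ext_r W' j' b' (Neg chi) Rb' nr) (over_r _ _ _ _); rewrite holds_inst sat_Neg sat_chi; apply.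
  by rewrite -(inst_sat (N := W') phi d).
move=> rchi; have [b' Rb'] := realization_pair gs.
have cB : range j `|` range b' #<= [set: U].
  by apply: (card_le_pair sP) => //; apply: finite_image; exact: finite_finset.
have [|F fF Fpi|a' [_ Ra']] := @reduct_saturation L U M N' j sP False n _
    [set Psi | @inv_ext L U 'I_n M W j r Psi /\ @over L W 'I_n (range j `|` range b') Psi] cB.
- by move=> Psi [].
- have [V [theta [e [_ xe H]]]] := ext_collapse Usat Uhom smallU sM sP gr ir fF Fpi.
  by have [a' ha'] := ext_exists gr xe; exists a'; split=> //; exact: H.
exists W, j, a', b'; split=> //; first exact: reduct_elementary sP.
  by move=> Psi h1 h2; exact: Ra'.
have := Ra' _ (conj (ext_r W j b' chi Rb' rchi) (over_r _ _ _ _)).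
by rewrite holds_inst sat_chi inst_sat.
Qed.

End RetractionGroup.

(** * Ellis subgroups *)

Section EllisGroups.
Variables (S : Type) (op : S -> S -> S) (X : set S).
Hypothesis opX : forall x y, X x -> X y -> X (op x y).
Hypothesis opA : forall x y z, X x -> X y -> X z -> op x (op y z) = op (op x y) z.

Lemma minimal_left_idealE I u : minimal_left_ideal op X I -> I u -> I = [set op x u | x in X].
Proof.
move=> [[_ IX lI] mI] Iu; symmetry; apply: mI; last by move=> _ [x Xx <-]; exact: lI.
split; first by exists (op u u); exists u => //; exact: IX.
  by move=> _ [x Xx <-]; apply: opX => //; exact: IX.
by move=> x _ Xx [y Xy <-]; exists (op x y); [exact: opX|rewrite opA //; exact: IX].
Qed.

(** A left ideal J inside X u contains some y = z u, and u y = u z u lies in the group [B];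
    inverting it there puts u into J. Hence X u is minimal, and u X u is [B]. *)
Lemma ellis_subgroupI (B : set S) u : B `<=` X -> B u -> (forall x, X x -> B (op (op u x) u)) ->
  (forall b, B b -> [/\ op u b = b, op b u = b & exists b', B b' /\ op b' b = u]) ->
  ellis_subgroup op X B.
Proof.
move=> BX Bu uXu gB; have Xu := BX _ Bu; have [uu _ _] := gB _ Bu.
exists [set op x u | x in X], u; split.
- split.
    split; first by exists (op u u); exists u.
      by move=> _ [x Xx <-]; exact: opX.
    by move=> x _ Xx [y Xy <-]; exists (op x y); [exact: opX|rewrite opA].
  move=> J [[y Jy] JX lJ] JI; apply/seteqP; split=> // _ [x Xx <-].
  have [z Xz Ey] := JI _ Jy; have Xy := JX _ Jy.
  have Buy : B (op u y) by rewrite -Ey opA //; exact: uXu.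
  have [_ _ [b [Bb Eb]]] := gB _ Buy.
  have Ju : J u by rewrite -Eb; apply: (lJ); [exact: BX|exact: (lJ)].
  exact: lJ.
- by exists u.
- exact: uu.
- apply/seteqP; split=> [b Bb|_ [_ [x Xx <-] <-]]; last by rewrite opA //; exact: uXu.
  have [ub bu _] := gB _ Bb; exists b => //; exists b => //; exact: BX.
Qed.

End EllisGroups.

Section GroupElements.
Variables (L : language) (U : structure L) (n : nat) (G : def_group U n).

(** The laws of [def_group] hold on [gset] only; the subtype satisfies them everywhere and so is a
    group for the algebraic library. *)
Definition group_elt := {x : tup n U | gset G x}.

HB.instance Definition _ := gen_eqMixin group_elt.
HB.instance Definition _ := gen_choiceMixin group_elt.

Lemma group_elt_eq (x y : group_elt) : sval x = sval y -> x = y.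
Proof. by case: x y => [x hx] [y hy] /= E; apply: eq_exist. Qed.

Definition elt_mul (x y : group_elt) : group_elt := exist _ _ (gmul_in (svalP x) (svalP y)).
Definition elt_inv (x : group_elt) : group_elt := exist _ _ (ginv_in (svalP x)).
Definition elt_one : group_elt := exist _ _ (gone_in G).

Lemma elt_mulA : associative elt_mul.
Proof. by move=> x y z; apply: group_elt_eq; rewrite /= gmulA //; exact: svalP. Qed.
Lemma elt_mul1 : left_id elt_one elt_mul.
Proof. by move=> x; apply: group_elt_eq; have [] := gmul1 (svalP x). Qed.
Lemma elt_1mul : right_id elt_one elt_mul.
Proof. by move=> x; apply: group_elt_eq; have [] := gmul1 (svalP x). Qed.
Lemma elt_mulV : left_inverse elt_one elt_inv elt_mul.
Proof. by move=> x; apply: group_elt_eq; have [] := gmulV (svalP x). Qed.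
Lemma elt_Vmul : right_inverse elt_one elt_inv elt_mul.
Proof. by move=> x; apply: group_elt_eq; have [] := gmulV (svalP x). Qed.

HB.instance Definition _ := isGroup.Build group_elt elt_mulA elt_mul1 elt_1mul elt_mulV elt_Vmul.

End GroupElements.

(** * Types all of whose right translates are invariant *)

Section GoodTypes.
Local Open Scope group_scope.
Variables (L : language) (U : structure L) (small : set (set U)).
Hypothesis Usat : saturated small.
Hypothesis Uhom : strongly_homogeneous small.
Hypothesis smallU : forall A B : set U, small A -> finite_set B -> small (A `|` B).
Hypothesis small_image : forall (A : set U) (f : U -> U), small A -> small (f @` A).
Variable M : set U.
Hypothesis eM : elem_substructure M.
Hypothesis sM : small M.
Variables (n : nat) (G : def_group U n).

Notation gtp := (set (@gform L U 'I_n)).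
Notation op := (nprod G M).
Notation elt := (group_elt G).
Notation "p · c" := (translate_r G p (sval (c : elt))) (at level 40, left associativity).

Let dG := gset_def G.
Let sG := def_subgroup_G G.
Let smallR := small_range smallU.
Let nprodR := nprod_Real Usat Uhom smallU sM (G := G).

Lemma sval_mul (x y : elt) : sval (x * y) = gmul G (sval x) (sval y). Proof. by []. Qed.
Lemma sval_inv (x : elt) : sval x^-1 = ginv G (sval x). Proof. by []. Qed.

Definition rg (x : elt) : set U := range (sval x).

Lemma smallE A (x : elt) : small A -> small (A `|` rg x).
Proof. exact: smallR. Qed.

Lemma exists_elt p A : S_ (gset G) p -> small A -> exists x : elt, Real A p (sval x).
Proof.
move=> Sp sA; have [a Ra] := exists_Real Usat Sp.1 sA.
by exists (exist _ a (S_in dG Sp Ra)).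
Qed.

Lemma nprod_elt p q A (x y : elt) : S_inv M (gset G) p -> S_ (gset G) q -> small A -> M `<=` A ->
  Real A q (sval y) -> Real (A `|` rg y) p (sval x) -> Real A (op p q) (sval (x * y)).
Proof. exact: nprodR. Qed.

Lemma translate_elt p A (x c : elt) : S_ (gset G) p -> rg c `<=` A -> Real A p (sval x) ->
  Real A (p · c) (sval (x * c)).
Proof. by move=> Sp cA; apply: translate_r_Real => //; exact: svalP. Qed.

Lemma translate_mul p (c d : elt) : S_ (gset G) p -> p · c · d = p · (c * d).
Proof.
move=> Sp; have S1 := translate_r_S Usat smallU sM sG Sp (svalP c).
have S2 := translate_r_S Usat smallU sM sG Sp (svalP (c * d)).
apply: (Real_eq smallU (smallE (c * d) (smallE d (smallE c sM)))) => A sA BA.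
have [x Rx] := exists_elt Sp sA; exists (sval (x * c * d)); split.
  apply: translate_elt => //; first by move=> y ?; apply: BA; left; right.
  by apply: translate_elt => // y ?; apply: BA; left; left; right.
by rewrite -mulgA; apply: translate_elt => // y ?; apply: BA; right.
Qed.

Lemma translate1 p : S_ (gset G) p -> p · 1 = p.
Proof.
move=> Sp; apply: (Real_eq smallU (smallE 1 sM)) => A sA BA.
have [x Rx] := exists_elt Sp sA; exists (sval x); split=> //.
by rewrite -[x]mulg1; apply: translate_elt => // y ?; apply: BA; right.
Qed.

(* Equivalent to tp(x/A) = tp(y/A), by homogeneity. *)
Definition conj_over (A : set U) (x y : elt) :=
  exists sigma, [/\ automorphism sigma, fixes A sigma & sigma \o sval x = sval y].

Lemma Real_conj_over p A (x y : elt) : small A -> Real A p (sval x) -> Real A p (sval y) -> conj_over A x y.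
Proof. by move=> sA Rx Ry; exact: (Real_conj Uhom smallU sA Rx Ry). Qed.

Lemma conj_over_mul (x y x' y' : elt) sigma : automorphism sigma ->
  sigma \o sval x = sval x' -> sigma \o sval y = sval y' -> sigma \o sval (x * y) = sval (x' * y').
Proof. by move=> aut Ex Ey; rewrite !sval_mul (aut_mul aut) ?Ex ?Ey //; exact: svalP. Qed.

Lemma conj_over_inv (x x' : elt) sigma : automorphism sigma ->
  sigma \o sval x = sval x' -> sigma \o sval x^-1 = sval x'^-1.
Proof. by move=> aut Ex; rewrite !sval_inv (aut_inv aut) ?Ex //; exact: svalP. Qed.

(** Inversion exchanges left and right translates, so a left fsg type provides one whose right
    translates are finitely satisfiable. *)
Lemma translate_type_inv (p : gtp) (c : elt) : S_ (gset G) p ->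
  type_inv G p · c = type_inv G (translate_l G (sval c^-1) p).
Proof.
move=> Sp; have Sl := translate_l_S Usat smallU sM sG Sp (svalP c^-1).
apply: (Real_eq smallU (smallE c (smallE c^-1 sM))) => A sA BA.
have [x Rx] := exists_elt Sp sA; exists (sval (x^-1 * c)); split.
  apply: translate_elt; [exact: (type_inv_S Usat smallU sM sG Sp)| |exact: type_inv_Real].
  by move=> y ?; apply: BA; right.
have -> : x^-1 * c = (c^-1 * x)^-1 by rewrite invgM invgK.
apply: type_inv_Real => //; apply: translate_l_Real => //; first exact: svalP.
by move=> y ?; apply: BA; left; right.
Qed.

Lemma nprod_translate_r (p q : gtp) (c : elt) : S_inv M (gset G) p -> S_ (gset G) q ->
  op p q · c = op p (q · c).
Proof.
move=> Sp Sq; apply: (Real_eq smallU (smallE c sM)) => A sA BA.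
have MA : M `<=` A by move=> y ?; apply: BA; left.
have cA : rg c `<=` A by move=> y ?; apply: BA; right.
have [y Ry] := exists_elt Sq sA.
have [x Rx] := exists_elt Sp.1 (smallE (y * c) (smallE y sA)).
have Rx1 : Real (A `|` rg y) p (sval x) by apply: Real_sub Rx => z; left.
have Rx2 : Real (A `|` rg (y * c)) p (sval x) by apply: Real_sub Rx => z [|]; [left; left|right].
exists (sval (x * y * c)); split.
  apply: translate_elt => //; first exact: (nprod_S Usat Uhom smallU sM sG Sp Sq).
  exact: (nprod_elt Sp Sq sA MA Ry Rx1).
rewrite -mulgA; apply: (nprod_elt Sp _ sA MA _ Rx2).
  exact: (translate_r_S Usat smallU sM sG Sq (svalP c)).
exact: translate_elt.
Qed.

Section Good.
Variable (H : set (tup n U)).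
Hypothesis sH : def_subgroup G H.

Let dH : definable set0 H. Proof. by case: sH. Qed.

Lemma subgroup_mul (x y : elt) : H (sval x) -> H (sval y) -> H (sval (x * y)).
Proof. by move=> Hx Hy; case: sH => _ _ _ h _; exact: h. Qed.
Lemma subgroup_inv (x : elt) : H (sval x) -> H (sval x^-1).
Proof. by move=> Hx; case: sH => _ _ _ _; exact. Qed.
Lemma subgroup_one : H (sval (1 : elt)).
Proof. by case: sH. Qed.

Definition translation_invariant (u : gtp) :=
  S_inv M H u /\ forall c : elt, H (sval c) -> invariant M (u · c).

Section TranslationInvariant.
Variable u : gtp.
Hypothesis tu : translation_invariant u.

Let Su : S_inv M H u := tu.1.
Let SuG : S_inv M (gset G) u := subgroup_Sinv Usat smallU sM sH Su.

Lemma translate_Sinv (c : elt) : H (sval c) -> S_inv M H (u · c).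
Proof. by move=> Hc; split; [exact: (translate_r_S Usat smallU sM sH Su.1 Hc)|exact: tu.2]. Qed.

(** An automorphism over [M] sending c to d fixes u, hence sends u . c to u . d; but it also fixes
    the invariant type u . c. *)
Lemma translate_conj_over (c d : elt) : H (sval c) -> H (sval d) -> conj_over M c d -> u · c = u · d.
Proof.
move=> Hc Hd [s [aut fx E]]; apply/predeqP => Phi.
have [m [phi [e0 [_ ->]]]] := over_setT Phi; have [e ->] := aut_surj aut e0.
rewrite -(tu.2 c Hc s aut fx); pose A := (M `|` rg c) `|` range e.
have sA : small A by apply: smallR; exact: smallE.
have [x Rx] := exists_elt SuG.1 sA.
have oA : over A (inst phi e) by apply: over_inst => i; right; exists i.
have osA : over (s @` A) (inst phi (s \o e)) by apply: over_inst => i; exists (e i) => //; right; exists i.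
have Rxc : Real A (u · c) (sval (x * c)).
  by apply: translate_elt => //; [exact: SuG.1|move=> y ?; left; right].
have Rsx := inv_Real aut SuG.2 fx Rx.
have [x' Ex'] : exists x' : elt, s \o sval x = sval x'.
  by exists (exist _ _ ((aut_G G (sval x) aut).2 (svalP x))).
have Rx'd : Real (s @` A) (u · d) (sval (x' * d)).
  apply: translate_elt; [exact: SuG.1| |by rewrite -Ex'].
  by move=> _ [i _ <-]; exists (sval c i); [left; right; exists i|rewrite -E].
rewrite (Rxc _ oA) (Rx'd _ osA) -(conj_over_mul aut Ex' E) !holds_inst -(aut_sat aut (join (sval (x * c)) e)).
by suff -> : s \o join (sval (x * c)) e = join (s \o sval (x * c)) (s \o e) by []; apply: funext => -[].
Qed.

(** Let c realize t over a small set and x realize u over that set and c: then x c realizes both u *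
    t and u . c, and the latter is u . b as c and b have the same type over [M]. *)
Lemma nprod_translate t A (b : elt) : S_inv M H t -> M `<=` A -> Real A t (sval b) -> op u t = u · b.
Proof.
move=> St MA Rb; have StG := subgroup_Sinv Usat smallU sM sH St.
have {Rb} Rb : Real M t (sval b) by exact: Real_sub Rb.
have Hb := S_in dH St.1 Rb.
apply: (Real_eq smallU (smallE b sM)) => B sB BB.
have MB : M `<=` B by move=> y ?; apply: BB; left.
have [c Rc] := exists_elt StG.1 sB.
have sBc := smallE b (smallE c sB).
have [x Rx] := exists_elt SuG.1 sBc.
have Rx1 : Real (B `|` rg c) u (sval x) by apply: Real_sub Rx => y ?; left.
exists (sval (x * c)); split; first exact: (nprod_elt SuG StG.1 sB MB Rc Rx1).
have Hc : H (sval c) := S_in dH St.1 Rc.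
rewrite (@translate_conj_over b c Hb Hc); last by apply: (Real_conj_over sM Rb); exact: Real_sub Rc.
apply: (@Real_sub _ _ _ B (B `|` rg c)); first by move=> y; left.
by apply: translate_elt Rx1; [exact: SuG.1|move=> y; right].
Qed.

End TranslationInvariant.

Lemma translation_invariant_translate u (c : elt) : translation_invariant u -> H (sval c) ->
  translation_invariant (u · c).
Proof.
move=> tu Hc; split; first exact: translate_Sinv.
move=> d Hd; rewrite translate_mul; last exact: (subgroup_S Usat smallU sM sH tu.1.1).
by apply: tu.2; exact: subgroup_mul.
Qed.

Section Idempotent.
Variable u : gtp.
Hypothesis tu : translation_invariant u.
Hypothesis uu : op u u = u.
Let SuG : S_inv M (gset G) u := subgroup_Sinv Usat smallU sM sH tu.1.

Lemma stab_realization A (b : elt) : M `<=` A -> Real A u (sval b) -> u · b = u.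
Proof. by move=> MA Rb; rewrite -(nprod_translate tu tu.1 MA Rb). Qed.

(** Equality of right cosets of the stabilizer of [u]. Right multiplication respects it by
    definition; left multiplication does so because the stabilizer is normal. *)
Definition eqv (c d : elt) := u · c = u · d.

Lemma eqv_conj_over (c d : elt) : H (sval c) -> H (sval d) -> conj_over M c d -> eqv c d.
Proof. exact: translate_conj_over. Qed.

Lemma eqv_mulr (c d e : elt) : eqv c d -> eqv (c * e) (d * e).
Proof. by rewrite /eqv => E; rewrite -!(translate_mul _ _ SuG.1) E. Qed.

(* The right stabilizer of u is normalized by every g normalizing H: if b
   realizes u over g and s then b and b s have the same type over g, so that
   g b g^-1 and g b s g^-1, and also their inverses, have the same type over M. *)
Lemma stab_normal (g s : elt) : H (sval s) ->
  (forall x : elt, H (sval x) -> H (sval (g * x * g^-1))) ->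
  u · s = u -> u · (g * s * g^-1) = u.
Proof.
move=> Hs Hg us; set A := (M `|` rg g) `|` rg s.
have sA : small A by do 2!apply: smallE.
have MA : M `<=` A by left; left.
have [b Rb] := exists_elt SuG.1 sA.
have Hb : H (sval b) := S_in dH tu.1.1 Rb.
have Rbs : Real A u (sval (b * s)).
  by rewrite -us; apply: translate_elt => //; [exact: SuG.1|move=> y ?; right].
have [sg [aut fx E]] := Real_conj_over sA Rb Rbs.
have Eg : sg \o sval g = sval g.
  by apply: funext => i; apply: fx; left; right; exists i.
have Egi := conj_over_inv aut Eg.
have Ec := conj_over_mul aut (conj_over_mul aut Eg E) Egi.
have Eci := conj_over_inv aut Ec.
have H1 := Hg _ Hb; have H2 := Hg _ (subgroup_mul Hb Hs).
have : eqv (g * b * g^-1)^-1 (g * (b * s) * g^-1)^-1.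
  apply: eqv_conj_over; [exact: subgroup_inv|exact: subgroup_inv|].
  by exists sg; split=> // x Mx; apply: fx; exact: MA.
(* Multiplying on the right, the side on which [eqv] is stable, leaves g s g^-1 on one side and 1 on
   the other; the inverses were taken for this. *)
move=> /(eqv_mulr (g * (b * s) * g^-1)); rewrite mulVg /eqv translate1; last exact: SuG.1.
by rewrite !invgM invgK !mulgA !(mulgVK, mulgK, mulVg, mul1g).
Qed.

Lemma eqv_stab (c d : elt) : eqv c d <-> u · (c * d^-1) = u.
Proof.
split=> [/(eqv_mulr d^-1)|h]; first by rewrite mulgV /eqv translate1 //; exact: SuG.1.
by rewrite /eqv -[c](mulgVK d) -translate_mul ?h //; exact: SuG.1.
Qed.

Lemma eqv_conj (g c d : elt) : H (sval c) -> H (sval d) ->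
  (forall x : elt, H (sval x) -> H (sval (g * x * g^-1))) ->
  eqv c d -> eqv (g * c * g^-1) (g * d * g^-1).
Proof.
move=> Hc Hd Hg /eqv_stab h; apply/eqv_stab.
have -> : g * c * g^-1 * (g * d * g^-1)^-1 = g * (c * d^-1) * g^-1.
  by rewrite !invgM invgK !mulgA !(mulgVK, mulgK).
by apply: stab_normal => //; apply: subgroup_mul => //; exact: subgroup_inv.
Qed.

Lemma conj_in (g x : elt) : H (sval g) -> H (sval x) -> H (sval (g * x * g^-1)).
Proof. by move=> Hg Hx; do !apply: subgroup_mul => //; exact: subgroup_inv. Qed.

Lemma eqv_mull (c d e : elt) : H (sval c) -> H (sval d) -> H (sval e) -> eqv c d -> eqv (e * c) (e * d).
Proof.
move=> Hc Hd He /(eqv_conj Hc Hd (fun x => conj_in He (x := x)))/(eqv_mulr e).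
by rewrite !mulgVK.
Qed.

Lemma eqv_mul (c d c' d' : elt) : H (sval c) -> H (sval d) -> H (sval c') -> H (sval d') ->
  eqv c d -> eqv c' d' -> eqv (c * c') (d * d').
Proof.
move=> Hc Hd Hc' Hd' h h'; rewrite /eqv (_ : u · (c * c') = u · (c * d')); first exact: eqv_mulr.
exact: eqv_mull.
Qed.

Lemma eqv_inv (c d : elt) : H (sval c) -> H (sval d) -> eqv c d -> eqv c^-1 d^-1.
Proof.
move=> Hc Hd /(eqv_mulr d^-1)/(eqv_mull _ _ (subgroup_inv Hc)).
have Hdi := subgroup_inv Hd.
rewrite mulgV mulg1 mulgA mulVg mul1g => h; apply/esym/h; [exact: subgroup_mul|exact: subgroup_one].
Qed.

(** Over [M], x has the same type as a c with a realizing [u], and such an a stabilizes the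
    idempotent [u]. *)
Lemma eqv_realization A (c x : elt) : M `<=` A -> H (sval c) -> Real A (u · c) (sval x) -> eqv x c.
Proof.
move=> MA Hc Rx; have {}Rx : Real M (u · c) (sval x) by exact: Real_sub Rx.
have Hx : H (sval x) := S_in dH (translate_Sinv tu Hc).1 Rx.
have [a Ra] := exists_elt SuG.1 (smallE c sM).
have Ha : H (sval a) := S_in dH tu.1.1 Ra.
have Rac : Real M (u · c) (sval (a * c)).
  apply: (@Real_sub _ _ _ M (M `|` rg c)); first by move=> y; left.
  by apply: translate_elt Ra; [exact: SuG.1|move=> y; right].
rewrite /eqv (eqv_conj_over Hx (subgroup_mul Ha Hc) (Real_conj_over sM Rx Rac)).
rewrite -translate_mul; last exact: SuG.1.
by rewrite (@stab_realization _ a _ Ra) //; move=> y; left.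
Qed.

Lemma nprod_translate_translate (c d : elt) : H (sval c) -> H (sval d) -> op (u · c) (u · d) = u · (c * d).
Proof.
move=> Hc Hd; have Sd := translate_Sinv tu Hd.
have [x Rx] := exists_elt (subgroup_S Usat smallU sM sH Sd.1) sM.
have Hx : H (sval x) := S_in dH Sd.1 Rx.
rewrite (nprod_translate (translation_invariant_translate tu Hc) Sd (fun _ => id) Rx).
rewrite translate_mul; last exact: SuG.1.
by apply: eqv_mull => //; exact: eqv_realization Rx.
Qed.

Section Ellis.
Variable X : set gtp.
Hypothesis Xinv : X `<=` S_inv M H.
Hypothesis Xop : forall p q, X p -> X q -> X (op p q).
Hypothesis Xext : forall c : elt, H (sval c) -> exists t, X t /\ Real M t (sval c).
Hypothesis Xu : X u.

Lemma XopA p q r : X p -> X q -> X r -> op p (op q r) = op (op p q) r.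
Proof.
move=> /Xinv/(subgroup_Sinv Usat smallU sM sH) Sp /Xinv/(subgroup_Sinv Usat smallU sM sH) Sq.
move=> /Xinv/(subgroup_Sinv Usat smallU sM sH) Sr.
exact: (nprod_assoc Usat Uhom smallU small_image sM Sp Sq Sr).
Qed.

Lemma translate_X (c : elt) : H (sval c) -> X (u · c).
Proof.
move=> Hc; have [t [Xt Rt]] := Xext Hc.
by rewrite -(nprod_translate tu (Xinv Xt) (fun _ => id) Rt); exact: Xop.
Qed.

(** By [Xext] the type of c over [M] extends to some t in [X], so that every translate u . c is a
    product u * t. *)
Lemma translates_eq_ellis I : minimal_left_ideal op X I -> I u ->
  [set op u x | x in I] = [set u · c | c in [set c : elt | H (sval c)]].
Proof.
move=> mI Iu; have [[_ IX lI] _] := mI; have u1 := translate1 SuG.1.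
have Ho : H (sval (1 : elt)) := subgroup_one.
apply/seteqP; split=> [_ [x Ix <-]|_ [c Hc <-]].
  have Sx := Xinv (IX _ Ix).
  have [b Rb] := exists_elt (subgroup_S Usat smallU sM sH Sx.1) sM.
  exists b; first exact: (S_in dH Sx.1 Rb).
  by rewrite (nprod_translate tu Sx (fun _ => id) Rb).
have cu : op (u · c) u = u · c by have := nprod_translate_translate Hc Ho; rewrite u1 mulg1.
exists (op (u · c) u); first by apply: lI => //; exact: translate_X.
by have := nprod_translate_translate Ho Hc; rewrite cu u1 mul1g.
Qed.

(** No minimal left ideal is given here: it is produced by the group of translates. This is what is
    needed in [G], where the idempotent is built by hand. *)
Lemma translates_ellis_subgroup : ellis_subgroup op X [set u · c | c in [set c : elt | H (sval c)]].
Proof.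
have Ho : H (sval (1 : elt)) := subgroup_one; have u1 := translate1 SuG.1.
apply: (ellis_subgroupI Xop XopA (u := u)).
- by move=> _ [c Hc <-]; exact: translate_X.
- by exists 1.
- move=> x Xx; have Sx := Xinv Xx.
  have [b Rb] := exists_elt (subgroup_S Usat smallU sM sH Sx.1) sM.
  have Hb : H (sval b) := S_in dH Sx.1 Rb.
  exists b => //; rewrite (nprod_translate tu Sx (fun _ => id) Rb).
  by have := nprod_translate_translate Hb Ho; rewrite u1 mulg1.
- move=> _ [c Hc <-]; split.
  + by have := nprod_translate_translate Ho Hc; rewrite u1 mul1g.
  + by have := nprod_translate_translate Hc Ho; rewrite u1 mulg1.
  exists (u · c^-1); split; first by exists c^-1 => //; exact: subgroup_inv.
  by rewrite nprod_translate_translate ?mulVg ?u1 //; exact: subgroup_inv.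
Qed.

End Ellis.
End Idempotent.
(* With q left fsg, all right translates of q^-1, hence of q^-1 * u = q^-1 . b,
   are M-invariant; and u = s * (q^-1 * u) for some s by minimality. *)
Lemma fsg_translation_invariant I u : fsg G M H -> minimal_left_ideal op (S_fs M H) I -> I u ->
  translation_invariant u.
Proof.
move=> [q [Sq fq flq]] mI Iu; have [[_ IX lI] _] := mI; have SqG := subgroup_S Usat smallU sM sH Sq.
have fq' : S_fs M H (type_inv G q) := type_inv_fs Usat smallU eM sM sH (conj Sq fq).
have tq : translation_invariant (type_inv G q).
  split; first exact: fs_inv fq'.
  move=> c Hc; rewrite translate_type_inv //; have Hc' := subgroup_inv Hc.
  have Sl := translate_l_S Usat smallU sM sH Sq Hc'.
  by apply: (type_inv_inv Usat smallU sM sH (fs_inv (conj Sl (flq _ Hc')))).2.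
have fu := IX _ Iu; have [b Rb] := exists_elt (subgroup_S Usat smallU sM sH fu.1) sM.
have Hb : H (sval b) := S_in dH fu.1 Rb.
have Iy : I (op (type_inv G q) u) by exact: lI.
have ty : translation_invariant (op (type_inv G q) u).
  rewrite (nprod_translate tq (fs_inv fu) (fun _ => id) Rb).
  exact: (translation_invariant_translate tq Hb).
have opX p r : S_fs M H p -> S_fs M H r -> S_fs M H (op p r).
  by move=> ? ?; exact: (nprod_fs Usat Uhom smallU eM sM sH).
have opA p r s : S_fs M H p -> S_fs M H r -> S_fs M H s -> op p (op r s) = op (op p r) s.
  by move=> /fs_inv ? /fs_inv ? /fs_inv ?; apply: (nprod_assoc Usat Uhom smallU small_image sM); exact: (subgroup_Sinv Usat smallU sM sH).
split; first exact: fs_inv fu.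
move=> c Hc; move: Iu; rewrite (minimal_left_idealE opX opA mI Iy) => -[s fs <-].
rewrite nprod_translate_r; first last.
- exact: (subgroup_S Usat smallU sM sH ty.1.1).
- exact: (subgroup_Sinv Usat smallU sM sH (fs_inv fs)).
apply: (nprod_inv Usat Uhom smallU small_image sM sH (fs_inv fs) _).2.
exact: (translate_Sinv ty Hc).
Qed.

Lemma right_dfg_translation_invariant u : right_dfg G M H u -> translation_invariant u.
Proof.
move=> [Su du dtu]; split; first by split=> //; exact: definable_invariant.
by move=> c Hc; apply: definable_invariant; exact: dtu.
Qed.

End Good.
End GoodTypes.

(** * Semidirect products *)

Section Semidirect.
Local Open Scope group_scope.
Variables (L : language) (U : structure L) (small : set (set U)).
Hypothesis Usat : saturated small.
Hypothesis Uhom : strongly_homogeneous small.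
Hypothesis smallU : forall A B : set U, small A -> finite_set B -> small (A `|` B).
Hypothesis small_image : forall (A : set U) (f : U -> U), small A -> small (f @` A).
Hypothesis small_countable : forall A : set U, countable A -> small A.
Variable M : set U.
Hypothesis eM : elem_substructure M.
Hypothesis sM : small M.
Variables (N' : structure (pair_language L)) (j : U -> N').
Hypothesis sP : saturated_pair M j.
Variable T : set (form L void).
Hypothesis TU : models U T.
Hypothesis nip : NIP T.
Variables (n : nat) (G : def_group U n) (H K : set (tup n U)).
Hypothesis sd : semidirect G H K.

Notation gtp := (set (@gform L U 'I_n)).
Notation F := (@retraction L U M N' j 'I_n).
Notation op := (nprod G M).
Notation elt := (group_elt G).
Notation "p · c" := (translate_r G p (sval (c : elt))) (at level 40, left associativity).
Notation inv := (type_inv G).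
Notation K_M := (K_map G M j).

Let sG := def_subgroup_G G.
Let sH : def_subgroup G H. Proof. by case: sd. Qed.
Let sK : def_subgroup G K. Proof. by case: sd. Qed.
Let dH : definable set0 H. Proof. by case: sH. Qed.
Let dK : definable set0 K. Proof. by case: sK. Qed.
Let SG Hs (sHs : def_subgroup G Hs) p := @subgroup_Sinv L U small Usat smallU n G M sM Hs p sHs.
Let SG0 Hs (sHs : def_subgroup G Hs) p := @subgroup_S L U small Usat smallU n G M sM Hs p sHs.
Let existsE p A := @exists_elt L U small Usat n G p A.
Let nprodE p q A x y := @nprod_elt L U small Usat Uhom smallU M sM n G p q A x y.
Let transE p A x c := @translate_elt L U n G p A x c.
Let tr1 p := @translate1 L U small Usat smallU M sM n G p.
Let opA p q r := @nprod_assoc L U small Usat Uhom smallU small_image n G M sM p q r.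
Let op_inv Hs p q := @nprod_inv L U small Usat Uhom smallU small_image n G M sM Hs p q.
Let op_fs Hs p q := @nprod_fs L U small Usat Uhom smallU n G M eM sM Hs p q.
Let tinv := @translation_invariant L U M n G.
Let nprodT Hs sHs u tu t A b := @nprod_translate L U small Usat Uhom smallU M sM n G Hs sHs u tu t A b.
Let smallE A (x : elt) : small A -> small (A `|` rg x) := @smallE L U small smallU n G A x.

Lemma sub_adjoin (A B : set U) : A `<=` A `|` B. Proof. by move=> x; left. Qed.
Lemma adjoin_sub (A B : set U) : B `<=` A `|` B. Proof. by move=> x; right. Qed.

Lemma normal_H (g x : elt) : H (sval x) -> H (sval (g * x * g^-1)).
Proof. by move=> Hx; case: sd => _ _ h _ _; exact: (h _ _ (svalP g) Hx). Qed.

Lemma normal_HV (g x : elt) : H (sval x) -> H (sval (g^-1 * x * g)).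
Proof. by move=> Hx; rewrite -{2}[g]invgK; exact: normal_H. Qed.

Lemma decomposition (g : elt) : exists h k : elt, [/\ H (sval h), K (sval k) & g = h * k].
Proof.
case: sd => _ _ _ _ E; have : [set gmul G h k | h in H & k in K] (sval g) by rewrite E; exact: svalP.
have [_ HG _ _ _] := sH; have [_ KG _ _ _] := sK.
move=> [h Hh [k Kk E']]; exists (exist _ h (HG _ Hh)), (exist _ k (KG _ Kk)); split=> //.
exact: group_elt_eq.
Qed.

Lemma decomposition_KH (g : elt) : exists k h : elt, [/\ K (sval k), H (sval h) & g = k * h].
Proof.
have [h [k [Hh Kk ->]]] := decomposition g; exists k, (k^-1 * h * k); split=> //; first exact: normal_HV.
by rewrite !mulgA mulgV mul1g.
Qed.

Lemma decomposition_unique (h h' k k' : elt) : H (sval h) -> H (sval h') -> K (sval k) -> K (sval k') ->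
  h * k = h' * k' -> h = h' /\ k = k'.
Proof.
move=> Hh Hh' Kk Kk' E; have E1 : h'^-1 * h = k' * k^-1.
  by apply: (can_inj (mulgK k)); rewrite mulgVK -mulgA E mulKg.
have : [set gone G] (sval (h'^-1 * h)).
  case: sd => _ _ _ <- _; split; last by rewrite E1; apply: (subgroup_mul sK) => //; exact: (subgroup_inv sK).
  by apply: (subgroup_mul sH) => //; exact: (subgroup_inv sH).
move=> /= E2; have E3 : h'^-1 * h = 1 by apply: group_elt_eq.
split; first by rewrite -[LHS](mulVKg h') E3 mulg1.
by rewrite -[RHS](mulgVK k) -E1 E3 mul1g.
Qed.

Lemma decomposition_KH_unique (h h' k k' : elt) : H (sval h) -> H (sval h') -> K (sval k) -> K (sval k') ->
  k * h = k' * h' -> h = h' /\ k = k'.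
Proof.
move=> Hh Hh' Kk Kk' E.
have : k * h * k^-1 * k = k' * h' * k'^-1 * k' by rewrite !mulgVK.
move=> /(decomposition_unique (normal_H k Hh) (normal_H k' Hh') Kk Kk')[_ Ek].
by split=> //; move: E; rewrite Ek => /(can_inj (mulKg k')).
Qed.

Lemma aut_elt (s : U -> U) (x : elt) : automorphism s -> exists x' : elt, s \o sval x = sval x'.
Proof. by move=> aut; exists (exist _ _ ((aut_G G (sval x) aut).2 (svalP x))). Qed.

Lemma aut_subgroup (Hs : set (tup n U)) (s : U -> U) (x x' : elt) : definable set0 Hs -> automorphism s ->
  s \o sval x = sval x' -> Hs (sval x) -> Hs (sval x').
Proof. by move=> dHs aut <- h; apply/(aut_definable aut (A := set0)). Qed.

(* H and K are definable over the empty set, hence stable under automorphisms. *)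
Lemma conj_decomposition (h h' k k' : elt) s : H (sval h) -> H (sval h') -> K (sval k) -> K (sval k') ->
  automorphism s -> s \o sval (h * k) = sval (h' * k') ->
  s \o sval h = sval h' /\ s \o sval k = sval k'.
Proof.
move=> Hh Hh' Kk Kk' aut E; have [x Ex] := aut_elt h aut; have [y Ey] := aut_elt k aut.
have Exy : x * y = h' * k' by apply: group_elt_eq; rewrite -E; symmetry; exact: conj_over_mul.
have [<- <-] := decomposition_unique (aut_subgroup dH aut Ex Hh) Hh' (aut_subgroup dK aut Ey Kk) Kk' Exy.
by [].
Qed.

Lemma conj_decomposition_KH (h h' k k' : elt) s : H (sval h) -> H (sval h') -> K (sval k) -> K (sval k') ->
  automorphism s -> s \o sval (k * h) = sval (k' * h') ->
  s \o sval h = sval h' /\ s \o sval k = sval k'.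
Proof.
move=> Hh Hh' Kk Kk' aut E; have [x Ex] := aut_elt h aut; have [y Ey] := aut_elt k aut.
have Exy : y * x = k' * h' by apply: group_elt_eq; rewrite -E; symmetry; exact: conj_over_mul.
have [<- <-] := decomposition_KH_unique (aut_subgroup dH aut Ex Hh) Hh' (aut_subgroup dK aut Ey Kk) Kk' Exy.
by [].
Qed.

Lemma Real_aut p A (x y : elt) s : automorphism s -> fixes A s -> s \o sval x = sval y ->
  Real A p (sval x) -> Real A p (sval y).
Proof. by move=> aut fx <- R Phi o; rewrite (aut_holds aut _ fx o); exact: R. Qed.

(** An automorphism over [A] preserves the types over [A], so x' realizes p as well as p', and y'
    realizes q as well as q'. *)
Lemma coupled_factors p p' q q' :
  (forall A, small A -> M `<=` A -> exists (x x' y y' : elt) s,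
    [/\ Real A p (sval x), Real A p' (sval x'), Real A q (sval y), Real A q' (sval y') &
     [/\ automorphism s, fixes A s, s \o sval x = sval x' & s \o sval y = sval y']]) ->
  q = q' /\ forall x x' : elt, Real M p (sval x) -> Real M p' (sval x') -> conj_over M x x'.
Proof.
move=> main; split.
  apply: (Real_eq smallU sM) => A sA MA; have [x [x' [y [y' [s [_ _ Ry Ry' [aut fx _ Ey]]]]]]] := main A sA MA.
  by exists (sval y'); split=> //; exact: Real_aut Ey Ry.
move=> z z' Rz Rz'; have [x [x' [_ [_ [s [Rx Rx' _ _ [aut fx Ex _]]]]]]] := main M sM (fun _ => id).
have [s1 [a1 f1 E1]] := Real_conj_over Uhom smallU sM Rz Rx.
have Rxz : Real M p' (sval x) by move=> Phi o; rewrite (Rx' _ o) -Ex (aut_holds aut _ fx o).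
have Rzz : Real M p' (sval z) by move=> Phi o; rewrite (Rxz _ o) -E1 (aut_holds a1 _ f1 o).
exact: (Real_conj_over Uhom smallU sM Rzz Rz').
Qed.

(** Realizations of equal products are conjugate, and an automorphism moving x y to x' y' moves
    factor to factor. *)
Lemma nprod_HK_unique p p' q q' : S_inv M H p -> S_inv M H p' -> S_inv M K q -> S_inv M K q' ->
  op p q = op p' q' -> q = q' /\ forall x x' : elt, Real M p (sval x) -> Real M p' (sval x') -> conj_over M x x'.
Proof.
move=> Sp Sp' Sq Sq' E; apply: coupled_factors => A sA MA.
have [y Ry] := existsE (SG0 sK Sq.1) sA; have [y' Ry'] := existsE (SG0 sK Sq'.1) sA.
have [x Rx] := existsE (SG0 sH Sp.1) (smallE y sA); have [x' Rx'] := existsE (SG0 sH Sp'.1) (smallE y' sA).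
have R := nprodE (SG sH Sp) (SG0 sK Sq.1) sA MA Ry Rx.
have R' := nprodE (SG sH Sp') (SG0 sK Sq'.1) sA MA Ry' Rx'.
rewrite -E in R'; have [s [aut fx Es]] := Real_conj_over Uhom smallU sA R R'.
have [Ex Ey] := conj_decomposition (S_in dH Sp.1 Rx) (S_in dH Sp'.1 Rx') (S_in dK Sq.1 Ry) (S_in dK Sq'.1 Ry') aut Es.
exists x, x', y, y', s; split=> //; [exact: Real_sub Rx|exact: Real_sub Rx'].
Qed.

Lemma nprod_KH_unique p p' q q' : S_inv M H p -> S_inv M H p' -> S_inv M K q -> S_inv M K q' ->
  op q p = op q' p' -> q = q' /\ forall x x' : elt, Real M p (sval x) -> Real M p' (sval x') -> conj_over M x x'.
Proof.
move=> Sp Sp' Sq Sq' E; apply: coupled_factors => A sA MA.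
have [x Rx] := existsE (SG0 sH Sp.1) sA; have [x' Rx'] := existsE (SG0 sH Sp'.1) sA.
have [y Ry] := existsE (SG0 sK Sq.1) (smallE x sA); have [y' Ry'] := existsE (SG0 sK Sq'.1) (smallE x' sA).
have R := nprodE (SG sK Sq) (SG0 sH Sp.1) sA MA Rx Ry.
have R' := nprodE (SG sK Sq') (SG0 sH Sp'.1) sA MA Rx' Ry'.
rewrite -E in R'; have [s [aut fx Es]] := Real_conj_over Uhom smallU sA R R'.
have [Ex Ey] := conj_decomposition_KH (S_in dH Sp.1 Rx) (S_in dH Sp'.1 Rx') (S_in dK Sq.1 Ry) (S_in dK Sq'.1 Ry') aut Es.
exists x, x', y, y', s; split=> //; [exact: Real_sub Ry|exact: Real_sub Ry'].
Qed.

(** * The Ellis subgroup of invariant types on [G] *)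

Section Idempotents.
Variables uH uK : gtp.
Hypothesis tH : tinv H uH.
Hypothesis uuH : op uH uH = uH.
Hypothesis dfH : forall c : elt, H (sval c) -> definable_type M (uH · c).
Hypothesis tK : tinv K uK.
Hypothesis uuK : op uK uK = uK.
Hypothesis fK : S_fs M K uK.

Notation "x ~H y" := (eqv uH (x : elt) y) (at level 70).
Notation "x ~K y" := (eqv uK (x : elt) y) (at level 70).
Notation EhatH := [set uH · c | c in [set c : elt | H (sval c)]].
Notation EK := [set uK · k | k in [set k : elt | K (sval k)]].

Let SuHG := SG sH tH.1.
Let SuKG := SG sK tK.1.
Let realH A := existsE SuHG.1 (A := A).
Let realK A := existsE SuKG.1 (A := A).
Let uH1 : uH · 1 = uH := tr1 SuHG.1.
Let uK1 : uK · 1 = uK := tr1 SuKG.1.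
Let inH A x R := @S_in L U n H uH A x dH tH.1.1 R.
Let inK A x R := @S_in L U n K uK A x dK tK.1.1 R.
Let HM (x y : elt) : H (sval x) -> H (sval y) -> H (sval (x * y)) := subgroup_mul sH (x := x) (y := y).
Let KM (x y : elt) : K (sval x) -> K (sval y) -> K (sval (x * y)) := subgroup_mul sK (x := x) (y := y).
Let HV (x : elt) : H (sval x) -> H (sval x^-1) := subgroup_inv sH (x := x).
Let KV (x : elt) : K (sval x) -> K (sval x^-1) := subgroup_inv sK (x := x).
Let H1 : H (sval (1 : elt)) := subgroup_one sH.
Let K1 : K (sval (1 : elt)) := subgroup_one sK.
Let eqvH_conj (g c d : elt) : H (sval c) -> H (sval d) -> c ~H d -> g * c * g^-1 ~H g * d * g^-1.
Proof. by move=> Hc Hd; apply: (eqv_conj Usat Uhom smallU sM sH tH) => // x; exact: normal_H. Qed.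
Let eqvH_over := eqv_conj_over Usat smallU sM sH tH.
Let eqvH_inv := eqv_inv Usat Uhom smallU sM sH tH.
Let eqvK_over := eqv_conj_over Usat smallU sM sK tK.
Let eqvK_mul := eqv_mul Usat Uhom smallU sM sK tK.
Let eqvK_inv := eqv_inv Usat Uhom smallU sM sK tK.
Let eqvH_mulr := eqv_mulr Usat smallU sM sH tH.
Let eqvH_real := eqv_realization Usat Uhom smallU sM sH tH uuH.
Let eqvK_real := eqv_realization Usat Uhom smallU sM sK tK uuK.
Let over_M p x y := @Real_conj_over L U small Uhom smallU n G p M x y sM.
Let SH_tr c := @translate_Sinv L U small Usat smallU M sM n G H sH uH tH c.
Let SK_tr c := @translate_Sinv L U small Usat smallU M sM n G K sK uK tK c.

Lemma eqvH1 A (x : elt) : M `<=` A -> Real A uH (sval x) -> x ~H 1.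
Proof. by move=> MA R; apply: (@eqvH_real A) => //; rewrite uH1. Qed.

Lemma eqvK1 A (x : elt) : M `<=` A -> Real A uK (sval x) -> x ~K 1.
Proof. by move=> MA R; apply: (@eqvK_real A) => //; rewrite uK1. Qed.

(** The automorphism takes k c k^-1 to k' c' k'^-1, where c' is the image of c; having the same type
    over [M], c' and c are in the same class. *)
Lemma conj_action (k k' c : elt) : H (sval c) -> conj_over M k k' -> k * c * k^-1 ~H k' * c * k'^-1.
Proof.
move=> Hc [s [aut fx E]]; have [c' Ec] := aut_elt c aut.
have Hc' := aut_subgroup dH aut Ec Hc.
have h1 : k' * c' * k'^-1 ~H k' * c * k'^-1.
  apply: eqvH_conj => //; apply/esym/eqvH_over => //; by exists s.
rewrite /eqv -h1; apply: eqvH_over; [exact: normal_H|exact: normal_H|].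
exists s; split=> //; apply: (conj_over_mul aut); first exact: (conj_over_mul aut).
exact: conj_over_inv.
Qed.

(* The action of K on the cosets of the stabilizer of uH induces an action of
   S_K^inv by injective maps, so the idempotent uK acts trivially. *)
Lemma idempotent_action A (y c : elt) : M `<=` A -> Real A uK (sval y) -> H (sval c) -> y * c * y^-1 ~H c.
Proof.
move=> MA Ry Hc; have {}Ry : Real M uK (sval y) := Real_sub MA Ry.
have [z Rz] := realK (smallE y sM); have Rz0 : Real M uK (sval z) := Real_sub (@sub_adjoin _ _) Rz.
have Rzy := nprodE SuKG SuKG.1 sM (fun _ => id) Ry Rz; rewrite uuK in Rzy.
have := conj_action Hc (over_M Rzy Rz0).
move=> /(eqvH_conj z^-1 (normal_H _ Hc) (normal_H _ Hc)).
by rewrite !invgM invgK !mulgA !(mulgVK, mulVg, mul1g).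
Qed.

Lemma idempotent_actionV A (y c : elt) : M `<=` A -> Real A uK (sval y) -> H (sval c) -> y^-1 * c * y ~H c.
Proof.
move=> MA Ry Hc; have := idempotent_action MA Ry Hc.
move=> /(eqvH_conj y^-1 (normal_H _ Hc) Hc).
by rewrite !invgK !mulgA !(mulgVK, mulVg, mul1g) => /esym.
Qed.

Notation a c k := (op (uH · c) (uK · k)).

(** For x and y realizing [uH] and [uK], x y (c k) = x (y c y^-1) (y k), and y c y^-1 is in the
    class of c since [uK] acts trivially. For this x is chosen generic over y c y^-1 as well. *)
Lemma translate_HK (c k : elt) : H (sval c) -> K (sval k) -> op uH uK · (c * k) = a c k.
Proof.
move=> Hc Kk; have Su : S_ (gset G) (op uH uK) := nprod_S Usat Uhom smallU sM sG SuHG SuKG.1.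
apply: (Real_eq smallU (smallE (c * k) (smallE k (smallE c sM)))) => A sA BA.
have MA : M `<=` A by move=> x ?; apply: BA; left; left; left.
have [y Ry] := realK sA; pose c' := y * c * y^-1; have Hc' : H (sval c') := normal_H y Hc.
have sA' := smallE (y * k) (smallE c' (smallE y sA)).
have [x Rx] := realH sA'.
exists (sval (x * y * (c * k))); split.
  apply: transE => //; first by move=> z ?; apply: BA; right.
  apply: (nprodE SuHG SuKG.1 sA MA Ry); apply: Real_sub Rx => z [?|?]; left; left; [left|right] => //.
have -> : x * y * (c * k) = x * c' * (y * k) by rewrite /c' !mulgA mulgVK.
have Ryk : Real A (uK · k) (sval (y * k)).
  by apply: transE => //; [exact: SuKG.1|move=> z ?; apply: BA; left; right].
apply: (nprodE (SG sH (SH_tr Hc)) (SG0 sK (SK_tr Kk).1) sA MA Ryk).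
have -> : uH · c = uH · c' by apply/esym; exact: (idempotent_action MA Ry Hc).
apply: (@Real_sub _ _ _ _ (((A `|` rg y) `|` rg c') `|` rg (y * k))).
  by move=> z [?|?]; [left; left; left|right].
by apply: transE => //; [exact: SuHG.1|move=> z ?; left; right].
Qed.

Lemma nprod_HK_inv (c k : elt) : H (sval c) -> K (sval k) -> S_inv M (gset G) (a c k).
Proof. by move=> Hc Kk; exact: (op_inv sG (SG sH (SH_tr Hc)) (SG sK (SK_tr Kk))). Qed.

Lemma translation_invariant_HK : tinv (gset G) (op uH uK).
Proof.
split; first by have := nprod_HK_inv H1 K1; rewrite uH1 uK1.
move=> g _; have [h [k [Hh Kk ->]]] := decomposition g.
by rewrite translate_HK //; case: (nprod_HK_inv Hh Kk).
Qed.

(** Translating by a realization x y of the type is translating the factors by x and y, which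
    stabilize [uH] and [uK]. *)
Lemma idempotent_HK : op (op uH uK) (op uH uK) = op uH uK.
Proof.
have [y Ry] := realK sM; have [x Rx] := realH (smallE y sM).
have R := nprodE SuHG SuKG.1 sM (fun _ => id) Ry Rx.
rewrite (nprodT sG translation_invariant_HK translation_invariant_HK.1 (fun _ => id) R) translate_HK; [|exact: (inH Rx)|exact: (inK Ry)].
have -> : uH · x = uH by rewrite -[RHS]uH1; apply: (eqvH1 _ Rx); exact: sub_adjoin.
by have -> : uK · y = uK by rewrite -[RHS]uK1; apply: (eqvK1 _ Ry).
Qed.

Lemma set_op_HK : set_op op EhatH EK =
  [set op uH uK · g | g in [set g : elt | gset G (sval g)]].
Proof.
apply/seteqP; split=> [_ [_ [c Hc <-] [_ [k Kk <-] <-]]|_ [g _ <-]].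
  by exists (c * k); [exact: svalP|rewrite translate_HK].
have [h [k [Hh Kk ->]]] := decomposition g; exists (uH · h); first by exists h.
by exists (uK · k); [exists k|rewrite translate_HK].
Qed.

Lemma exists_fs_type Hs (c : elt) : def_subgroup G Hs -> Hs (sval c) -> exists t, S_fs M Hs t /\ Real M t (sval c).
Proof. by move=> [dHs _ _ _ _] Hc; apply: (fs_extension eM sP). Qed.

Lemma exists_inv_type Hs (c : elt) : def_subgroup G Hs -> Hs (sval c) -> exists t, S_inv M Hs t /\ Real M t (sval c).
Proof. by move=> sHs Hc; have [t [/fs_inv St Rt]] := exists_fs_type sHs Hc; exists t. Qed.

Lemma ellis_HK : ellis_subgroup op (S_inv M (gset G))
  (set_op op EhatH EK).
Proof.
rewrite set_op_HK; apply: (translates_ellis_subgroup Usat Uhom smallU small_image sM sG translation_invariant_HK idempotent_HK) => //.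
- by move=> p q; exact: op_inv.
- by move=> c; exact: exists_inv_type.
- exact: translation_invariant_HK.1.
Qed.

Lemma nprod_HK_mul (c c' k k' : elt) : H (sval c) -> H (sval c') -> K (sval k) -> K (sval k') ->
  op (a c k) (a c' k') = a (c * (k * c' * k^-1)) (k * k').
Proof.
move=> Hc Hc' Kk Kk'; rewrite -!translate_HK //; [|by apply: HM => //; exact: normal_H|exact: KM].
rewrite (nprod_translate_translate Usat Uhom smallU sM sG translation_invariant_HK idempotent_HK (svalP _) (svalP _)).
by rewrite !mulgA mulgVK.
Qed.

Lemma nprod_HK_inj (c c' k k' : elt) : H (sval c) -> H (sval c') -> K (sval k) -> K (sval k') ->
  a c k = a c' k' -> c ~H c' /\ k ~K k'.
Proof.
move=> Hc Hc' Kk Kk' E.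
have [Ek h] := nprod_HK_unique (SH_tr Hc) (SH_tr Hc') (SK_tr Kk) (SK_tr Kk') E; split=> //.
have [x Rx] := existsE (SG0 sH (SH_tr Hc).1) sM; have [x' Rx'] := existsE (SG0 sH (SH_tr Hc').1) sM.
have Hx := S_in dH (SH_tr Hc).1 Rx; have Hx' := S_in dH (SH_tr Hc').1 Rx'.
rewrite /eqv -(eqvH_real (fun _ => id) Hc Rx) -(eqvH_real (fun _ => id) Hc' Rx').
by apply: eqvH_over => //; exact: h.
Qed.

(** * The retracted group and the Ellis subgroup of finitely satisfiable types on [G] *)

Lemma type_inv_definable p : S_ (gset G) p -> definable_type M p -> definable_type M (inv p).
Proof.
move=> Sp dp m phi.
have [|theta Ht] := dfun_pre (dfun_ginv G) (R := fun v : 'I_n + 'I_m -> U => sat v phi); first by exists phi.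
apply: definable_iff (dp m theta) => d /=.
rewrite -(conc_holds Sp.1 (inst theta d)) /type_inv /push /=.
suff -> : [set x | gset G x /\ holds (ginv G x) (inst phi d)] = [set x | holds x (inst theta d)] by [].
apply/predeqP => x /=; rewrite !holds_inst -Ht.
by have -> : join x d \o inr = d by apply: funext.
Qed.

(** The two inversions compensate each other: [rr c] is realized by c a^-1 with a realizing [uH], so
    that it represents the class of c, and [f] will be multiplicative. *)
Let rr (c : elt) := inv (uH · c^-1).
Let f (c : elt) := F (rr c).
Notation EH := [set f c | c in [set c : elt | H (sval c)]].

Let rr_Sinv (c : elt) : H (sval c) -> S_inv M H (rr c).
Proof. by move=> Hc; apply: (type_inv_inv Usat smallU sM sH); apply: SH_tr; exact: HV. Qed.

Let rr_eqv (c d : elt) : H (sval c) -> H (sval d) -> c ~H d -> rr c = rr d.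
Proof. by move=> Hc Hd h; rewrite /rr (eqvH_inv Hc Hd h). Qed.

Let rr_Real A (c a : elt) : rg c^-1 `<=` A -> Real A uH (sval a) -> Real A (rr c) (sval (c * a^-1)).
Proof.
move=> cA Ra; have -> : c * a^-1 = (a * c^-1)^-1 by rewrite invgM invgK.
apply: type_inv_Real; first exact: (translate_r_S Usat smallU sM sG SuHG.1 (svalP _)).
by apply: transE => //; exact: SuHG.1.
Qed.

Let SfsG Hs p : def_subgroup G Hs -> S_fs M Hs p -> S_fs M (gset G) p.
Proof. by move=> sHs [Sp fp]; split=> //; exact: (SG0 sHs Sp). Qed.

Let FS c (Hc : H (sval (c : elt))) : S_fs M H (f c) :=
  F_S Usat Uhom smallU small_countable eM sM sP TU nip dH (rr_Sinv Hc).
Let F_op t r := F_nprod Usat Uhom smallU small_image small_countable eM sM sP TU nip (G := G) (t := t) (r := r).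

(* Since inv uH is M-definable and s is finitely satisfiable in M, the Morley
   product of s and rr c may be realized in either order. *)
Lemma nprod_inv_translate_Real s A (c g a : elt) : S_fs M (gset G) s -> H (sval c) -> small A -> M `<=` A -> rg c^-1 `<=` A ->
  Real A s (sval g) -> Real (A `|` rg g) uH (sval a) -> Real A (op s (rr c)) (sval (g * (c * a^-1))).
Proof.
move=> fs Hc sA MA cA Rg Ra; have Sr := rr_Sinv Hc.
have Rx : Real (A `|` rg g) (rr c) (sval (c * a^-1)) by apply: rr_Real Ra => x ?; left; exact: cA.
apply: (nprodE (fs_inv fs) (SG0 sH Sr.1) sA MA); first by apply: Real_sub Rx => x; left.
apply: (fs_definable_commute fs.2 fs.1.1 _ Sr.1.1 MA Rg Rx).
apply: type_inv_definable; first exact: (SG0 sH (SH_tr (HV Hc)).1).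
exact: dfH (HV Hc).
Qed.

Lemma retraction_eqv (c d : elt) : H (sval c) -> H (sval d) -> c ~H d -> f c = f d.
Proof. by move=> Hc Hd h; rewrite /f (rr_eqv Hc Hd h). Qed.

Lemma inv_translate_realization (c x : elt) : H (sval c) -> Real M (rr c) (sval x) -> x ~H c.
Proof.
move=> Hc Rx; have Hx := S_in dH (rr_Sinv Hc).1 Rx.
have [a Ra] := realH (smallE c^-1 sM); have Ha := inH Ra.
have Rca : Real M (rr c) (sval (c * a^-1)).
  apply: (Real_sub (@sub_adjoin _ (rg c^-1))); apply: rr_Real Ra; exact: adjoin_sub.
have h : x ~H c * a^-1 by apply: eqvH_over => //; [apply: HM => //; exact: HV|exact: (over_M Rx Rca)].
have ha : a^-1 ~H 1.
  rewrite -[1](invg1 elt); apply: eqvH_inv => //; exact: (eqvH1 (@sub_adjoin _ _) Ra).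
by rewrite /eqv h (eqv_mul Usat Uhom smallU sM sH tH Hc Hc (HV Ha) H1 (erefl _) ha) mulg1.
Qed.

Lemma retraction_realization A (c x : elt) : H (sval c) -> M `<=` A -> Real A (f c) (sval x) -> x ~H c.
Proof.
move=> Hc MA Rx; apply: inv_translate_realization => //; have [[gr _] ir] := rr_Sinv Hc.
apply: (Real_F Usat Uhom smallU small_countable eM sM sP TU nip gr ir (fun _ => id)).
exact: Real_sub Rx.
Qed.

Lemma retraction_inj (c d : elt) : H (sval c) -> H (sval d) -> f c = f d -> c ~H d.
Proof.
move=> Hc Hd E; have [x Rx] := existsE (SG0 sH (FS Hc).1) sM.
by rewrite /eqv -(retraction_realization Hc (fun _ => id) Rx); rewrite E in Rx; exact: retraction_realization Rx.
Qed.

(** Before retraction both sides are realized by g (c a^-1) = (g c) a^-1, with g realizing t and a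
    realizing [uH] over g; and [rr] only depends on the class of g c, which is that of h c. *)
Lemma nprod_fs_retraction t (h c : elt) : S_fs M H t -> Real M t (sval h) -> H (sval c) -> op t (f c) = f (h * c).
Proof.
move=> ft Rh Hc; have ftG := SfsG sH ft; have Hh := S_in dH ft.1 Rh.
rewrite /f -(F_op ftG (SG sH (rr_Sinv Hc))); congr F.
have Str := op_inv sG (fs_inv ftG) (SG sH (rr_Sinv Hc)).
apply: (Real_eq smallU (smallE c^-1 sM)) => A sA BA.
have MA : M `<=` A by move=> x ?; apply: BA; left.
have cA : rg c^-1 `<=` A by move=> x ?; apply: BA; right.
have [g Rg] := existsE ftG.1 sA; have Hg := S_in dH ft.1 Rg.
have [a Ra] := realH (smallE (g * c)^-1 (smallE g sA)).
have Ra' : Real (A `|` rg g) uH (sval a) by apply: Real_sub Ra; exact: sub_adjoin.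
exists (sval (g * (c * a^-1))); split; first exact: nprod_inv_translate_Real.
rewrite (_ : rr (h * c) = rr (g * c)).
  rewrite mulgA; apply: (@Real_sub _ _ _ A _ _ _ _ (rr_Real (@adjoin_sub (A `|` rg g) _) Ra)).
  by move=> x ?; left; left.
apply: rr_eqv; [exact: HM|exact: HM|apply: eqvH_mulr; apply: eqvH_over => //].
by apply: (over_M Rh _); exact: Real_sub Rg.
Qed.

Let fsK (k : elt) : K (sval k) -> S_fs M K (uK · k).
Proof.
apply: (translate_X Usat Uhom smallU sM sK tK (X := S_fs M K)) => //; first exact: fs_inv.
  by move=> p q; exact: op_fs.
by move=> c Kc; exact: exists_fs_type sK Kc.
Qed.

(** Once the retraction is outside, a realization g = k' h' of s is split, and y (k' h') (c a^-1) =
    (y k') (h' c a^-1) is read in both ways. The factor [uK] absorbs the choice of k', as [uK · k]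
    depends only on the type of k over [M]. *)
Lemma nprod_fs_KH s (k h c : elt) : S_fs M (gset G) s -> K (sval k) -> H (sval h) -> H (sval c) ->
  Real M s (sval (k * h)) -> op uK (op s (f c)) = op (uK · k) (f (h * c)).
Proof.
move=> fs Kk Hh Hc Rs; have SrG := SG sH (rr_Sinv Hc).
have fuK := SfsG sK fK; have fuKk := SfsG sK (fsK Kk).
have Srs := op_inv sG (fs_inv fs) SrG.
have Hhc := HM Hh Hc; have SrG' := SG sH (rr_Sinv Hhc).
rewrite /f -(F_op fs SrG) -(F_op fuK Srs) -(F_op fuKk SrG'); congr F.
apply: (Real_eq smallU (smallE c^-1 sM)) => A sA BA.
have MA : M `<=` A by move=> x ?; apply: BA; left.
have cA : rg c^-1 `<=` A by move=> x ?; apply: BA; right.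
have [g Rg] := existsE fs.1 sA; have [k' [h' [Kk' Hh' Eg]]] := decomposition_KH g.
have [Ehh Ekk] : conj_over M h h' /\ conj_over M k k'.
  have [s0 [aut fx]] := over_M Rs (Real_sub MA Rg); rewrite Eg => E.
  have [E1 E2] := conj_decomposition_KH Hh Hh' Kk Kk' aut E.
  by split; exists s0.
have [a Ra] := realH (smallE (h' * c)^-1 (smallE g sA)).
have Ra' : Real (A `|` rg g) uH (sval a) by apply: Real_sub Ra; exact: sub_adjoin.
have R1 := nprod_inv_translate_Real fs Hc sA MA cA Rg Ra'.
pose x := h' * c * a^-1.
have R2 : Real A (rr (h * c)) (sval x).
  rewrite (_ : rr (h * c) = rr (h' * c)).
    apply: (@Real_sub _ _ _ A _ _ _ _ (rr_Real (@adjoin_sub (A `|` rg g) _) Ra)).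
    by move=> y ?; left; left.
  by apply: rr_eqv; [exact: HM|exact: HM|apply: eqvH_mulr; exact: eqvH_over].
(* y is generic over g (c a^-1) for the first reading, over x and k' for the second. *)
have [y Ry] := realK (smallE k' (smallE x (smallE (g * (c * a^-1)) sA))).
exists (sval (y * (g * (c * a^-1)))); split.
  apply: (nprodE (fs_inv fuK) Srs.1 sA MA R1); apply: Real_sub Ry => z [?|?]; left; left; [left|right] => //.
have -> : y * (g * (c * a^-1)) = y * k' * x by rewrite Eg /x !mulgA.
apply: (nprodE (fs_inv fuKk) SrG'.1 sA MA R2).
have -> : uK · k = uK · k' by apply: eqvK_over.
apply: (@Real_sub _ _ _ _ (((A `|` rg (g * (c * a^-1))) `|` rg x) `|` rg k')).
  by move=> z [?|?]; left; [left; left|right].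
by apply: (transE _ _ Ry); [exact: SuKG.1|exact: adjoin_sub].
Qed.

Notation e k c := (op (uK · k) (f c)).

Lemma nprod_KH_fs (k c : elt) : K (sval k) -> H (sval c) -> S_fs M (gset G) (e k c).
Proof. by move=> Kk Hc; exact: (op_fs sG (SfsG sK (fsK Kk)) (SfsG sH (FS Hc))). Qed.

Let opAfs p q r : S_fs M (gset G) p -> S_fs M (gset G) q -> S_fs M (gset G) r ->
  op p (op q r) = op (op p q) r.
Proof. by move=> /fs_inv Sp /fs_inv Sq /fs_inv Sr; exact: opA. Qed.

(** Writing [uK · k] as uK * t with t finitely satisfiable makes everything between the leading [uK]
    and the last retraction a single finitely satisfiable type, to which [nprod_fs_KH] applies. *)
Lemma nprod_KH_mul (k c k' c' : elt) : K (sval k) -> H (sval c) -> K (sval k') -> H (sval c') ->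
  op (e k c) (e k' c') = e (k * k') (k'^-1 * c * k' * c').
Proof.
move=> Kk Hc Kk' Hc'; have [t [ft Rt]] := exists_fs_type sK Kk.
have ftG := SfsG sK ft; have fcG := SfsG sH (FS Hc); have fcG' := SfsG sH (FS Hc').
have fkG := SfsG sK (fsK Kk'); have fuK := SfsG sK fK.
pose s := op t (op (f c) (uK · k')).
have fcu := op_fs sG fcG fkG; have fs : S_fs M (gset G) s := op_fs sG ftG fcu.
have -> : op (e k c) (e k' c') = op uK (op s (f c')).
  rewrite -(nprodT sK tK (fs_inv ft) (fun _ => id) Rt) /s.
  have futG := op_fs sG fuK ftG; have ekG := op_fs sG fkG fcG'.
  rewrite -(opAfs futG fcG ekG) -(opAfs fuK ftG (op_fs sG fcG ekG)).
  by rewrite (opAfs fcG fkG fcG') (opAfs ftG fcu fcG').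
have [y0 Ry0] := realK (smallE k' sM); have Ky0 := inK Ry0.
have [y Ey] : exists y, y = y0 * k' by exists (y0 * k').
have Ky : K (sval y) by rewrite Ey; exact: KM.
have Ry : Real M (uK · k') (sval y).
  rewrite Ey; apply: (Real_sub (@sub_adjoin _ (rg k'))); apply: (transE _ _ Ry0); [exact: SuKG.1|exact: adjoin_sub].
have [z Rz] := existsE fcG.1 (smallE y sM).
have Rzy := nprodE (fs_inv fcG) fkG.1 sM (fun _ => id) Ry Rz.
have [w Rw] := existsE ftG.1 (smallE (z * y) sM).
have Rs := nprodE (fs_inv ftG) fcu.1 sM (fun _ => id) Rzy Rw.
have Kw : K (sval w) := S_in dK ft.1 Rw; have Hz : H (sval z) := S_in dH (FS Hc).1 Rz.
have Hzy : H (sval (y^-1 * z * y)) by exact: normal_HV.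
(* The realization w z y of [s] is split as (w y) (y^-1 z y), with factors in [K] and in [H]. *)
rewrite (nprod_fs_KH (k := w * y) (h := y^-1 * z * y) fs (KM Kw Ky) Hzy Hc'); last first.
  have -> : w * y * (y^-1 * z * y) = w * (z * y) by rewrite !mulgA mulgK.
  exact: Rs.
congr op.
  apply: eqvK_mul => //; first by apply: eqvK_over => //; apply: (over_M _ Rt); apply: Real_sub Rw; exact: sub_adjoin.
  by rewrite Ey /eqv (eqvK_mul Ky0 K1 Kk' Kk' (eqvK1 (@sub_adjoin _ _) Ry0) (erefl _)) mul1g.
apply: retraction_eqv; [exact: HM|by apply: HM => //; exact: normal_HV|].
apply: eqvH_mulr; have hz : z ~H c := retraction_realization Hc (@sub_adjoin _ _) Rz.
have h1 : y^-1 * z * y ~H y^-1 * c * y by have := eqvH_conj y^-1 Hz Hc hz; rewrite invgK.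
(* As [y] is y0 k' and y0 realizes [uK], which acts trivially, conjugating by [y] amounts to
   conjugating by [k']. *)
have h2 : y0^-1 * c * y0 ~H c := idempotent_actionV (@sub_adjoin _ _) Ry0 Hc.
rewrite /eqv h1; have := eqvH_conj k'^-1 (normal_HV _ Hc) Hc h2.
by rewrite invgK Ey invgM !mulgA.
Qed.

Lemma nprod_KH_inj (k c k' c' : elt) : K (sval k) -> H (sval c) -> K (sval k') -> H (sval c') ->
  e k c = e k' c' -> k ~K k' /\ c ~H c'.
Proof.
move=> Kk Hc Kk' Hc' E.
have [Ek h] := nprod_KH_unique (fs_inv (FS Hc)) (fs_inv (FS Hc')) (SK_tr Kk) (SK_tr Kk') E; split=> //.
have [x Rx] := existsE (SG0 sH (FS Hc).1) sM; have [x' Rx'] := existsE (SG0 sH (FS Hc').1) sM.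
have Hx := S_in dH (FS Hc).1 Rx; have Hx' := S_in dH (FS Hc').1 Rx'.
rewrite /eqv -(retraction_realization Hc (fun _ => id) Rx) -(retraction_realization Hc' (fun _ => id) Rx').
by apply: eqvH_over => //; exact: h.
Qed.

Lemma nprod_retraction (c d : elt) : H (sval c) -> H (sval d) -> op (f c) (f d) = f (c * d).
Proof.
move=> Hc Hd; have [x Rx] := existsE (SG0 sH (FS Hc).1) sM.
rewrite (nprod_fs_retraction (FS Hc) Rx Hd); have Hx := S_in dH (FS Hc).1 Rx.
by apply: retraction_eqv; [exact: HM|exact: HM|apply: eqvH_mulr; exact: retraction_realization Rx].
Qed.

Lemma ellis_retraction : ellis_subgroup op (S_fs M H) EH.
Proof.
apply: (ellis_subgroupI _ _ (u := f 1)).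
- by move=> p q; exact: op_fs.
- by move=> p q r /(SfsG sH) Sp /(SfsG sH) Sq /(SfsG sH) Sr; exact: opAfs.
- by move=> _ [c Hc <-]; exact: FS.
- by exists 1.
- move=> t ft; have [h Rh] := existsE (SG0 sH ft.1) sM; have Hh := S_in dH ft.1 Rh.
  rewrite -(opAfs (SfsG sH (FS H1)) (SfsG sH ft) (SfsG sH (FS H1))) (nprod_fs_retraction ft Rh H1) mulg1 nprod_retraction //.
  by exists (1 * h) => //; exact: HM.
- move=> _ [c Hc <-]; rewrite !nprod_retraction // mul1g mulg1; split=> //.
  exists (f c^-1); split; first by exists c^-1 => //; exact: HV.
  by rewrite nprod_retraction ?mulVg //; exact: HV.
Qed.

Lemma ellis_KH : ellis_subgroup op (S_fs M (gset G))
  (set_op op EK EH).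
Proof.
have mem k c : K (sval k) -> H (sval c) -> set_op op EK
    EH (e k c).
  by move=> Kk Hc; exists (uK · k); [exists k|exists (f c); [exists c|]].
apply: (ellis_subgroupI _ _ (u := e 1 1)).
- by move=> p q; exact: (op_fs sG).
- by move=> p q r; exact: opAfs.
- by move=> _ [_ [k Kk <-] [_ [c Hc <-] <-]]; exact: nprod_KH_fs.
- exact: mem.
- move=> t ft; rewrite uK1.
  have fuK := SfsG sK fK; have fo := SfsG sH (FS H1).
  have f1 := op_fs sG fuK fo; have f2 := op_fs sG ft fuK; have f3 := op_fs sG fo f2.
  (* The inner factors are bracketed into one finitely satisfiable type between [uK] and [f 1], the
     shape required by [nprod_fs_KH]. *)
  have -> : op (op (op uK (f 1)) t) (op uK (f 1)) = op uK (op (op (f 1) (op t uK)) (f 1)).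
    by rewrite (opAfs (op_fs sG f1 ft) fuK fo) -(opAfs fuK fo ft) -(opAfs fuK (op_fs sG fo ft) fuK) -(opAfs fo ft fuK) (opAfs fuK f3 fo).
  have [g Rg] := existsE f3.1 sM; have [k [h [Kk Hh Eg]]] := decomposition_KH g.
  by rewrite Eg in Rg; rewrite (nprod_fs_KH f3 Kk Hh H1 Rg); apply: mem => //; exact: HM.
- move=> _ [_ [k Kk <-] [_ [c Hc <-] <-]].
  have [Kki Hci] := (KV Kk, HV Hc).
  split.
  + by rewrite nprod_KH_mul // mul1g mulg1 mulVg mul1g.
  + by rewrite nprod_KH_mul // invg1 !mulg1 mul1g.
  (* This is the left inverse for the law (k, c) (k', c') = (k k', k'^-1 c k' c'). *)
  exists (e k^-1 (k * c^-1 * k^-1)); split; first by apply: mem => //; exact: normal_H.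
  rewrite nprod_KH_mul //; last exact: normal_H.
  by rewrite mulVg !mulgA !(mulgVK, mulVg, mul1g).
Qed.

Lemma K_M_translate (c : elt) : K_M (uH · c) = f c^-1.
Proof. by rewrite /f /rr invgK. Qed.

(** * The conjugation of a type on [H] by a type on [K] *)

Let conj_dom (v : 'I_n + 'I_n -> U) := gset G (v \o inl) /\ gset G (v \o inr).

Lemma dfun_conj_by V (dom : set (V -> U)) g1 g2 : dfun dom g1 -> dfun dom g2 ->
  (forall v, dom v -> gset G (g1 v)) -> (forall v, dom v -> gset G (g2 v)) ->
  dfun dom (fun v => conj_by G (g1 v) (g2 v)).
Proof.
move=> d1 d2 h1 h2; apply: dfun_mul; first exact: dfun_mul.
- exact: dfun_comp (dfun_ginv G) h1.
- by move=> v dv; apply: gmul_in; [exact: h1|exact: h2].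
- by move=> v dv; apply: ginv_in; exact: h1.
Qed.

Lemma type_conj_Real q s A (x y : elt) : S_inv M K q -> S_inv M H s -> small A -> M `<=` A ->
  Real A s (sval y) -> Real (A `|` rg y) q (sval x) ->
  Real A (type_conj G H K (morley M q s)) (sval (x * y * x^-1)).
Proof.
move=> Sq Ss sA MA Ry Rx; have Hy := S_in dH Ss.1 Ry; have Kx := S_in dK Sq.1 Rx.
have [_ HG _ _ _] := sH; have [_ KG _ _ _] := sK.
have R := morley_Real Usat Uhom smallU sM sP Sq.1.1 Sq.2 Ss.1.1 MA Ry Rx.
have gt : global_type (morley M q s).
  apply: (global_type_Real smallU sM) => B sB MB.
  have [y' Ry'] := existsE (SG0 sH Ss.1) sB; have [x' Rx'] := existsE (SG0 sK Sq.1) (smallE y' sB).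
  exists (join (sval x') (sval y')).
  exact: (morley_Real Usat Uhom smallU sM sP Sq.1.1 Sq.2 Ss.1.1 MB Ry' Rx').
apply: (push_Real (f := fun c => conj_by G (c \o inl) (c \o inr)) gt R); first by split.
move=> E dE; pose dom (c : 'I_n + 'I_n -> U) := K (c \o inl) /\ H (c \o inr).
have Hdom : Def dom := Def_and (Def_sub inl (definable_Def dK)) (Def_sub inr (definable_Def dH)).
have hd : dfun dom (fun c => conj_by G (c \o inl) (c \o inr)).
  apply: dfun_conj_by; [exact: dfun_proj|exact: dfun_proj|by move=> v [/KG]|by move=> v [_ /HG]].
have [m [e [R' [he HR' ->]]]] := definableE dE.
apply: definable_iff (definableI (dfun_pre hd HR') he) => c /=.
by rewrite (_ : join c e \o inl = c) // (_ : join c e \o inr = e).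
Qed.

Lemma closed_conj_by (a b : tup n U) : (forall i, M (a i)) -> (forall i, M (b i)) -> gset G a -> gset G b ->
  forall i, M (conj_by G a b i).
Proof.
move=> Ma Mb Ga Gb; apply: closed_mul => //; [exact: closed_mul|exact: closed_inv|exact: gmul_in|exact: ginv_in].
Qed.

(** The realizations of q and s are successively replaced by points of [M], which is closed under
    conjugation. *)
Lemma type_conj_fs q s : S_fs M K q -> S_fs M H s -> S_fs M H (type_conj G H K (morley M q s)).
Proof.
move=> fq fs; have Sq := fs_inv fq; have Ss := fs_inv fs; split.
  apply: (S_Real smallU sM dH) => A sA MA.
  have [y Ry] := existsE (SG0 sH Ss.1) sA; have [x Rx] := existsE (SG0 sK Sq.1) (smallE y sA).
  exists (sval (x * y * x^-1)); split; first exact: type_conj_Real.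
  by apply: normal_H; exact: S_in dH Ss.1 Ry.
move=> Phi tPhi; have [k [phi [d [_ EPhi]]]] := over_setT Phi.
pose A := M `|` range d; have sA : small A := small_range smallU d sM.
have MA : M `<=` A by move=> x; left.
have oA : over A Phi by rewrite EPhi; apply: over_inst => i; right; exists i.
have [y Ry] := existsE (SG0 sH Ss.1) sA; have [x Rx] := existsE (SG0 sK Sq.1) (smallE y sA).
have h : holds (conj_by G (sval x) (sval y)) Phi := (type_conj_Real Sq Ss sA MA Ry Rx oA).1 tPhi.
have hd : dfun conj_dom (fun v => conj_by G (v \o inl) (v \o inr)).
  by apply: dfun_conj_by; [exact: dfun_proj (Def_GG G)|exact: dfun_proj (Def_GG G)|move=> v []..].
have hd' : dfun conj_dom (fun v => conj_by G (v \o inr) (v \o inl)).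
  by apply: dfun_conj_by; [exact: dfun_proj (Def_GG G)|exact: dfun_proj (Def_GG G)|move=> v []..].
have dE1 := dfun_param hd (b := sval y) (fun i => or_intror (imageP _ (a := i) I) : (A `|` rg y) _)
  (definable_mono (@sub_adjoin A (rg y)) (definable_holds oA)).
have := (conc_real fq.1.1 Rx dE1).2 (conj (conj (svalP x) (svalP y)) h).
move=> /(fs_conc fq.2)[m [Mm [[Gm _] hm]]].
have dE2 := dfun_param hd' (b := m) (fun i => MA _ (Mm i)) (definable_holds oA).
have := (conc_real fs.1.1 Ry dE2).2 (conj (conj (svalP y) Gm) hm).
move=> /(fs_conc fs.2)[m' [Mm' [[Gm' _] hm']]].
by exists (conj_by G m m'); split=> //; exact: closed_conj_by.
Qed.

(* The argument of iota in the definition of nu_M, for q = uK k and p = uH c^-1. *)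
Lemma type_conj_retraction (k c : elt) : K (sval k) -> H (sval c) ->
  op (type_conj G H K (morley M (inv (uK · k)) (f c))) (f 1) = f (k^-1 * c * k).
Proof.
move=> Kk Hc; have fq : S_fs M K (inv (uK · k)) := type_inv_fs Usat smallU eM sM sK (fsK Kk).
have ft := type_conj_fs fq (FS Hc).
have [y Ry] := existsE (SG0 sH (FS Hc).1) (smallE k sM); have Hy := S_in dH (FS Hc).1 Ry.
have [a Ra] := realK (smallE k (smallE y (smallE k sM))); pose x := (a * k)^-1.
have Rx : Real ((M `|` rg k) `|` rg y) (inv (uK · k)) (sval x).
  apply: type_inv_Real; first exact: (SG0 sK (SK_tr Kk).1).
  apply: (Real_sub (@sub_adjoin _ (rg k))); apply: (transE _ _ Ra); [exact: SuKG.1|exact: adjoin_sub].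
have Rt := type_conj_Real (fs_inv fq) (fs_inv (FS Hc)) (smallE k sM) (@sub_adjoin _ _) Ry Rx.
rewrite (nprod_fs_retraction ft (Real_sub (@sub_adjoin _ _) Rt) H1) mulg1.
apply: retraction_eqv; [exact: normal_H|exact: normal_HV|].
have hy : y ~H c := retraction_realization Hc (@sub_adjoin _ _) Ry.
have ha : a^-1 * y * a ~H y by apply: idempotent_actionV Ra Hy => z ?; left; left; left.
have h1 := eqvH_conj k^-1 (normal_HV a Hy) Hy ha; have h2 := eqvH_conj k^-1 Hy Hc hy.
by rewrite invgK in h1 h2; rewrite /eqv -h2 -h1 /x invgK invgM !mulgA.
Qed.

(** The left side of [type_conj_retraction] involves k only through the type [uK · k], and [f]
    separates the classes. *)
Lemma conj_eqvK (k k' c : elt) : K (sval k) -> K (sval k') -> H (sval c) -> k ~K k' ->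
  k^-1 * c * k ~H k'^-1 * c * k'.
Proof.
move=> Kk Kk' Hc h; apply: retraction_inj; [exact: normal_HV|exact: normal_HV|].
by rewrite -!type_conj_retraction //; rewrite /eqv in h; rewrite h.
Qed.

(* uK * q^-1 is the inverse of q in the Ellis group of K *)
Lemma idempotent_type_inv (k : elt) : K (sval k) -> op uK (inv (uK · k)) = uK · k^-1.
Proof.
move=> Kk; have Sq := type_inv_inv Usat smallU sM sK (SK_tr Kk).
have [a Ra] := realK (smallE k sM); have Ka := inK Ra.
have R : Real M (inv (uK · k)) (sval (a * k)^-1).
  apply: type_inv_Real; first exact: (SG0 sK (SK_tr Kk).1).
  apply: (Real_sub (@sub_adjoin _ (rg k))); apply: (transE _ _ Ra); [exact: SuKG.1|exact: adjoin_sub].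
rewrite (nprodT sK tK Sq (fun _ => id) R) invgM.
have ha : a^-1 ~K 1 by rewrite -[1](invg1 elt); apply: eqvK_inv => //; exact: (eqvK1 (@sub_adjoin _ _) Ra).
by rewrite (eqvK_mul (KV Kk) (KV Kk) (KV Ka) K1 (erefl _) ha) mulg1.
Qed.

(** * Unique factorization and the three maps *)

Notation setA := (set_op op EhatH EK).
Notation setB := (set_op op EK EH).

Lemma K_M_image : [set K_M p | p in EhatH] = EH.
Proof.
apply/seteqP; split=> [_ [_ [c Hc <-] <-]|_ [c Hc <-]].
  by exists c^-1; [exact: HV|rewrite K_M_translate].
by exists (uH · c^-1); [exists c^-1 => //; exact: HV|rewrite K_M_translate invgK].
Qed.

Lemma unique_factorization_HK : unique_factorization op EhatH EK.
Proof.
move=> _ [_ [c Hc <-] [_ [k Kk <-] <-]]; exists (uH · c, uK · k); split=> /=.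
  by split=> //; [exists c|exists k].
move=> [_ _] /= [[c' Hc' <-] [k' Kk' <-]] E.
by have [hc hk] := nprod_HK_inj Hc Hc' Kk Kk' E; rewrite hc hk.
Qed.

Lemma unique_factorization_KH : unique_factorization op EK EH.
Proof.
move=> _ [_ [k Kk <-] [_ [c Hc <-] <-]]; exists (uK · k, f c); split=> /=.
  by split=> //; [exists k|exists c].
move=> [_ _] /= [[k' Kk' <-] [c' Hc' <-]] E.
by have [hk hc] := nprod_KH_inj Kk Hc Kk' Hc' E; rewrite hk (retraction_eqv Hc Hc' hc).
Qed.

(** Unique factorization makes a map of pairs a map of products; elsewhere its value is an arbitrary
    default, the argument itself. *)
Lemma factor_map (Phi : gtp -> gtp -> gtp) : exists nu, forall p q, EhatH p -> EK q -> nu (op p q) = Phi p q.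
Proof.
pose dec z := [set pq : gtp * gtp | [/\ EhatH pq.1, EK pq.2 & z = op pq.1 pq.2]].
exists (fun z => if pselect (dec z !=set0) is left h then Phi (sval (cid h)).1 (sval (cid h)).2 else z).
move=> p q hp hq; case: pselect => [h|[]]; last by exists (p, q).
have [pq [_ U0]] := unique_factorization_HK (ex_intro2 _ _ p hp (ex_intro2 _ _ q hq erefl)).
by case: (cid h) => /= x hx; rewrite -(U0 x hx) (U0 (p, q)).
Qed.

(** All three maps are given by maps of representatives, so that bijectivity becomes a statement on
    group elements modulo the two stabilizers. *)
Lemma factor_map_bij (nu : gtp -> gtp) (kap gam : elt -> elt -> elt) :
  (forall c k : elt, H (sval c) -> K (sval k) -> [/\ K (sval (kap c k)), H (sval (gam c k)) & nu (a c k) = e (kap c k) (gam c k)]) ->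
  (forall c k c' k' : elt, H (sval c) -> K (sval k) -> H (sval c') -> K (sval k') ->
     kap c k ~K kap c' k' -> gam c k ~H gam c' k' -> c ~H c' /\ k ~K k') ->
  (forall c k : elt, H (sval c) -> K (sval k) -> exists c' k' : elt, [/\ H (sval c'), K (sval k'), kap c' k' = k & gam c' k' = c]) ->
  set_bij setA setB nu.
Proof.
move=> Enu inj surj; split.
- move=> _ [_ [c Hc <-] [_ [k Kk <-] <-]]; have [Kk' Hc' ->] := Enu c k Hc Kk.
  by exists (uK · kap c k); [exists (kap c k)|exists (f (gam c k)); [exists (gam c k)|]].
- move=> _ _ /set_mem[_ [c Hc <-] [_ [k Kk <-] <-]] /set_mem[_ [c' Hc' <-] [_ [k' Kk' <-] <-]].
  have [Kk1 Hc1 ->] := Enu c k Hc Kk; have [Kk1' Hc1' ->] := Enu c' k' Hc' Kk'.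
  move=> /(nprod_KH_inj Kk1 Hc1 Kk1' Hc1')[hk hc].
  by have [-> ->] := inj _ _ _ _ Hc Kk Hc' Kk' hk hc.
- move=> _ [_ [k Kk <-] [_ [c Hc <-] <-]]; have [c' [k' [Hc' Kk' <- <-]]] := surj c k Hc Kk.
  have [_ _ <-] := Enu c' k' Hc' Kk'; exists (a c' k') => //.
  by exists (uH · c'); [exists c'|exists (uK · k'); [exists k'|]].
Qed.

Lemma K_M_bijection : exists nu, (forall p q, EhatH p -> EK q -> nu (op p q) = op q (K_M p)) /\ set_bij setA setB nu.
Proof.
have [nu Hnu] := factor_map (fun p q => op q (K_M p)); exists nu; split=> //.
apply: (factor_map_bij (kap := fun c k => k) (gam := fun c k => c^-1)).
- move=> c k Hc Kk; split=> //; first exact: HV.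
  by rewrite Hnu ?K_M_translate //; [exists c|exists k].
- move=> c k c' k' Hc Kk Hc' Kk' hk hc; split=> //.
  by rewrite -(invgK (c : elt)) -(invgK (c' : elt)); apply: eqvH_inv => //; exact: HV.
- by move=> c k Hc Kk; exists c^-1, k; split=> //; [exact: HV|rewrite invgK].
Qed.

(** A representative c satisfies c c ~ c, and cancelling leaves the class of 1. *)
Lemma idempotent_EH u : is_idempotent_of op EH u -> u = f 1.
Proof.
move=> [[c Hc <-]]; rewrite nprod_retraction // => /retraction_inj - /(_ (HM Hc Hc) Hc) h.
by apply: retraction_eqv => //; have := eqvH_mulr c^-1 h; rewrite mulgK mulgV.
Qed.

Lemma idempotent_EK u : is_idempotent_of op EK u -> u = uK.
Proof.
move=> [[k Kk <-]]; rewrite (nprod_translate_translate Usat Uhom smallU sM sK tK uuK Kk Kk) => h.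
have /(eqv_mulr Usat smallU sM sK tK k^-1) : k * k ~K k by exact: h.
by rewrite mulgK mulgV /eqv uK1.
Qed.

(** On representatives c k goes to k (k^-1 c k): the conjugation of types supplies the conjugation
    by k, and [iota] undoes the inversion in [K_M]. *)
Lemma semidirect_isomorphism u iota : is_idempotent_of op EH u -> group_inversion op EH u iota ->
  let arg p q := op (type_conj G H K (morley M (inv q) (K_M p))) u in
  (forall p q, EhatH p -> EK q -> EH (arg p q)) /\
  exists nu, [/\ forall p q, EhatH p -> EK q -> nu (op p q) = op q (iota (arg p q)),
    set_bij setA setB nu & forall r s, setA r -> setA s -> nu (op r s) = op (nu r) (nu s)].
Proof.
move=> /idempotent_EH -> hiota arg.
have arg_f (c k : elt) : H (sval c) -> K (sval k) -> arg (uH · c) (uK · k) = f (k^-1 * c^-1 * k).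
  by move=> Hc Kk; rewrite /arg K_M_translate type_conj_retraction //; exact: HV.
have iota_f (c : elt) : H (sval c) -> iota (f c) = f c^-1.
  move=> Hc; have [|[d Hd <-] E _] := hiota (f c); first by exists c.
  rewrite nprod_retraction // in E; have h := retraction_inj (HM Hc Hd) H1 E; apply: retraction_eqv => //; first exact: HV.
  have := eqv_mull Usat Uhom smallU sM sH tH (HM Hc Hd) H1 (HV Hc) h.
  by rewrite mulgA mulVg mul1g mulg1.
split.
  move=> _ _ [c Hc <-] [k Kk <-]; exists (k^-1 * c^-1 * k); last by rewrite arg_f.
  by apply: normal_HV; exact: HV.
have [nu Hnu] := factor_map (fun p q => op q (iota (arg p q))).
have nu_a (c k : elt) : H (sval c) -> K (sval k) -> nu (a c k) = e k (k^-1 * c * k).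
  move=> Hc Kk; rewrite Hnu; [|by exists c|by exists k].
  rewrite arg_f // iota_f; last by apply: normal_HV; exact: HV.
  by rewrite !invgM !invgK !mulgA.
exists nu; split=> //.
- apply: (factor_map_bij (kap := fun c k => k) (gam := fun c k => k^-1 * c * k)).
  + by move=> c k Hc Kk; split=> //; [exact: normal_HV|exact: nu_a].
  + move=> c k c' k' Hc Kk Hc' Kk' hk hc; split=> //.
    (* k and k' are only known to be in the same class, so [conj_eqvK] is needed to conjugate c' by
       k instead of k'. *)
    have h : k^-1 * c * k ~H k^-1 * c' * k.
      by rewrite /eqv hc; apply/esym; exact: (conj_eqvK Kk Kk' Hc' hk).
    have := eqvH_conj k (normal_HV k Hc) (normal_HV k Hc') h.
    by rewrite !mulgA !mulgK !mulgV !mul1g.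
  + move=> c k Hc Kk; exists (k * c * k^-1), k; split=> //; first exact: normal_H.
    by rewrite !mulgA mulgVK mulVg mul1g.
- move=> _ _ [_ [c Hc <-] [_ [k Kk <-] <-]] [_ [c' Hc' <-] [_ [k' Kk' <-] <-]].
  rewrite nprod_HK_mul // !nu_a //; [|by apply: HM => //; exact: normal_H|exact: KM].
  rewrite nprod_KH_mul //; [|exact: normal_HV|exact: normal_HV].
  by congr (op _ (f _)); rewrite !invgM !mulgA mulgVK mulgK.
Qed.

Lemma semidirect_anti_isomorphism u : is_idempotent_of op EK u ->
  exists nu, [/\ forall p q, EhatH p -> EK q -> nu (op p q) = op (op u (inv q)) (K_M p),
    set_bij setA setB nu & forall r s, setA r -> setA s -> nu (op r s) = op (nu s) (nu r)].
Proof.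
move=> /idempotent_EK ->.
have [nu Hnu] := factor_map (fun p q => op (op uK (inv q)) (K_M p)).
have nu_a (c k : elt) : H (sval c) -> K (sval k) -> nu (a c k) = e k^-1 c^-1.
  move=> Hc Kk; rewrite Hnu; [|by exists c|by exists k].
  by rewrite idempotent_type_inv // K_M_translate.
exists nu; split=> //.
- apply: (factor_map_bij (kap := fun c k => k^-1) (gam := fun c k => c^-1)).
  + by move=> c k Hc Kk; split; [exact: KV|exact: HV|exact: nu_a].
  + move=> c k c' k' Hc Kk Hc' Kk' hk hc; split.
      by rewrite -(invgK (c : elt)) -(invgK (c' : elt)); apply: eqvH_inv => //; exact: HV.
    by rewrite -(invgK (k : elt)) -(invgK (k' : elt)); apply: eqvK_inv => //; exact: KV.
  + by move=> c k Hc Kk; exists c^-1, k^-1; rewrite !invgK; split=> //; [exact: HV|exact: KV].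
- move=> _ _ [_ [c Hc <-] [_ [k Kk <-] <-]] [_ [c' Hc' <-] [_ [k' Kk' <-] <-]].
  rewrite nprod_HK_mul // !nu_a //; [|by apply: HM => //; exact: normal_H|exact: KM].
  rewrite nprod_KH_mul //; [|exact: KV|exact: HV|exact: KV|exact: HV].
  by rewrite !invgM !invgK !mulgA.
Qed.

End Idempotents.
End Semidirect.

(** * Passage to arbitrary Ellis subgroups *)

Theorem theorem6p13 (L : language) (T : set (form L void)) (U : structure L)
    (kappa : Type) (M : set U)
    (N' : structure (pair_language L)) (j : U -> N')
    (n : nat) (G : def_group U n) (H K : set (tup n U))
    (E_K Ehat_H : set (set (@gform L U 'I_n))) :
  models U T -> monster U kappa ->
  elem_substructure M -> card_lt kappa M ->
  NIP T ->
  saturated_pair M j ->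
  semidirect G H K ->
  fsg G M K -> dfg G M H ->
  let op := nprod G M in
  let K_M := K_map G M j in
  let F_M := @retraction L U M N' j 'I_n in
  let inv := type_inv G in
  ellis_subgroup op (S_fs M K) E_K ->
  ellis_subgroup op (S_inv M H) Ehat_H ->
  (forall p, Ehat_H p -> right_dfg G M H p) ->
  let E_H := [set K_M p | p in Ehat_H] in
  let A := set_op op Ehat_H E_K in
  let B := set_op op E_K E_H in
  E_H = [set inv p | p in [set F_M p | p in Ehat_H]] /\
  (* (1) *)
  ellis_subgroup op (S_fs M H) E_H /\
  (* (2) *)
  (ellis_subgroup op (S_inv M G) A /\ unique_factorization op Ehat_H E_K) /\
  (* (3) *)
  (ellis_subgroup op (S_fs M G) B /\ unique_factorization op E_K E_H) /\
  (* (4) *)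
  (exists f, (forall p q, Ehat_H p -> E_K q -> f (op p q) = op q (K_M p)) /\
     set_bij A B f) /\
  (* (5) *)
  (forall u_H iota, is_idempotent_of op E_H u_H -> group_inversion op E_H u_H iota ->
     let arg p q := op (type_conj G H K (morley M (inv q) (K_M p))) u_H in
     (forall p q, Ehat_H p -> E_K q -> E_H (arg p q)) /\
     exists nu, [/\ forall p q, Ehat_H p -> E_K q -> nu (op p q) = op q (iota (arg p q)),
       set_bij A B nu &
       forall r s, A r -> A s -> nu (op r s) = op (nu r) (nu s)]) /\
  (* (6) *)
  (forall u_K, is_idempotent_of op E_K u_K ->
     exists nu', [/\
       forall p q, Ehat_H p -> E_K q -> nu' (op p q) = op (op u_K (inv q)) (K_M p),
       set_bij A B nu' &
       forall r s, A r -> A s -> nu' (op r s) = op (nu' s) (nu' r)]).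
Proof.
move=> TU [kL Usat Uhom] eM sM nip sP sd fK _ op K_M F_M inv.
have smallU := @card_lt_setU L kappa kL U.
have small_image (A : set U) (f : U -> U) : card_lt kappa A -> card_lt kappa (f @` A) by exact: card_lt_image.
have small_countable := @card_lt_countable L kappa kL U.
have sH : def_subgroup G H by case: sd.
have sK : def_subgroup G K by case: sd.
have SG p : S_inv M H p -> S_inv M (gset G) p := @subgroup_Sinv _ _ _ Usat smallU _ _ _ sM _ p sH.
move=> [IK [uK [mIK IuK uuK EK]]] [IH [uH [mIH IuH uuH EH]]] dfgH E_H A B.
have EuH : Ehat_H uH by rewrite EH; exists uH.
have tH := right_dfg_translation_invariant (dfgH _ EuH).
have dfH (c : group_elt G) : H (sval c) -> definable_type M (translate_r G uH (sval c)).
  by move=> Hc; have [_ _ h] := dfgH _ EuH; exact: h.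
have tK := fsg_translation_invariant Usat Uhom smallU small_image eM sM sK fK mIK IuK.
have fsK : S_fs M K uK by case: mIK => -[_ IX _] _; exact: IX.
have XH : Ehat_H `<=` S_inv M H.
  by case: mIH => -[_ IX lI] _; rewrite EH => _ [x Ix <-]; apply: (IX); apply: lI => //; exact: IX.
have E1 : E_H = [set inv p | p in [set F_M p | p in Ehat_H]].
  have h p : Ehat_H p -> K_M p = inv (F_M p).
    by move=> /XH/SG Sp; exact: (F_inv Usat Uhom smallU small_countable eM sM sP TU nip Sp).
  apply/seteqP; split=> [_ [p Ep <-]|_ [_ [p Ep <-] <-]].
    by exists (F_M p); [exists p|rewrite h].
  by exists p; rewrite ?h.
split=> //.
(* The given Ellis subgroups are the sets of right translates of their idempotents, the form in
   which the preceding results apply. *)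
have EtH : Ehat_H = [set translate_r G uH (sval c) | c in [set c : group_elt G | H (sval c)]].
  rewrite EH; apply: (translates_eq_ellis Usat Uhom smallU sM sH tH uuH (X := S_inv M H)) => //.
  - by move=> p q; exact: (nprod_inv Usat Uhom smallU small_image sM sH).
  - by move=> c Hc; exact: (exists_inv_type eM sP sH Hc).
  - exact: tH.1.
have EtK : E_K = [set translate_r G uK (sval c) | c in [set c : group_elt G | K (sval c)]].
  rewrite EK; apply: (translates_eq_ellis Usat Uhom smallU sM sK tK uuK (X := S_fs M K)) => //.
  - by move=> p /fs_inv.
  - by move=> p q; exact: (nprod_fs Usat Uhom smallU eM sM sK).
  - by move=> c Kc; exact: (exists_fs_type eM sP sK Kc).
have EEH := K_M_image M j sd uH; rewrite -EtH in EEH.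
rewrite /A /B /E_H /K_M EEH EtH EtK.
split; first exact: (ellis_retraction Usat Uhom smallU small_image small_countable eM sM sP TU nip sd tH uuH dfH).
split.
  split; first exact: (ellis_HK Usat Uhom smallU small_image eM sM sP sd tH uuH tK uuK).
  exact: (unique_factorization_HK Usat Uhom smallU sM sd tH uuH tK).
split.
  split; first exact: (ellis_KH Usat Uhom smallU small_image small_countable eM sM sP TU nip sd tH uuH dfH tK uuK fsK).
  exact: (unique_factorization_KH Usat Uhom smallU small_countable eM sM sP TU nip sd tH uuH tK).
split; first exact: (K_M_bijection Usat Uhom smallU small_countable eM sM sP TU nip sd tH uuH tK).
split=> [u iota|u]; first exact: (semidirect_isomorphism Usat Uhom smallU small_image small_countable eM sM sP TU nip sd tH uuH dfH tK uuK fsK).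
exact: (semidirect_anti_isomorphism Usat Uhom smallU small_image small_countable eM sM sP TU nip sd tH uuH dfH tK uuK fsK).
Qed.
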